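(* Let $\{X_{\mu,i}\}$ be i.i.d. real random variables with common distribution function $F$, finite mean $\lambda=\mathrm{E}[X_{\mu,i}]$, and $\mathrm{Var}[X_{\mu,i}]>0$. Let $g$ be the shape function associated with $F$ and $\tilde g(v_1,v_2)=g(v_1,v_2)-\lambda(v_1+v_2)$. For each number of jobs $N$, let $M=M(N)\ge 1$ be the number of machines and $\nu=\nu(N)\in\{1,\dots,M\}$ the index of the fiducial machine, and assume that, as $N\to\infty$, $M=\kappa N+o(N)$ and $\nu=\tau M+o(M)$ for some constants $\kappa\ge 0$ and $\tau\in[0,1]$. Let $T(\nu)$ denote the makespan of the flowshop with $M$ machines, $N$ jobs, processing times $X_{\mu,i}$ ($1\le\mu\le M$, $1\le i\le N$), scheduled from the fiducial machine $\nu$. Then, as $N\to\infty$, $$\frac1N T(\nu)\ \longrightarrow\ g(\kappa(1-\tau),1)+g(\kappa\tau,1)-\lambda\ =\ \tilde g(\kappa(1-\tau),1)+\tilde g(\kappa\tau,1)+\lambda(\kappa+1)\quad\text{almost surely},$$ and $$\frac1N \mathrm{E}[T(\nu)]\ \longrightarrow\ g(\kappa(1-\tau),1)+g(\kappa\tau,1)-\lambda\ =\ \tilde g(\kappa(1-\tau),1)+\tilde g(\kappa\tau,1)+\lambda(\kappa+1).$$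
   Context: **Makespan with fiducial machine $\nu$.** There are $M$ machines in a line and $N$ jobs processed in the fixed order $1,\dots,N$; machine $\mu$ needs time $x_{\mu,i}=X_{\mu,i}$ for job $i$. For $\nu\in\{1,\dots,M\}$ define starting times $s_{\mu,i}$ and terminate times $t_{\mu,i}$ ($1\le\mu\le M$, $1\le i\le N$) as follows. (1) Fiducial machine: $s_{\nu,1}=0$, $t_{\nu,i}=s_{\nu,i}+x_{\nu,i}$, $s_{\nu,i+1}=t_{\nu,i}$. (2) Forward scheduling, for $\mu=\nu+1,\dots,M$ successively, and $i=1,\dots,N$ successively: $s_{\mu,i}=\max(t_{\mu,i-1},t_{\mu-1,i})$, $t_{\mu,i}=s_{\mu,i}+x_{\mu,i}$, where for $i=1$ the term $t_{\mu,0}$ is omitted. (3) Backward scheduling, for $\mu=\nu-1,\dots,1$ successively, and $i=N,\dots,1$ successively: $t_{\mu,i}=\min(s_{\mu,i+1},s_{\mu+1,i})$, $s_{\mu,i}=t_{\mu,i}-x_{\mu,i}$, where for $i=N$ the term $s_{\mu,N+1}$ is omitted. The makespan is $T(\nu)=t_{M,N}-s_{1,1}$. **Probability space.** The variables $X_{\mu,i}$ form a single i.i.d. array indexed by pairs of nonnegative integers $(\mu,i)$; for each $N$ the processing-time table consists of the entries with $1\le\mu\le M(N)$, $1\le i\le N$. **Shape function.** For $(m,n)\in\mathbb{Z}_{\ge0}^2$, $(m,n)\neq(0,0)$, let $$T_{m,n}=\max_{\gamma}\sum_{(\mu,i)\in\gamma}X_{\mu,i},$$ where $\gamma$ ranges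 over all shortest paths in the square grid graph from $(0,0)$ to $(m,n)$ (each step increases one coordinate by 1), each path identified with the set of its vertices; set $T_{0,0}=0$. The shape function $g$ on $\mathbb{R}_{\ge0}^2$ is the deterministic function such that for every $(v_1,v_2)\in\mathbb{R}_{\ge0}^2$, as $N\to\infty$, $$\tfrac1N T_{\lfloor Nv_1\rfloor,\lfloor Nv_2\rfloor}\to g(v_1,v_2)\ \text{almost surely},\qquad \tfrac1N\mathrm{E}[T_{\lfloor Nv_1\rfloor,\lfloor Nv_2\rfloor}]\to g(v_1,v_2).$$ The existence of $g$ is a known fact (via Kingman's subadditive ergodic theorem) and is taken as given.
   Formalization: The variance Var[X] is assumed finite as well as positive; with infinite variance (for example a heavy lower tail of order x^(-3/2), M=N, ν=⌈N/2⌉) the almost sure convergence fails. *)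

(* Defs.v *)
From HB Require Import structures.
From mathcomp Require Import all_boot all_order all_algebra.
From mathcomp Require Import all_classical all_reals all_analysis.

Set Implicit Arguments.
Unset Strict Implicit.
Unset Printing Implicit Defensive.

Import Order.TTheory GRing.Theory Num.Theory.
Import numFieldNormedType.Exports.

Local Open Scope classical_set_scope.
Local Open Scope ring_scope.

(* Machines and jobs are numbered from 1, as are the arguments of
   [x : nat -> nat -> R] ([x mu i] is the time machine [mu] needs for job [i]);
   values at out-of-range indices are irrelevant. *)
Section Flowshop.
Context {R : realType}.
Variables (N nu : nat) (x : nat -> nat -> R).

Fixpoint fiducial_start (i : nat) : R :=
  match i with
  | 0 | 1 => 0
  | j.+1 => fiducial_start j + x nu j
  end.

(* [y] is the row of processing times of the current machine and [t] the row
   of terminate times of the preceding one. *)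
Fixpoint forward_row (y t : nat -> R) (i : nat) : R :=
  match i with
  | 0 => 0
  | j.+1 => (if j == 0%N then t i else Num.max (forward_row y t j) (t i)) + y i
  end.

(* The jobs are run through downwards from [N], so the recursion is on
   [k = N - i]; [s] is the row of starting times of the following machine. *)
Fixpoint backward_row_rev (y s : nat -> R) (k : nat) : R :=
  match k with
  | 0 => s N
  | j.+1 => Num.min (backward_row_rev y s j) (s (N - k)%N)
  end - y (N - k)%N.

Definition backward_row (y s : nat -> R) (i : nat) : R :=
  backward_row_rev y s (N - i).

(* Terminate times on machine [nu + k]. *)
Fixpoint forward_term (k : nat) : nat -> R :=
  match k with
  | 0 => fun i => fiducial_start i + x nu i
  | j.+1 => forward_row (x (nu + k)%N) (forward_term j)
  end.

(* Starting times on machine [nu - k]. *)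
Fixpoint backward_start (k : nat) : nat -> R :=
  match k with
  | 0 => fiducial_start
  | j.+1 => backward_row (x (nu - k)%N) (backward_start j)
  end.

Definition start_time (mu i : nat) : R :=
  if (mu <= nu)%N then backward_start (nu - mu) i
  else forward_term (mu - nu) i - x mu i.

Definition term_time (mu i : nat) : R :=
  if (nu <= mu)%N then forward_term (mu - nu) i
  else backward_start (nu - mu) i + x mu i.

Definition makespan (M : nat) : R := term_time M N - start_time 1 1.

End Flowshop.

(* The scheduling rules, which determine [s] and [t] on the table
   [1 <= mu <= M], [1 <= i <= N]. *)
Record fiducial_schedule {R : realType} (M N nu : nat) (x s t : nat -> nat -> R)
    : Prop := FiducialSchedule {
  fiducial_start1 : s nu 1%N = 0;
  fiducial_term : forall i, (1 <= i <= N)%N -> t nu i = s nu i + x nu i;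
  fiducial_startS : forall i, (1 <= i < N)%N -> s nu i.+1 = t nu i;
  forward_startE : forall mu i, (nu < mu <= M)%N -> (1 <= i <= N)%N ->
    s mu i = if i == 1%N then t mu.-1 i else Num.max (t mu i.-1) (t mu.-1 i);
  forward_termE : forall mu i, (nu < mu <= M)%N -> (1 <= i <= N)%N ->
    t mu i = s mu i + x mu i;
  backward_termE : forall mu i, (1 <= mu < nu)%N -> (1 <= i <= N)%N ->
    t mu i = if i == N then s mu.+1 i else Num.min (s mu i.+1) (s mu.+1 i);
  backward_startE : forall mu i, (1 <= mu < nu)%N -> (1 <= i <= N)%N ->
    s mu i = t mu i - x mu i
}.

Lemma fiducial_scheduleP {R : realType} (M N nu : nat) (x : nat -> nat -> R) :
  fiducial_schedule M N nu x (start_time N nu x) (term_time N nu x).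
Proof.
split.
- by rewrite /start_time leqnn subnn.
- by move=> i _; rewrite /start_time /term_time leqnn subnn.
- move=> i /andP[i1 _]; rewrite /start_time /term_time leqnn subnn /=.
  by case: i i1.
- move=> mu i /andP[numu _] /andP[i1 _].
  have [k ->] : exists k, mu = (nu + k.+1)%N.
    by exists (mu - nu).-1; rewrite prednK ?subn_gt0// subnKC// ltnW.
  have nuk : (nu + k.+1 <= nu)%N = false.
    by rewrite -[X in (_ <= X)%N]addn0 leq_add2l.
  have -> : (nu + k.+1).-1 = (nu + k)%N by rewrite addnS.
  rewrite /start_time /term_time nuk !leq_addr !addKn /=.
  case: i i1 => // j _ /=; rewrite addrK eqSS.
  by case: j.
- move=> mu i /andP[numu _] _; rewrite /start_time /term_time.
  by rewrite [(mu <= nu)%N]leqNgt numu /= ltnW// subrK.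
- move=> mu i /andP[_ munu] /andP[i1 iN].
  rewrite /start_time /term_time leqNgt munu /= (ltnW munu).
  have [k E] : exists k, (nu - mu = k.+1)%N.
    by exists (nu - mu).-1; rewrite prednK ?subn_gt0.
  have E' : (nu - mu.+1 = k)%N by rewrite subnS E.
  have Emu : (nu - k.+1 = mu)%N by rewrite -E subKn// ltnW.
  rewrite E E' /= Emu /backward_row.
  have [->|iNN] := eqVneq i N; first by rewrite subnn /= subn0 subrK.
  have iltN : (i < N)%N by rewrite ltn_neqAle iNN.
  have [j F] : exists j, (N - i = j.+1)%N.
    by exists (N - i).-1; rewrite prednK ?subn_gt0.
  have F' : (N - i.+1 = j)%N by rewrite subnS F.
  have Fi : (N - j.+1 = i)%N by rewrite -F subKn.
  by rewrite F F' /= Fi subrK.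
- move=> mu i /andP[_ munu] _; rewrite /start_time /term_time.
  by rewrite [(nu <= mu)%N]leqNgt munu /= ltnW// addrK.
Qed.

Definition grid_step : rel (nat * nat) :=
  fun u v => (v == (u.1.+1, u.2)) || (v == (u.1, u.2.+1)).

(* The path consists of the vertices [(0, 0) :: p]. *)
Definition grid_path (m n : nat) (p : seq (nat * nat)) : Prop :=
  path grid_step (0%N, 0%N) p /\ last (0%N, 0%N) p = (m, n).

(* The set of path weights is finite and nonempty, so [sup] is a maximum. *)
Definition last_passage {R : realType} (x : nat -> nat -> R) (m n : nat) : R :=
  if (m == 0%N) && (n == 0%N) then 0
  else sup [set \sum_(z <- (0%N, 0%N) :: p) x z.1 z.2 | p in grid_path m n].

Definition mutually_independent d (Omega : measurableType d) (R : realType)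
    (P : probability Omega R) (X : nat -> nat -> {RV P >-> R}) : Prop :=
  forall (s : seq (nat * nat)) (A : nat * nat -> set R),
    uniq s -> (forall z, measurable (A z)) ->
    P (\bigcap_(z in [set` s]) (X z.1 z.2 @^-1` A z)) =
    (\prod_(z <- s) P (X z.1 z.2 @^-1` A z))%E.

(* For [v1, v2 >= 0], [Num.truncn (N%:R * v1)] is the floor of [N v1]. *)
Definition is_shape_function d (Omega : measurableType d) (R : realType)
    (P : probability Omega R) (X : nat -> nat -> {RV P >-> R})
    (g : R -> R -> R) : Prop :=
  forall v1 v2 : R, 0 <= v1 -> 0 <= v2 ->
  let T (N : nat) (w : Omega) := last_passage (fun mu i => X mu i w)
    (Num.truncn (N%:R * v1)) (Num.truncn (N%:R * v2)) in
  {ae P, forall w, (N%:R^-1 * T N w) @[N --> \oo] --> g v1 v2} /\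
  ((N%:R^-1)%:E * 'E_P[T N])%E @[N --> \oo] --> (g v1 v2)%:E.

Definition centered_shape {R : realType} (g : R -> R -> R) (lambda v1 v2 : R) : R :=
  g v1 v2 - lambda * (v1 + v2).

(* Main.v *)
(* Both halves of the schedule are last-passage problems. If [L k m n] denotes the
   passage time from the corner [(k, 1)] to [(k + m, 1 + n)], the makespan is
   [L nu (M - nu) (N - 1) + L 1 (nu - 1) (N - 1)] minus the total processing time of
   the fiducial machine. So one has to show [L k_N m_N (N - 1) / N --> g s 1], almost
   surely and in mean, whenever [m_N / N --> s] and [k_N = O(N)].

   In mean this follows from translation invariance, the monotonicity of the mean
   passage times of the centered weights and the continuity of [g s 1] in [s]. Almost
   surely, the corner moves with [N]; a maximal inequality for stationary sequences
   yields a good corner within distance [eta N], and the two corners are joined by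
   short vertical pieces whose weight is controlled by the law of large numbers.

   Continuity for [s > 0] is scaling. Continuity at [s = 0] has to be obtained from
   two moments and the finiteness of [g]: weights bounded above contribute nothing
   in thin strips by an exponential-moment bound, so a jump [c > 0] at the boundary
   would come from arbitrarily heavy weights; resampling the remaining light weights
   and shearing the array would then give a passage time close to [2 c N]. *)
Require Import Defs.
From HB Require Import structures.
From mathcomp Require Import all_boot all_order all_algebra.
From mathcomp Require Import all_classical all_reals all_analysis.
From mathcomp Require Import measurable_realfun.
From mathcomp Require Import zify ring lra.

Import Order.TTheory GRing.Theory Num.Theory.
Import numFieldNormedType.Exports.

Set Implicit Arguments.
Unset Strict Implicit.
Unset Printing Implicit Defensive.

Local Open Scope classical_set_scope.
Local Open Scope ring_scope.

(** * Last-passage times and the makespan *)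

(** The shape function controls passage times from the origin along exact rays only. For each fixed
    [N] the passage time from a moving corner has the law of the one from the origin, which settles
    the means. The joint law over all [N] is different, however, so almost sure convergence is not
    inherited. Summable deviation bounds are proved only for plain sums over [O(N)] cells; hence a
    strong law in which the cells may change with [N], and a maximal inequality for everything else.

    Weights of either sign are allowed, so mean passage times grow with the rectangle only after
    centering. The number of vertices of a path is deterministic, and removing the mean costs an
    explicit drift.

    In the boundary argument the heavy path must be chosen without looking at the light weights:
    only then can the mean gain of the light vertices between consecutive heavy ones be computed.
    This is why the light weights are replaced by an independent copy conditioned to be light, and
    why the result must be shown to have the original law. *)

(* The weight of the starting vertex [(0, 0)] is left out, which makes [lpp]
   superadditive under concatenation of paths. *)
Fixpoint lpp_rec {R : realType} (x : nat -> nat -> R) (m : nat) : nat -> R :=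
  match m with
  | 0 => fun n => \sum_(1 <= j < n.+1) x 0%N j
  | m'.+1 => fix row n := match n with
      | 0 => lpp_rec x m' 0%N + x m'.+1 0%N
      | n'.+1 => Num.max (lpp_rec x m' n'.+1) (row n') + x m'.+1 n'.+1
      end
  end.

HB.lock Definition lpp {R : realType} (x : nat -> nat -> R) (m n : nat) : R :=
  lpp_rec x m n.

Section LastPassage.
Context {R : realType}.
Implicit Types x y : nat -> nat -> R.

Definition translate x a b : nat -> nat -> R := fun i j => x (a + i)%N (b + j)%N.

Lemma lpp00 x : lpp x 0 0 = 0.
Proof. by rewrite lpp.unlock /= big_nil. Qed.

Lemma lpp0S x n : lpp x 0 n.+1 = lpp x 0 n + x 0%N n.+1.
Proof. by rewrite lpp.unlock /= big_nat_recr. Qed.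

Lemma lppS0 x m : lpp x m.+1 0 = lpp x m 0 + x m.+1 0%N.
Proof. by rewrite lpp.unlock. Qed.

Lemma lppSS x m n :
  lpp x m.+1 n.+1 = Num.max (lpp x m n.+1) (lpp x m.+1 n) + x m.+1 n.+1.
Proof. by rewrite lpp.unlock. Qed.

Lemma lpp0n x n : lpp x 0 n = \sum_(1 <= j < n.+1) x 0%N j.
Proof. by rewrite lpp.unlock. Qed.

Lemma lppn0 x m : lpp x m 0 = \sum_(1 <= i < m.+1) x i 0%N.
Proof.
elim: m => [|m IH]; first by rewrite lpp00 big_nil.
by rewrite lppS0 IH [in RHS]big_nat_recr.
Qed.

Lemma grid_ind (Q : nat -> nat -> Prop) :
  Q 0%N 0%N -> (forall m, Q m 0%N -> Q m.+1 0%N) ->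
  (forall n, Q 0%N n -> Q 0%N n.+1) ->
  (forall m n, Q m n.+1 -> Q m.+1 n -> Q m.+1 n.+1) ->
  forall m n, Q m n.
Proof.
move=> Q00 QS0 Q0S QSS; elim=> [|m IHm]; first by elim.
by elim=> [|n IHn]; [exact: QS0 | exact: QSS].
Qed.

Lemma eq_lpp x y m n :
  (forall i j, (i <= m)%N -> (j <= n)%N -> (0 < i + j)%N -> x i j = y i j) ->
  lpp x m n = lpp y m n.
Proof.
elim/grid_ind: m / n => [|m IH|n IH|m n IH1 IH2] xy.
- by rewrite !lpp00.
- by rewrite !lppS0 xy// IH// => i j im; apply: xy; rewrite leqW.
- by rewrite !lpp0S xy// IH// => i j im jn; apply: xy => //; rewrite leqW.
- rewrite !lppSS xy// IH1; last by move=> i j im; apply: xy; rewrite leqW.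
  by rewrite IH2// => i j im jn; apply: xy => //; rewrite leqW.
Qed.

Lemma translate_translate x a b c d :
  translate (translate x a b) c d = translate x (a + c) (b + d).
Proof. by apply/funext => i; apply/funext => j; rewrite /translate !addnA. Qed.

Lemma lpp_super x m n p q :
  lpp x m n + lpp (translate x m n) p q <= lpp x (m + p) (n + q).
Proof.
elim/grid_ind: p / q => [|p IH|q IH|p q IH1 IH2].
- by rewrite lpp00 !addn0 addr0.
- rewrite lppS0 addrA; move: IH; rewrite addn0 addnS => IH.
  case: n IH => [|n] IH; first by rewrite lppS0 /translate addnS lerD2r.
  by rewrite lppSS /translate addn0 addnS lerD2r le_max IH.
- rewrite lpp0S addrA; move: IH; rewrite addn0 addnS => IH.
  case: m IH => [|m] IH; first by rewrite lpp0S /translate addnS lerD2r.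
  by rewrite lppSS /translate addn0 addnS lerD2r le_max IH orbT.
- rewrite lppSS addrA !addnS lppSS /translate !addnS lerD2r addr_maxr ge_max !le_max.
  by rewrite -addnS IH1 -addnS IH2 orbT.
Qed.

Lemma lpp_first0 x n : lpp x 0 n.+1 = x 0%N 1%N + lpp (translate x 0 1) 0 n.
Proof.
elim: n => [|n IH]; first by rewrite lpp0S !lpp00 add0r addr0.
by rewrite lpp0S IH lpp0S addrA.
Qed.

Lemma lpp_first1 x m : lpp x m.+1 0 = x 1%N 0%N + lpp (translate x 1 0) m 0.
Proof.
elim: m => [|m IH]; first by rewrite lppS0 !lpp00 add0r addr0.
by rewrite lppS0 IH lppS0 addrA.
Qed.

(** Splits off the first step instead of the last one: backward scheduling proceeds towards the
    starting corner, and its recursion is this one. *)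
Lemma lpp_first x m n : lpp x m.+1 n.+1 =
  Num.max (x 1%N 0%N + lpp (translate x 1 0) m n.+1)
          (x 0%N 1%N + lpp (translate x 0 1) m.+1 n).
Proof.
elim/grid_ind: m / n => [|m IH|n IH|m n IH1 IH2].
- by rewrite lppSS lppS0 !lpp0S lppS0 !lpp00 !add0r addr_maxl maxC.
- rewrite lppSS IH (lpp_first1 x m.+1) (lppSS (translate x 1 0)).
  rewrite !(lppS0 (translate x 0 1)) !addrA addr_maxr !addr_maxl -!maxA.
  by rewrite [X in _ = Num.max _ X]maxC.
- rewrite lppSS IH (lpp_first0 x n.+1) (lppSS (translate x 0 1)).
  rewrite !(lpp0S (translate x 1 0)).
  by rewrite !addrA addr_maxr !addr_maxl maxCA.
- rewrite lppSS IH1 IH2 (lppSS (translate x 1 0) m n.+1).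
  rewrite (lppSS (translate x 0 1) m.+1 n).
  by rewrite !addrA !addr_maxr !addr_maxl maxACA.
Qed.

Lemma lpp_ge_corner x m n :
  \sum_(1 <= i < m.+1) x i 0%N + \sum_(1 <= j < n.+1) x m j <= lpp x m n.
Proof.
have := lpp_super x m 0 0 n; rewrite addn0 add0n lppn0 lpp0n.
by under [X in _ + X]eq_bigr do rewrite /translate addn0.
Qed.

Lemma ler_lpp x y m n :
  (forall i j, (i <= m)%N -> (j <= n)%N -> x i j <= y i j) ->
  lpp x m n <= lpp y m n.
Proof.
elim/grid_ind: m / n => [|m IH|n IH|m n IH1 IH2] xy.
- by rewrite !lpp00.
- by rewrite !lppS0 lerD ?xy// IH// => i j im; apply: xy; rewrite leqW.
- by rewrite !lpp0S lerD ?xy// IH// => i j im jn; apply: xy => //; rewrite leqW.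
- rewrite !lppSS lerD ?xy// ge_max !le_max IH1; last first.
    by move=> i j im; apply: xy; rewrite leqW.
  by rewrite IH2 ?orbT// => i j im jn; apply: xy => //; rewrite leqW.
Qed.

(** A path that is optimal for the sum is admissible for each summand. *)
Lemma lppD_le x y m n :
  lpp (fun i j => x i j + y i j) m n <= lpp x m n + lpp y m n.
Proof.
elim/grid_ind: m / n => [|m IH|n IH|m n IH1 IH2].
- by rewrite !lpp00 addr0.
- by rewrite !lppS0 [leRHS]addrACA lerD2r.
- by rewrite !lpp0S [leRHS]addrACA lerD2r.
- rewrite !lppSS [leRHS]addrACA lerD2r ge_max.
  by rewrite (le_trans IH1) ?(le_trans IH2)// lerD// le_max lexx ?orbT.
Qed.

(** All paths from [(0, 0)] to [(m, n)] have [m + n] vertices besides the origin, so a constant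
    shift favours none of them. *)
Lemma lppDcst x (c : R) m n :
  lpp (fun i j => x i j + c) m n = lpp x m n + c *+ (m + n).
Proof.
elim/grid_ind: m / n => [|m IH|n IH|m n IH1 IH2].
- by rewrite !lpp00 addr0.
- by rewrite !lppS0 IH addSn mulrSr addrACA.
- by rewrite !lpp0S IH addnS mulrSr addrACA.
- by rewrite !lppSS IH1 IH2 addSnnS [(m.+1 + _)%N]addSn mulrSr -addr_maxl [RHS]addrACA.
Qed.

End LastPassage.

(** * The makespan in terms of two passage times *)

Section MakespanLastPassage.
Context {R : realType}.
Implicit Types x : nat -> nat -> R.

Lemma fiducial_startS_sum nu x i :
  fiducial_start nu x i.+1 = \sum_(1 <= j < i.+1) x nu j.
Proof.
elim: i => [|i IH]; first by rewrite big_nil.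
by rewrite [LHS]/= -/(fiducial_start nu x i.+1) IH [in RHS]big_nat_recr.
Qed.

(** Forward scheduling is the last-step recursion of [lpp]; the weight of the corner [(nu, 1)], left
    out by [lpp], is added separately. *)
Lemma forward_term_lpp nu x k i :
  forward_term nu x k i.+1 = x nu 1%N + lpp (translate x nu 1) k i.
Proof.
elim: k i => [|k IHk] i.
  rewrite [LHS]/= -/(fiducial_start nu x i.+1) fiducial_startS_sum lpp0n.
  rewrite -big_nat_recr//= big_nat_recl//; congr (_ + _).
  by apply: eq_bigr => j _; rewrite /translate addn0.
elim: i => [|i IHi].
  by rewrite [LHS]/= IHk lppS0 addrA /translate addn0.
have -> : forward_term nu x k.+1 i.+2 =
  Num.max (forward_term nu x k.+1 i.+1) (forward_term nu x k i.+2) +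
  x (nu + k.+1)%N i.+2 by [].
rewrite IHi.
by rewrite IHk lppSS addrA /translate addr_maxr maxC.
Qed.

(** Measured back from the end of the fiducial row, the minima of backward scheduling become maxima
    and its recursion becomes [lpp_first]. Jobs are written [N - j] because [backward_row_rev]
    recurses on the distance to [N]. *)
Lemma backward_start_lpp N nu x k j : (k <= nu)%N -> (j < N)%N ->
  backward_start N nu x k (N - j) = \sum_(1 <= l < N.+1) x nu l -
    (x (nu - k)%N (N - j)%N + lpp (translate x (nu - k) (N - j)) k j).
Proof.
elim: k j => [|k IHk] j knu jN.
  rewrite subn0 lpp0n /=.
  have [i Ni] : exists i, (N - j = i.+1)%N.
    by exists (N - j).-1; rewrite prednK// subn_gt0.
  rewrite Ni fiducial_startS_sum.
  rewrite (@big_cat_nat _ _ _ i.+1 1%N N.+1)//=; last by lia.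
  rewrite (@big_ltn _ _ _ i.+1 N.+1); last by lia.
  rewrite (big_addn 1 N.+1 i.+1) (_ : N.+1 - i.+1 = j.+1)%N; last by lia.
  rewrite -[LHS]addr0 -addrA; congr (_ + _).
  under [X in _ = _ - (_ + X)]eq_bigr do rewrite /translate addn0 addnC.
  by rewrite subrr.
have Enu : (nu - k.+1).+1 = (nu - k)%N by rewrite subnSK.
have -> : backward_start N nu x k.+1 (N - j) =
    backward_row_rev N (x (nu - k.+1)%N) (backward_start N nu x k) j.
  by rewrite [LHS]/= /backward_row (_ : N - (N - j) = j)%N; last by lia.
elim: j jN => [|j IHj] jN.
  have -> : backward_row_rev N (x (nu - k.+1)%N) (backward_start N nu x k) 0 =
    backward_start N nu x k N - x (nu - k.+1)%N (N - 0)%N by [].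
  have := IHk 0%N (ltnW knu) jN; rewrite !subn0 => ->.
  rewrite lpp_first1 translate_translate addn0 addn1 Enu.
  by rewrite /translate addn0 addn1 Enu; ring.
have -> : backward_row_rev N (x (nu - k.+1)%N) (backward_start N nu x k) j.+1 =
  Num.min (backward_row_rev N (x (nu - k.+1)%N) (backward_start N nu x k) j)
    (backward_start N nu x k (N - j.+1)) - x (nu - k.+1)%N (N - j.+1)%N by [].
have ENj : (N - j.+1).+1 = (N - j)%N by rewrite subnSK// ltnW.
rewrite IHj ?(ltnW jN)// IHk ?(ltnW knu)//.
rewrite lpp_first !translate_translate !addn0 !addn1 Enu ENj.
rewrite [X in Num.max (X + _)]/translate addn0 addn1 Enu.
rewrite [X in Num.max _ (X + _)]/translate addn0 addn1 ENj.
by rewrite -addr_minr -oppr_max maxC; ring.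
Qed.

Lemma makespan_lpp N nu x M : (0 < N)%N -> (0 < nu <= M)%N ->
  makespan N nu x M =
    x nu 1%N + lpp (translate x nu 1) (M - nu) N.-1 +
    (x 1%N 1%N + lpp (translate x 1 1) nu.-1 N.-1) -
    \sum_(1 <= j < N.+1) x nu j.
Proof.
move=> N0 /andP[nu0 nuM]; rewrite /makespan /term_time /start_time nuM nu0.
rewrite -[X in forward_term _ _ _ X](prednK N0) forward_term_lpp.
rewrite -[X in backward_start _ _ _ _ X](_ : N - N.-1 = 1)%N; last by lia.
rewrite backward_start_lpp; [|lia|lia].
rewrite (_ : nu - (nu - 1) = 1)%N; last by lia.
by rewrite (_ : N - N.-1 = 1)%N ?subn1; [ring|lia].
Qed.

Lemma grid_path_le p (u : nat * nat) : path grid_step u p ->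
  (u.1 <= (last u p).1)%N /\ (u.2 <= (last u p).2)%N.
Proof.
elim: p u => //= v p IH u /andP[uv /IH[h1 h2]].
by split; [apply: leq_trans h1|apply: leq_trans h2]; case/orP: uv => /eqP->/=.
Qed.

Lemma translate10 x a b : translate x a b 1 0 = x a.+1 b.
Proof. by rewrite /translate addn1 addn0. Qed.

Lemma translate01 x a b : translate x a b 0 1 = x a b.+1.
Proof. by rewrite /translate addn1 addn0. Qed.

Lemma path_weight_le x p a b m n : path grid_step (a, b) p ->
  last (a, b) p = (a + m, b + n)%N ->
  \sum_(z <- p) x z.1 z.2 <= lpp (translate x a b) m n.
Proof.
elim: p a b m n => [|v p IH] a b m n /=.
  move=> _ [] /eqP; rewrite -[X in X == _]addn0 eqn_add2l => /eqP<-.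
  move=> /eqP; rewrite -[X in X == _]addn0 eqn_add2l => /eqP<-.
  by rewrite big_nil lpp00.
move=> /andP[/orP[]/eqP-> vp] lp; have [/= + +] := grid_path_le vp;
  rewrite lp big_cons /=.
  case: m lp => [|m] lp; first by rewrite addn0 ltnn.
  move=> _ _; have := IH a.+1 b m n vp; rewrite lp addSnnS => /(_ erefl) h.
  case: n lp h => [|n] lp h.
    by rewrite lpp_first1 translate_translate translate10 addn0 addn1 lerD2l.
  rewrite lpp_first !translate_translate !addn0 !addn1 le_max.
  by rewrite translate10 lerD2l h.
case: n lp => [|n] lp; first by rewrite addn0 ltnn.
move=> _ _; have := IH a b.+1 m n vp; rewrite lp addSnnS => /(_ erefl) h.
case: m lp h => [|m] lp h.
  by rewrite lpp_first0 translate_translate translate01 addn0 addn1 lerD2l.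
rewrite lpp_first !translate_translate !addn0 !addn1 le_max.
by rewrite translate01 lerD2l h orbT.
Qed.

Lemma path_weight_attained x m n a b : exists p, [/\ path grid_step (a, b) p,
  last (a, b) p = (a + m, b + n)%N &
  \sum_(z <- p) x z.1 z.2 = lpp (translate x a b) m n].
Proof.
move: a b; elim/grid_ind: m / n => [|m IH|n IH|m n IH1 IH2] a b.
- by exists [::]; rewrite big_nil lpp00 !addn0.
- have [p [pp lp sp]] := IH a.+1 b; exists ((a.+1, b) :: p).
  rewrite /= {1}/grid_step eqxx/= pp lp addSnnS big_cons sp lpp_first1.
  by rewrite translate_translate translate10 addn0 addn1.
- have [p [pp lp sp]] := IH a b.+1; exists ((a, b.+1) :: p).
  rewrite /= {1}/grid_step eqxx orbT/= pp lp addSnnS big_cons sp lpp_first0.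
  by rewrite translate_translate translate01 addn0 addn1.
rewrite lpp_first !translate_translate !addn0 !addn1 translate10 translate01.
have [_|_] := leP (x a.+1 b + lpp (translate x a.+1 b) m n.+1) _.
- have [p [pp lp sp]] := IH2 a b.+1; exists ((a, b.+1) :: p).
  by rewrite /= {1}/grid_step eqxx orbT/= pp lp addSnnS big_cons sp.
- have [p [pp lp sp]] := IH1 a.+1 b; exists ((a.+1, b) :: p).
  by rewrite /= {1}/grid_step eqxx/= pp lp addSnnS big_cons sp.
Qed.

(** [last_passage] counts the weight of the origin and [lpp] does not; the origin itself is excluded
    because [last_passage] is 0 there by convention. *)
Lemma last_passage_lpp x m n : (0 < m + n)%N ->
  last_passage x m n = x 0%N 0%N + lpp x m n.
Proof.
move=> mn0; rewrite /last_passage ifF; last by lia.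
set S := [set _ | _ in _].
have Sub : ubound S (x 0%N 0%N + lpp x m n).
  move=> _ [p [pp lp] <-]; rewrite big_cons lerD2l.
  by apply: (@path_weight_le x p 0 0 m n pp); rewrite lp !add0n.
have Smax : S (x 0%N 0%N + lpp x m n).
  have [p [pp lp sp]] := path_weight_attained x m n 0 0.
  by exists p => //; rewrite big_cons sp.
apply/eqP; rewrite eq_le; apply/andP; split.
- by apply: ge_sup => //; exists (x 0%N 0%N + lpp x m n).
- by apply: ub_le_sup => //; exists (x 0%N 0%N + lpp x m n).
Qed.

End MakespanLastPassage.

(** * Laws of random arrays *)

Section Arrays.
Context {R : realType}.

Definition cyl_box (s : seq (nat * nat)) (A : nat * nat -> set R) :
  set (nat -> nat -> R) := [set x | forall z, z \in s -> A z (x z.1 z.2)].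

Definition cylinders : set (set (nat -> nat -> R)) :=
  [set B | exists s A, [/\ uniq s, forall z, measurable (A z) & B = cyl_box s A]].

(** Cylinders thus form a pi-system generating the sigma-algebra of [arrayT], so that a probability
    on arrays is determined by its values on them. *)
Lemma cylinders_setI : setI_closed cylinders.
Proof.
move=> _ _ [s [A [us mA ->]]] [s' [A' [us' mA' ->]]].
exists (undup (s ++ s')).
exists (fun z => (if z \in s then A z else setT) `&` (if z \in s' then A' z else setT)).
split; first exact: undup_uniq.
  by move=> z; apply: measurableI; case: ifP.
apply/seteqP; split=> x /=.
  move=> [xs xs'] z; rewrite mem_undup mem_cat => _; split; case: ifP => //.
    exact: xs.
  exact: xs'.
move=> h; split=> z zs.
  by have := h z; rewrite mem_undup mem_cat zs => /(_ isT)[].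
by have := h z; rewrite mem_undup mem_cat zs orbT => /(_ isT)[].
Qed.

Lemma cyl_box_nil A : cyl_box [::] A = setT.
Proof. by apply/seteqP; split => x. Qed.

Lemma cyl_box1 z A : cyl_box [:: z] A = (fun x => x z.1 z.2) @^-1` A z.
Proof.
apply/seteqP; split=> x /=; first by apply; rewrite inE.
by move=> Ax z'; rewrite inE => /eqP->.
Qed.

Lemma cyl_box_bigcap s A : cyl_box s A =
  \bigcap_(z in [set` s]) ((fun x => x z.1 z.2) @^-1` A z).
Proof. by []. Qed.

End Arrays.

Notation arrayT R := (g_sigma_algebraType (@cylinders R)).

Section ArrayMeasurability.
Context {R : realType}.

Lemma measurable_entry i j : measurable_fun setT (fun x : arrayT R => x i j).
Proof.
move=> _ B mB; rewrite setTI; apply: sub_sigma_algebra.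
exists [:: (i, j)], (fun=> B); split => //.
by rewrite cyl_box1.
Qed.

Lemma measurable_arrayP d (T : measurableType d) (X : T -> arrayT R) :
  (forall i j, measurable_fun setT (fun w => X w i j)) -> measurable_fun setT X.
Proof.
move=> mX.
have := @measurability _ _ T (arrayT R) setT X (@cylinders R) erefl.
apply.
move=> _ [_ [s [A [us mA ->]]] <-]; rewrite setTI cyl_box_bigcap preimage_bigcap.
rewrite bigcap_seq; apply: bigsetI_measurable => z _.
by have := mX z.1 z.2 measurableT _ (mA z); rewrite setTI.
Qed.

Lemma measurable_translate a b :
  measurable_fun setT (fun x : arrayT R => translate x a b : arrayT R).
Proof. by apply: measurable_arrayP => i j; exact: measurable_entry. Qed.

Lemma measurable_lpp m n : measurable_fun setT (fun x : arrayT R => lpp x m n).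
Proof.
elim/grid_ind: m / n => [|m IH|n IH|m n IH1 IH2].
- by rewrite (funext (@lpp00 R)).
- rewrite (funext (fun x => @lppS0 R x m)).
  by apply: measurable_funD => //; exact: measurable_entry.
- rewrite (funext (fun x => @lpp0S R x n)).
  by apply: measurable_funD => //; exact: measurable_entry.
- rewrite (funext (fun x => @lppSS R x m n)).
  by apply: measurable_funD; [exact: measurable_maxr|exact: measurable_entry].
Qed.

End ArrayMeasurability.

Section Laws.
Context {R : realType}.
Implicit Types (mm : nat * nat -> set R -> \bar R).

(** The marginal [mm z] may depend on the cell, in order to cover arrays that are set to 0 off a
    finite box. *)
Definition indep_law d (T : measurableType d) (P : {measure set T -> \bar R})
    (X : T -> arrayT R) mm : Prop :=
  forall (s : seq (nat * nat)) (A : nat * nat -> set R),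
    uniq s -> (forall z, measurable (A z)) ->
    P (X @^-1` cyl_box s A) = (\prod_(z <- s) mm z (A z))%E.

Definition same_law d (T : measurableType d) (P : {measure set T -> \bar R})
    (X : T -> arrayT R) d' (T' : measurableType d')
    (P' : {measure set T' -> \bar R}) (X' : T' -> arrayT R) : Prop :=
  [/\ measurable_fun setT X, measurable_fun setT X' &
    forall B, measurable B -> P (X @^-1` B) = P' (X' @^-1` B)].

Lemma indep_law_unique d (T : measurableType d) (P : {measure set T -> \bar R})
    (X : T -> arrayT R) d' (T' : measurableType d')
    (P' : {measure set T' -> \bar R}) (X' : T' -> arrayT R) mm :
  measurable_fun setT X -> measurable_fun setT X' ->
  indep_law P X mm -> indep_law P' X' mm -> same_law P X P' X'.
Proof.
move=> mX mX' iX iX'; split => // B mB.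
pose mX_ := isMeasurableFun.Build _ _ _ _ _ mX.
pose X_ : {mfun _ >-> _} := HB.pack X mX_.
pose mX'_ := isMeasurableFun.Build _ _ _ _ _ mX'.
pose X'_ : {mfun _ >-> _} := HB.pack X' mX'_.
apply: (@g_sigma_algebra_measure_unique _ R (arrayT R) (@cylinders R) _
  (fun=> setT) _ _ (pushforward P X_) (pushforward P' X'_)) => //.
- by move=> A cA; exact: sub_sigma_algebra.
- by move=> _; exists [::], (fun=> setT); rewrite cyl_box_nil.
- by rewrite bigcup_const//; exists 0%N.
- exact: cylinders_setI.
- move=> _ [s [A [us mA ->]]].
  by transitivity (\prod_(z <- s) mm z (A z))%E; [exact: iX|exact/esym/iX'].
- move=> _; have := iX [::] (fun=> setT) isT (fun=> measurableT).
  by rewrite big_nil cyl_box_nil => PX; rewrite [X in (X < _)%E]PX ltry.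
Qed.

Section same_law_integral.
Context d (T : measurableType d) (P : {measure set T -> \bar R})
  (X : T -> arrayT R) d' (T' : measurableType d')
  (P' : {measure set T' -> \bar R}) (X' : T' -> arrayT R).
Hypothesis XX' : same_law P X P' X'.
Variables (f : arrayT R -> R).
Hypothesis mf : measurable_fun setT f.

Let ge0_same_law (g : arrayT R -> \bar R) : measurable_fun setT g ->
  (forall x, 0 <= g x)%E ->
  (\int[P]_w g (X w) = \int[P']_w g (X' w))%E.
Proof.
move=> mg g0; have [mX mX' E] := XX'.
pose mX_ := isMeasurableFun.Build _ _ _ _ _ mX.
pose X_ : {mfun _ >-> _} := HB.pack X mX_.
pose mX'_ := isMeasurableFun.Build _ _ _ _ _ mX'.
pose X'_ : {mfun _ >-> _} := HB.pack X' mX'_.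
have H1 := @ge0_integral_pushforward _ _ _ _ R X mX P setT g measurableT mg (fun x _ => g0 x).
have H2 := @ge0_integral_pushforward _ _ _ _ R X' mX' P' setT g measurableT mg (fun x _ => g0 x).
rewrite preimage_setT in H1; rewrite preimage_setT in H2.
rewrite -[LHS]H1 -[RHS]H2.
apply: (@eq_measure_integral _ _ R setT (pushforward P' X'_) (pushforward P X_)).
by move=> A mA _; exact: E.
Qed.

Lemma same_law_integral :
  (\int[P]_w (f (X w))%:E = \int[P']_w (f (X' w))%:E)%E.
Proof.
have mEf : measurable_fun setT (EFin \o f) by exact/measurable_EFinP.
rewrite integralE [RHS]integralE; congr (_ - _)%E.
- have := @ge0_same_law _ (measurable_funepos mEf) (funepos_ge0 _).
  by rewrite -[LHS]/(\int[P]_w ((EFin \o f)^\+ \o X) w)%E -funepos_comp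
    -[RHS]/(\int[P']_w ((EFin \o f)^\+ \o X') w)%E -funepos_comp.
- have := @ge0_same_law _ (measurable_funeneg mEf) (funeneg_ge0 _).
  by rewrite -[LHS]/(\int[P]_w ((EFin \o f)^\- \o X) w)%E -funeneg_comp
    -[RHS]/(\int[P']_w ((EFin \o f)^\- \o X') w)%E -funeneg_comp.
Qed.

Lemma same_law_Rintegral : \int[P]_w f (X w) = \int[P']_w f (X' w).
Proof. by rewrite /Rintegral same_law_integral. Qed.

Lemma same_law_integrable : P.-integrable setT (fun w => (f (X w))%:E) ->
  P'.-integrable setT (fun w => (f (X' w))%:E).
Proof.
have [mX mX' _] := XX'.
move=> /integrableP[_ foo]; apply/integrableP; split.
  by apply/measurable_EFinP; exact: measurableT_comp.
rewrite (le_lt_trans _ foo)// le_eqVlt; apply/orP; left; apply/eqP/esym.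
apply: (ge0_same_law (g := fun x => `|(f x)%:E|%E)) => //.
by apply: measurableT_comp => //; exact/measurable_EFinP.
Qed.

End same_law_integral.

End Laws.

(** * Integrability and expectation of real functions *)

Section Integ.
Context {R : realType} d (T : measurableType d) (P : probability T R).
Implicit Types f g : T -> R.

Definition integ f : Prop := P.-integrable setT (fun w => (f w)%:E).

Lemma integ_measurable f : integ f -> measurable_fun setT f.
Proof. by move=> /integrableP[/measurable_EFinP]. Qed.

Lemma integ_cst c : integ (fun=> c).
Proof. exact: finite_measure_integrable_cst. Qed.

Lemma integD f g : integ f -> integ g -> integ (fun w => f w + g w).
Proof. by move=> fi gi; exact: (integrableD measurableT fi gi). Qed.

Lemma integB f g : integ f -> integ g -> integ (fun w => f w - g w).
Proof. by move=> fi gi; exact: (integrableB measurableT fi gi). Qed.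

Lemma integZ c f : integ f -> integ (fun w => c * f w).
Proof. by move=> fi; exact: (integrableZl measurableT c fi). Qed.

Lemma integ_norm f : integ f -> integ (fun w => `|f w|).
Proof. exact: integrable_norm. Qed.

Lemma integ_le f g : measurable_fun setT f -> integ g ->
  (forall w, `|f w| <= g w) -> integ f.
Proof.
move=> mf gi fg; apply: le_integrable gi => //; first exact/measurable_EFinP.
by move=> w _; rewrite /= lee_fin (le_trans (fg w))// ler_norm.
Qed.

Lemma integ_sum (I : Type) (r : seq I) (Q : pred I) (F : I -> T -> R) :
  (forall i, integ (F i)) -> integ (fun w => \sum_(i <- r | Q i) F i w).
Proof.
move=> Fi; rewrite /integ; under eq_fun do rewrite -sumEFin.
apply: (@integrable_sum _ _ _ P setT _ I r Q (fun i w => (F i w)%:E)) => // i _; exact: Fi.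
Qed.

Lemma integ_max f g : integ f -> integ g -> integ (fun w => Num.max (f w) (g w)).
Proof.
move=> fi gi; apply: (@integ_le _ (fun w => `|f w| + `|g w|)).
- by apply: measurable_maxr; exact: integ_measurable.
- by apply: integD; exact: integ_norm.
- by move=> w; have [_|_] := leP (f w) (g w); rewrite ?lerDl ?lerDr.
Qed.

Lemma expD f g : integ f -> integ g ->
  \int[P]_w (f w + g w) = \int[P]_w f w + \int[P]_w g w.
Proof. by move=> fi gi; rewrite RintegralD. Qed.

Lemma expB f g : integ f -> integ g ->
  \int[P]_w (f w - g w) = \int[P]_w f w - \int[P]_w g w.
Proof. by move=> fi gi; rewrite RintegralB. Qed.

Lemma expZ c f : integ f -> \int[P]_w (c * f w) = c * \int[P]_w f w.
Proof. by move=> fi; rewrite RintegralZl. Qed.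

Lemma exp_cst c : \int[P]_w c = c.
Proof. by rewrite Rintegral_cst//= probability_setT/= mulr1. Qed.

Lemma exp_sum (I : Type) (r : seq I) (F : I -> T -> R) :
  (forall i, integ (F i)) ->
  \int[P]_w (\sum_(i <- r) F i w) = \sum_(i <- r) \int[P]_w F i w.
Proof.
move=> Fi; elim: r => [|i r IH].
  by under eq_Rintegral do rewrite big_nil; rewrite big_nil exp_cst.
under eq_Rintegral do rewrite big_cons.
by rewrite big_cons -IH expD//; exact: integ_sum.
Qed.

Lemma exp_le f g : integ f -> integ g -> (forall w, f w <= g w) ->
  \int[P]_w f w <= \int[P]_w g w.
Proof. by move=> fi gi fg; apply: le_Rintegral. Qed.

Lemma integ_bounded f c : measurable_fun setT f -> (forall w, `|f w| <= c) ->
  integ f.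
Proof. by move=> mf fc; apply: (integ_le mf (integ_cst c)). Qed.

Lemma expectation_Rintegral f : integ f -> 'E_P[f]%E = (\int[P]_w f w)%:E.
Proof.
by move=> fi; rewrite unlock /Rintegral fineK//; exact: integrable_fin_num.
Qed.

(** A finite integral leaves no room for an infinite positive or negative part, so a real mean
    already carries integrability. *)
Lemma expectation_integ f c : measurable_fun setT f -> 'E_P[f]%E = c%:E -> integ f.
Proof.
move=> mf; rewrite unlock => Ef.
have mEf : measurable_fun setT (fun w => (f w)%:E) by exact/measurable_EFinP.
apply/integrableP; split => //.
by rewrite integral_fin_num_abs// Ef.
Qed.

End Integ.

Section Product.
Context {R : realType} d (T : measurableType d) (P : probability T R)
  d' (T' : measurableType d') (P' : probability T' R).

Lemma integ_prodM (f : T -> R) (g : T' -> R) : integ P f -> integ P' g ->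
  (P \x P')%E.-integrable setT (fun w => (f w.1 * g w.2)%:E).
Proof.
move=> fi gi.
have mfg : measurable_fun setT (fun w : T * T' => (f w.1 * g w.2)%:E).
  apply/measurable_EFinP; apply: measurable_funM.
    by apply: measurableT_comp => //; exact: integ_measurable fi.
  by apply: measurableT_comp => //; exact: integ_measurable gi.
apply: (@integrable12ltyP _ _ T T' R P P' _ mfg).2.
have E x : (\int[P']_y `|(f x * g y)%:E| = `|f x|%:E * \int[P']_y `|(g y)%:E|)%E.
  under eq_integral do rewrite abse_EFin normrM EFinM.
  rewrite ge0_integralZl//.
  by apply/measurable_EFinP; apply: measurableT_comp => //; exact: integ_measurable gi.
under eq_integral do rewrite E.
rewrite ge0_integralZr//; last 2 first.
- by apply/measurable_EFinP; apply: measurableT_comp => //; exact: integ_measurable fi.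
- exact: integral_ge0.
move: fi gi => /integrableP[_ fi] /integrableP[_ gi].
by apply: lte_mul_pinfty => //; [exact: integral_ge0|rewrite ge0_fin_numE//; exact: integral_ge0].
Qed.

Lemma exp_prodM (f : T -> R) (g : T' -> R) : integ P f -> integ P' g ->
  \int[(P \x P')%E]_w (f w.1 * g w.2) = \int[P]_w f w * \int[P']_w g w.
Proof.
move=> fi gi; rewrite /Rintegral -integral12_prod_meas1; last exact: integ_prodM.
rewrite /fubini_F /=.
under eq_integral do (under eq_integral do rewrite EFinM; rewrite integralZl//).
rewrite -fineM; [|exact: integrable_fin_num..].
set c := (\int[P']_w (g w)%:E)%E.
have -> : c = (fine c)%:E by rewrite fineK//; exact: integrable_fin_num.
by rewrite integralZr.
Qed.

End Product.

(** * I.i.d. arrays: relabelling, splicing, independence *)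

Section IidArrays.
Context {R : realType}.

Definition iid_array d (T : measurableType d) (P : {measure set T -> \bar R})
    (mu : set R -> \bar R) (X : T -> arrayT R) : Prop :=
  measurable_fun setT X /\ indep_law P X (fun=> mu).

Lemma iid_same_law d (T : measurableType d) (P : {measure set T -> \bar R})
    (X : T -> arrayT R) d' (T' : measurableType d')
    (P' : {measure set T' -> \bar R}) (X' : T' -> arrayT R) mu :
  iid_array P mu X -> iid_array P' mu X' -> same_law P X P' X'.
Proof. by move=> [mX iX] [mX' iX']; exact: indep_law_unique iX iX'. Qed.

Lemma measurable_coord d (T : measurableType d) (X : T -> arrayT R) i j :
  measurable_fun setT X -> measurable_fun setT (fun w => X w i j).
Proof. by move=> mX; exact: measurableT_comp (measurable_entry i j) mX. Qed.

Lemma iid_reindex d (T : measurableType d) (P : {measure set T -> \bar R})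
    (X : T -> arrayT R) mu (phi : nat * nat -> nat * nat) :
  injective phi -> iid_array P mu X ->
  iid_array P mu (fun w i j => X w (phi (i, j)).1 (phi (i, j)).2).
Proof.
move=> phiI [mX iX]; split.
  by apply: measurable_arrayP => i j; exact: measurable_coord.
move=> s A us mA.
(* [inv] inverts [phi] on the cells of [s] only; its other values are irrelevant. *)
pose inv z := nth (0%N, 0%N) s (index z (map phi s)).
have invK z : z \in s -> inv (phi z) = z.
  by move=> zs; rewrite /inv index_map// nth_index.
have := iX (map phi s) (fun z => A (inv z)).
rewrite map_inj_uniq// => /(_ us (fun z => mA _)).
rewrite big_map (eq_big_seq (fun z => mu (A z))); last by move=> z zs; rewrite invK.
move=> <-; congr (P _); apply/seteqP; split=> w /=.
  by move=> h _ /mapP[z zs ->]; rewrite invK//; have := h z zs; case: z {zs}.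
by move=> h [i j] zs /=; have := h (phi (i, j)); rewrite map_f// invK//; apply.
Qed.

Lemma iid_translate d (T : measurableType d) (P : {measure set T -> \bar R})
    (X : T -> arrayT R) mu a b :
  iid_array P mu X -> iid_array P mu (fun w => translate (X w) a b).
Proof.
apply: (@iid_reindex _ _ _ _ _ (fun z => (a + z.1, b + z.2)%N)).
by move=> [i j] [i' j'] /= [] /addnI-> /addnI->.
Qed.

Lemma cyl_box_measurable (s : seq (nat * nat)) (A : nat * nat -> set R) :
  (forall z, measurable (A z)) -> measurable (cyl_box s A : set (arrayT R)).
Proof.
move=> mA; rewrite cyl_box_bigcap bigcap_seq; apply: bigsetI_measurable => z _.
by have := @measurable_entry R z.1 z.2 measurableT _ (mA z); rewrite setTI.
Qed.

(* Splicing two independent copies of an i.i.d. array along [D] does not change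
   its law, so that the independence of functions of disjoint sets of entries
   becomes Fubini's theorem on the product space. *)
Definition splice (D : pred (nat * nat)) (x y : nat -> nat -> R) :=
  fun i j => if D (i, j) then x i j else y i j.

Section splice.
Context d (T : measurableType d) (P : probability T R) (mu : set R -> \bar R)
  (X : T -> arrayT R).
Hypothesis iX : iid_array P mu X.
Variable D : pred (nat * nat).

Lemma iid_splice :
  iid_array (P \x P)%E mu (fun w => splice D (X w.1) (X w.2)).
Proof.
have [mX indX] := iX; split.
  apply: measurable_arrayP => i j; rewrite /splice; case: (D (i, j)).
    exact: (measurableT_comp (measurable_coord i j mX) measurable_fst).
  exact: (measurableT_comp (measurable_coord i j mX) measurable_snd).
move=> s A us mA.
have -> : (fun w => splice D (X w.1) (X w.2)) @^-1` cyl_box s A =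
    (X @^-1` cyl_box (seq.filter D s) A) `*`
    (X @^-1` cyl_box (seq.filter (predC D) s) A).
  apply/seteqP; split=> -[w w'] /=.
    move=> h; split=> -[i j]; rewrite mem_filter => /andP[/= Dij zs].
      by have := h _ zs; rewrite /= /splice Dij.
    by have := h _ zs; rewrite /= /splice (negbTE Dij).
  move=> [h h'] [i j] zs /=; rewrite /splice; case: ifPn => Dij.
    by apply: (h (i, j)); rewrite mem_filter Dij.
  by apply: (h' (i, j)); rewrite mem_filter /= Dij.
have mXB B : measurable B -> measurable (X @^-1` B).
  by move=> mB; have := mX measurableT _ mB; rewrite setTI.
rewrite [LHS]product_measure1E; [|by apply: mXB; exact: cyl_box_measurable..].
rewrite !indX ?filter_uniq// !big_filter.
by rewrite [RHS](bigID D).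
Qed.

(** Dependence is stated pointwise rather than through a sub-sigma-algebra, since it is used to
    evaluate [f] on spliced arrays. *)
Definition depends_on (D' : pred (nat * nat)) (f : arrayT R -> R) : Prop :=
  forall x y, (forall i j, D' (i, j) -> x i j = y i j) -> f x = f y.

Variables f h : arrayT R -> R.
Hypotheses (mf : measurable_fun setT f) (mh : measurable_fun setT h)
  (fD : depends_on D f) (hD : depends_on (predC D) h)
  (fi : integ P (fun w => f (X w))) (hi : integ P (fun w => h (X w))).

Let spliceE w : f (splice D (X w.1) (X w.2)) * h (splice D (X w.1) (X w.2)) =
  f (X w.1) * h (X w.2).
Proof.
congr (_ * _).
  by apply: fD => i j Dij; rewrite /splice Dij.
by apply: hD => i j /= Dij; rewrite /splice (negbTE Dij).
Qed.

Let mfh : measurable_fun setT (fun x => f x * h x).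
Proof. exact: measurable_funM. Qed.

Lemma indep_integ : integ P (fun w => f (X w) * h (X w)).
Proof.
apply: (same_law_integrable (iid_same_law iid_splice iX) mfh).
under eq_fun do rewrite spliceE.
exact: (integ_prodM fi hi).
Qed.

Lemma indep_exp : \int[P]_w (f (X w) * h (X w)) =
  \int[P]_w f (X w) * \int[P]_w h (X w).
Proof.
rewrite -(same_law_Rintegral (iid_same_law iid_splice iX) mfh).
under eq_Rintegral do rewrite spliceE.
exact: (exp_prodM fi hi).
Qed.

End splice.

End IidArrays.

Section BaseLaw.
Context {R : realType} d (Omega : measurableType d) (P : probability Omega R)
  (X : nat -> nat -> {RV P >-> R}) (F : R -> \bar R).
Hypotheses (X_indep : mutually_independent X)
  (X_ident : forall (mu i : nat) (r : R), cdf (X mu i) r = F r).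

Definition array_of (w : Omega) : arrayT R := fun i j => X i j w.

Lemma measurable_array_of : measurable_fun setT array_of.
Proof. by apply: measurable_arrayP => i j; exact: measurable_funP. Qed.

(** The half-lines []-oo, r]], together with the whole line, form a pi-system generating the Borel
    sets. *)
Lemma cdf_unique (Y Z : {RV P >-> R}) : (forall r, cdf Y r = cdf Z r) ->
  forall A, measurable A -> P (Y @^-1` A) = P (Z @^-1` A).
Proof.
move=> YZ A mA.
pose G : set (set R) := [set B | B = setT \/ exists r, B = `]-oo, r]%classic].
have Gm : G `<=` measurable by move=> _ [->|[r ->]] //.
apply: (@g_sigma_algebra_measure_unique _ R R G Gm (fun=> setT) _ _
  (distribution P Y) (distribution P Z)).
- by left.
- by rewrite bigcup_const//; exists 0%N.
- move=> B C [->|[r ->]] [->|[r' ->]]; rewrite ?setTI ?setIT.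
  + by left.
  + by right; exists r'.
  + by right; exists r.
  + right; exists (Num.min r r'); apply/seteqP; split => x /=; rewrite !in_itv/=.
      by move=> [xr xr']; rewrite le_min xr.
    by rewrite le_min => /andP[].
- move=> _ [->|[r ->]]; last exact: YZ.
  transitivity (1%E : \bar R); first exact: (probability_setT (distribution P Y)).
  by symmetry; exact: (probability_setT (distribution P Z)).
- move=> _; rewrite [X in (X < _)%E](_ : _ = 1%E) ?ltry//.
  exact: (probability_setT (distribution P Y)).
have E : @measurable _ R = <<s @RGenOInfty.G R >>.
  exact: RGenOInfty.measurableE.
move: mA; rewrite E => mA.
suff : <<s @RGenOInfty.G R >> `<=` <<s G >> by apply.
apply: smallest_sub; first exact: smallest_sigma_algebra.
move=> _ [r ->]; rewrite -setCitvl; apply: sigma_algebraC.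
by apply: sub_sigma_algebra; right; exists r.
Qed.

Lemma array_of_iid :
  iid_array P (fun A => P (X 0 0 @^-1` A)) array_of.
Proof.
split; first exact: measurable_array_of.
move=> s A us mA; rewrite cyl_box_bigcap preimage_bigcap.
rewrite [LHS](X_indep us mA); apply: eq_big_seq => z _.
by apply: cdf_unique => // r; rewrite !X_ident.
Qed.

End BaseLaw.

(** * Sums over moving blocks of cells *)

(** Borel-Cantelli in integrated form: the series of the [psi N] has finite integral, so it
    converges almost everywhere and its terms tend to 0. *)
Lemma ae_eventually_lt1 {R : realType} d (T : measurableType d)
    (P : probability T R) (psi : nat -> T -> R) (K : R) :
  (forall N, integ P (psi N)) -> (forall N w, 0 <= psi N w) ->
  (forall n, \sum_(N < n) \int[P]_w psi N w <= K) ->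
  {ae P, forall w, \forall N \near \oo, psi N w < 1}.
Proof.
move=> psii psi0 psiK.
have mpsi N : measurable_fun setT (fun w => (psi N w)%:E).
  by apply/measurable_EFinP; exact: integ_measurable (psii N).
have int_lty : (\int[P]_w (\sum_(N <oo) (psi N w)%:E) < +oo)%E.
  rewrite integral_nneseries//; last by move=> N w _; rewrite lee_fin.
  apply: (@le_lt_trans _ _ K%:E); last exact: ltry.
  apply: lime_le; first by apply: is_cvg_nneseries => N _ _; apply: integral_ge0 => w _; rewrite lee_fin.
  apply: nearW => n; rewrite big_mkord.
  rewrite (eq_bigr (fun N : 'I_n => (\int[P]_w psi N w)%:E)).
    by rewrite sumEFin lee_fin; exact: psiK.
  by move=> N _; rewrite /Rintegral fineK// integrable_fin_num//; exact: psii.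
have mS : measurable_fun setT (fun w => \sum_(N <oo) (psi N w)%:E)%E.
  by apply: ge0_emeasurable_sum => // N w _ _; rewrite lee_fin.
have S0 w : (0 <= \sum_(N <oo) (psi N w)%:E)%E.
  by apply: nneseries_ge0 => N _ _; rewrite lee_fin.
have Sint : P.-integrable setT (fun w => \sum_(N <oo) (psi N w)%:E)%E.
  by apply/integrableP; split => //; under eq_integral do rewrite gee0_abs//.
have := integrable_ae measurableT Sint; apply: filterS => w /= /(_ I) Sfin.
have Soo : (\sum_(N <oo) (psi N w)%:E < +oo)%E by rewrite -ge0_fin_numE.
have psi0' N : xpredT N -> (0 <= (psi N w)%:E)%E by rewrite lee_fin.
have := nneseries_tail_cvg Soo psi0'.
move=> /fine_cvgP[tfin /cvgrPdist_lt/(_ 1 ltr01)].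
apply: filter_app; near=> N; rewrite sub0r normrN => /(le_lt_trans (ler_norm _)).
apply: le_lt_trans; rewrite -lee_fin fineK; last by near: N.
apply: le_trans (nneseries_lim_ge N.+1 _); last by move=> n _ _; rewrite lee_fin.
by rewrite big_nat1.
Unshelve. all: by end_near.
Qed.

(** Used with [x] the absolute value of an entry: it makes the probabilities that one of [O(N)]
    entries exceeds [N] summable, at the cost of a second moment. *)
Lemma sum_lt_sqr_le {R : realType} (x : R) n : 0 <= x ->
  \sum_(N < n) N%:R * (N%:R < x)%R%:R <= x ^+ 2.
Proof.
move=> x0.
suff : \sum_(N < n) N%:R * (N%:R < x)%R%:R <=
    (if n%:R <= x then n%:R * (n%:R - 1) / 2 else x ^+ 2).
  move=> /le_trans; apply; case: ifP => // nx.
  by have : (0 : R) <= n%:R by []; nra.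
elim: n => [|n IH]; first by rewrite big_ord0 x0 mul0r mul0r.
rewrite big_ord_recr/=; apply: le_trans (lerD IH (lexx _)) _.
have n0 : (0 : R) <= n%:R by [].
have nS : n.+1%:R = n%:R + 1 :> R by rewrite -natr1.
have nn : n%:R <= n%:R * n%:R :> R by rewrite -natrM ler_nat; case: (n) => // k; rewrite leq_pmulr.
have [nx|xn|nx] := ltgtP n%:R x.
- rewrite mulr1; case: ifP => [_|/negbT]; rewrite nS; first by nra.
  by rewrite -ltNge => h; nra.
- by rewrite mulr0 addr0 ifF//; apply/negbTE; rewrite -ltNge nS; lra.
- by rewrite mulr0 addr0 ifF; [rewrite -nx; nra|apply/negbTE; rewrite -ltNge nS; lra].
Qed.

(** Multiplied by [x ^+ 2], it bounds the fourth moments truncated at [N] and divided by [N ^ 3],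
    summed over [N], by twice the second moment. The term [N = 0] vanishes because the inverse of 0
    is 0. *)
Lemma sum_inv_cube_le {R : realType} (x : R) n : 0 <= x ->
  \sum_(N < n) x ^+ 2 * (x <= N%:R)%R%:R / N%:R ^+ 3 <= 2.
Proof.
move=> x0.
(* The sum telescopes: the first nonzero term is at most [2 - x / n.+1], and each later one at most
   [x / n - x / n.+1]. *)
suff : \sum_(N < n.+1) x ^+ 2 * (x <= N%:R)%R%:R / N%:R ^+ 3 <=
    (if x <= n%:R then if n == 0%N then 0 else 2 - x / n%:R else 0).
  rewrite big_ord_recr/= => h.
  apply: (@le_trans _ _ (\sum_(N < n) x ^+ 2 * (x <= N%:R)%R%:R / N%:R ^+ 3 +
     x ^+ 2 * (x <= n%:R)%R%:R / n%:R ^+ 3)).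
    by rewrite lerDl divr_ge0 ?mulr_ge0 ?exprn_ge0.
  apply: le_trans h _; case: ifP => // xn; case: eqP => // _.
  by rewrite gerBl divr_ge0.
elim: n => [|n IH].
  rewrite big_ord_recr big_ord0/= add0r expr0n/= invr0 mulr0.
  by case: ifP.
rewrite big_ord_recr/=; apply: le_trans (lerD IH (lexx _)) _.
have n0 : (0 : R) <= n%:R by [].
have Sn0 : (0 : R) < n.+1%:R by rewrite ltr0n.
have [xn1|] := leP x n.+1%:R; last first.
  move=> n1x; rewrite ifF ?mulr0 ?mul0r ?addr0//.
  by apply/negbTE; rewrite -ltNge (lt_trans _ n1x)// ltr_nat.
rewrite mulr1.
have step : x ^+ 2 / n.+1%:R ^+ 3 <= 2 - x / n.+1%:R.
  have xq : x / n.+1%:R <= 1 by rewrite ler_pdivrMr// mul1r.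
  have q0 : 0 <= x / n.+1%:R by rewrite divr_ge0.
  have i1 : n.+1%:R^-1 <= 1 :> R by rewrite invf_le1// ler1n.
  have i0 : 0 <= n.+1%:R^-1 :> R by rewrite invr_ge0.
  have -> : x ^+ 2 / n.+1%:R ^+ 3 = (x / n.+1%:R) ^+ 2 * n.+1%:R^-1.
    by field; rewrite ?natr1 ?nat1r gt_eqF.
  have q21 : (x / n.+1%:R) ^+ 2 <= 1 by rewrite exprn_ile1.
  have : (x / n.+1%:R) ^+ 2 * n.+1%:R^-1 <= 1.
    by rewrite mulr_ile1// exprn_ge0.
  move=> h; apply: le_trans h _; move: xq; set q := x / _; lra.
have [xn|nx] := leP x n%:R; last by rewrite add0r.
case: eqP => [n00|/eqP nneq0].
  by rewrite add0r.
have npos : (0 : R) < n%:R by rewrite ltr0n lt0n.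
rewrite -addrA lerD2l -lerBrDl opprK addrC.
rewrite (_ : x / n%:R - x / n.+1%:R = x / (n%:R * n.+1%:R)); last first.
  by rewrite -natr1; field; rewrite !gt_eqF// natr1.
rewrite ler_pdivrMr ?exprn_gt0// mulrAC ler_pdivlMr ?mulr_gt0//.
rewrite -natr1.
have : x <= n%:R + 1 by rewrite natr1.
move=> xn1'.
have h2 : 0 <= (x * (n%:R + 1)) * ((n%:R + 1) ^+ 2 - x * n%:R).
  apply: mulr_ge0; first by rewrite mulr_ge0// addr_ge0.
  nra.
nra.
Qed.

Lemma integ_lpp_coord {R : realType} d (T : measurableType d) (Q : probability T R)
    (Z : T -> nat -> nat -> R) m n :
  (forall i j, integ Q (fun w => Z w i j)) -> integ Q (fun w => lpp (Z w) m n).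
Proof.
move=> ij; elim/grid_ind: m / n => [|m IH|n IH|m n IH1 IH2].
- by rewrite (funext (fun w => lpp00 (Z w))); exact: integ_cst.
- by rewrite (funext (fun w => lppS0 (Z w) m)); exact: integD.
- by rewrite (funext (fun w => lpp0S (Z w) n)); exact: integD.
- rewrite (funext (fun w => lppSS (Z w) m n)); apply: integD => //.
  exact: integ_max.
Qed.

Section Moments.
Context {R : realType} d (T : measurableType d) (P : probability T R)
  (mu : set R -> \bar R) (X : T -> arrayT R).
Hypothesis iX : iid_array P mu X.

Let mX : measurable_fun setT X. Proof. by case: iX. Qed.

Lemma measurable_coord_comp (phi : R -> R) i j : measurable_fun setT phi ->
  measurable_fun setT (fun w => phi (X w i j)).
Proof. by move=> mphi; exact: measurableT_comp mphi (measurable_coord i j mX). Qed.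

Let measurable_entry_comp (phi : R -> R) i j : measurable_fun setT phi ->
  measurable_fun setT (fun x : arrayT R => phi (x i j)).
Proof. by move=> mphi; exact: measurableT_comp mphi (measurable_entry i j). Qed.

Lemma exp_coord (phi : R -> R) i j : measurable_fun setT phi ->
  \int[P]_w phi (X w i j) = \int[P]_w phi (X w 0 0).
Proof.
move=> mphi.
have := same_law_Rintegral (iid_same_law (iid_translate i j iX) iX)
  (measurable_entry_comp 0 0 mphi).
by rewrite /translate !addn0.
Qed.

Lemma integ_coord (phi : R -> R) i j : measurable_fun setT phi ->
  integ P (fun w => phi (X w 0 0)) -> integ P (fun w => phi (X w i j)).
Proof.
move=> mphi ip.
have := same_law_integrable (iid_same_law iX (iid_translate i j iX))
  (measurable_entry_comp 0 0 mphi) ip.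
by rewrite /translate !addn0.
Qed.

Lemma iid_map (phi : R -> R) : measurable_fun setT phi ->
  iid_array P (fun A => mu (phi @^-1` A)) (fun w i j => phi (X w i j)).
Proof.
move=> mphi; split.
  by apply: measurable_arrayP => i j; exact: measurable_coord_comp.
move=> s A us mA.
have mphiA z : measurable (phi @^-1` A z).
  by have := mphi measurableT _ (mA z); rewrite setTI.
by have [_ /(_ s (fun z => phi @^-1` A z) us mphiA) <-] := iX.
Qed.

Lemma integ_lpp m n : integ P (fun w => X w 0 0) -> integ P (fun w => lpp (X w) m n).
Proof.
by move=> i00; apply: integ_lpp_coord => i j; exact: (@integ_coord id).
Qed.

Section fourth_moment.
Variables (phi : R -> R) (c : R).
Hypotheses (mphi : measurable_fun setT phi) (phic : forall r, `|phi r| <= c)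
  (phi0 : \int[P]_w phi (X w 0 0) = 0).

Let S (s : seq (nat * nat)) (x : arrayT R) := \sum_(z <- s) phi (x z.1 z.2).

Let mS s : measurable_fun setT (S s).
Proof.
elim: s => [|z s IH].
  by rewrite (_ : S [::] = fun=> 0)//; apply/funext => x; rewrite /S big_nil.
rewrite (_ : S (z :: s) = fun x => phi (x z.1 z.2) + S s x).
  by apply: measurable_funD => //; exact: measurable_entry_comp.
by apply/funext => x; rewrite /S big_cons.
Qed.

Let Sbound s x : `|S s x| <= (size s)%:R * c.
Proof.
elim: s => [|z s IH]; first by rewrite /S big_nil normr0 mul0r.
rewrite /S big_cons (le_trans (ler_normD _ _))//= -nat1r mulrDl mul1r.
exact: lerD.
Qed.

Let integ_pow (f : arrayT R -> R) b k : measurable_fun setT f ->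
  (forall x, `|f x| <= b) -> integ P (fun w => f (X w) ^+ k).
Proof.
move=> mf fb; apply: (@integ_bounded _ _ _ _ _ (b ^+ k)).
  by apply: measurable_funX; exact: measurableT_comp mf mX.
by move=> w; rewrite normrX lerXn2r ?nnegrE// (le_trans _ (fb (X w))).
Qed.

(** The cell [z] lies outside [s], so the partial sum and the new entry are independent and every
    mixed moment of the binomial expansions factors. *)
Let ES z s k l : z \notin s ->
  integ P (fun w => S s (X w) ^+ k * phi (X w z.1 z.2) ^+ l) /\
  \int[P]_w (S s (X w) ^+ k * phi (X w z.1 z.2) ^+ l) =
  \int[P]_w (S s (X w) ^+ k) * \int[P]_w (phi (X w 0 0) ^+ l).
Proof.
move=> zs.
pose f x := S s x ^+ k; pose h (x : arrayT R) := phi (x z.1 z.2) ^+ l.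
have mf : measurable_fun setT f by exact: measurable_funX.
have mh : measurable_fun setT h.
  by apply: measurable_funX; exact: measurable_entry_comp.
have fD : depends_on (mem s) f.
  move=> x y xy; congr (_ ^+ _); apply: eq_big_seq => -[i j] zs'.
  by rewrite xy.
have hD : depends_on (predC (mem s)) h.
  move=> x y xy; congr (phi _ ^+ _); apply: xy => /=.
  by move: zs; case: (z).
have fi : integ P (fun w => f (X w)) by exact: (integ_pow k (mS s) (Sbound s)).
have hi : integ P (fun w => h (X w)).
  apply: (@integ_pow (fun x => phi (x z.1 z.2)) c l) => //.
  exact: measurable_entry_comp.
split; first exact: (indep_integ iX mf mh fD hD fi hi).
rewrite (indep_exp iX mf mh fD hD fi hi); congr (_ * _).
apply: (@exp_coord (fun r => phi r ^+ l) z.1 z.2).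
exact: measurable_funX.
Qed.

Let iSk s k : integ P (fun w => S s (X w) ^+ k).
Proof. exact: (integ_pow k (mS s) (Sbound s)). Qed.

Let exp_pow0 (f : T -> R) : \int[P]_w (f w ^+ 0) = 1.
Proof. by rewrite -[RHS](exp_cst P 1); under eq_Rintegral do rewrite expr0. Qed.

Let exp_pow1 (f : T -> R) : \int[P]_w (f w ^+ 1) = \int[P]_w f w.
Proof. by under eq_Rintegral do rewrite expr1. Qed.

Let ES2 s : uniq s ->
  \int[P]_w (S s (X w) ^+ 2) = (size s)%:R * \int[P]_w (phi (X w 0 0) ^+ 2).
Proof.
elim: s => [_|z s IH /= /andP[zs us]].
  under eq_Rintegral do rewrite /S big_nil expr0n/=.
  by rewrite exp_cst mul0r.
under eq_Rintegral => w _.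
  rewrite (_ : _ ^+ 2 = S s (X w) ^+ 2 * phi (X w z.1 z.2) ^+ 0 +
    (2 * (S s (X w) ^+ 1 * phi (X w z.1 z.2) ^+ 1) +
     S s (X w) ^+ 0 * phi (X w z.1 z.2) ^+ 2)); last first.
    by rewrite [S (z :: s) _]big_cons -/(S s (X w)); ring.
  over.
rewrite /= expD; [|exact: (ES 2 0 zs).1|]; last first.
  by apply: integD; [apply: integZ; exact: (ES 1 1 zs).1|exact: (ES 0 2 zs).1].
rewrite expD; [|by apply: integZ; exact: (ES 1 1 zs).1|exact: (ES 0 2 zs).1].
rewrite expZ; last exact: (ES 1 1 zs).1.
rewrite (ES 2 0 zs).2 (ES 1 1 zs).2 (ES 0 2 zs).2 IH//.
rewrite !exp_pow0 !(exp_pow1 (fun w => phi (X w 0 0))) phi0 -nat1r.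
ring.
Qed.

(** Cells are added one at a time. In the binomial expansion the terms containing a first power
    vanish by centering; the middle term, [6 * n] times the squared second moment, is covered by the
    increment of [3 * n ^ 2]. *)
Lemma fourth_moment s : uniq s ->
  integ P (fun w => (\sum_(z <- s) phi (X w z.1 z.2)) ^+ 4) /\
  \int[P]_w ((\sum_(z <- s) phi (X w z.1 z.2)) ^+ 4) <=
  (size s)%:R * \int[P]_w (phi (X w 0 0) ^+ 4) +
  3 * (size s)%:R ^+ 2 * (\int[P]_w (phi (X w 0 0) ^+ 2)) ^+ 2.
Proof.
move=> us; split; first exact: iSk.
rewrite -/(S s _); elim: s us => [_|z s IH /= /andP[zs us]].
  under eq_Rintegral do rewrite big_nil expr0n/=.
  by rewrite exp_cst mul0r add0r expr0n/= mulr0 mul0r.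
under eq_Rintegral => w _.
  rewrite (_ : _ ^+ 4 = S s (X w) ^+ 4 * phi (X w z.1 z.2) ^+ 0 +
    (4 * (S s (X w) ^+ 3 * phi (X w z.1 z.2) ^+ 1) +
    (6 * (S s (X w) ^+ 2 * phi (X w z.1 z.2) ^+ 2) +
    (4 * (S s (X w) ^+ 1 * phi (X w z.1 z.2) ^+ 3) +
     S s (X w) ^+ 0 * phi (X w z.1 z.2) ^+ 4)))); last first.
    by rewrite big_cons -/(S s (X w)); ring.
  over.
have I k l : integ P (fun w => S s (X w) ^+ k * phi (X w z.1 z.2) ^+ l).
  exact: (ES k l zs).1.
have I4 : integ P (fun w => 4 * (S s (X w) ^+ 1 * phi (X w z.1 z.2) ^+ 3) +
     S s (X w) ^+ 0 * phi (X w z.1 z.2) ^+ 4).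
  by apply: integD => //; exact: integZ.
have I3 : integ P (fun w => 6 * (S s (X w) ^+ 2 * phi (X w z.1 z.2) ^+ 2) +
    (4 * (S s (X w) ^+ 1 * phi (X w z.1 z.2) ^+ 3) +
     S s (X w) ^+ 0 * phi (X w z.1 z.2) ^+ 4)).
  by apply: integD => //; exact: integZ.
rewrite /= expD//; last by apply: integD => //; exact: integZ.
rewrite expD//; last exact: integZ.
rewrite expD//; last exact: integZ.
rewrite expD//; last exact: integZ.
rewrite (expZ 4 (I 3 1)) (expZ 6 (I 2 2)) (expZ 4 (I 1 3)).
rewrite (ES 4 0 zs).2 (ES 3 1 zs).2 (ES 2 2 zs).2 (ES 1 3 zs).2 (ES 0 4 zs).2.
rewrite ES2//.
have ES1 : \int[P]_w S s (X w) = 0.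
  rewrite exp_sum//; last first.
    move=> i; apply: (@integ_bounded _ _ _ _ _ c) => //.
    exact: measurable_coord_comp.
  by rewrite big1// => i _; rewrite exp_coord.
rewrite !exp_pow0 (exp_pow1 (fun w => phi (X w 0 0))) phi0.
rewrite (exp_pow1 (fun w => S s (X w))) ES1.
have := IH us.
set v2 := \int[P]_w (phi (X w 0 0) ^+ 2).
set v4 := \int[P]_w (phi (X w 0 0) ^+ 4).
rewrite -/(S s _) -nat1r.
have : 0 <= v2 ^+ 2 by rewrite sqr_ge0.
have : (0 : R) <= (size s)%:R by [].
set n := (size s)%:R; set e := \int[P]_w _ => n0 v20.
by nra.
Qed.

End fourth_moment.
End Moments.

Lemma sum_inv_sqr_le {R : realType} n : \sum_(N < n) (N%:R ^+ 2)^-1 <= 2 :> R.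
Proof.
suff : \sum_(N < n.+1) (N%:R ^+ 2)^-1 <= (if n == 0%N then 0 else 2 - n%:R^-1) :> R.
  rewrite big_ord_recr/= => h.
  apply: (@le_trans _ _ (\sum_(N < n) (N%:R ^+ 2)^-1 + (n%:R ^+ 2)^-1)).
    by rewrite lerDl invr_ge0 exprn_ge0.
  by apply: le_trans h _; case: eqP => // _; rewrite gerBl invr_ge0.
elim: n => [|n IH]; first by rewrite big_ord_recr big_ord0/= add0r expr0n/= invr0.
rewrite big_ord_recr/=; apply: le_trans (lerD IH (lexx _)) _.
case: eqP => [->|/eqP n0]; first by rewrite add0r expr1n invr1; lra.
have npos : (0 : R) < n%:R by rewrite ltr0n lt0n.
rewrite -addrA lerD2l -lerBrDl opprK addrC.
rewrite (_ : n%:R^-1 - n.+1%:R^-1 = (n%:R * n.+1%:R)^-1 :> R); last first.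
  by rewrite -natr1; field; rewrite natr1 !gt_eqF// ltr0n.
have Spos : (0 : R) < n.+1%:R by rewrite ltr0n.
have le1 : n%:R * n.+1%:R <= n.+1%:R ^+ 2 :> R by rewrite expr2 ler_pM2r// ler_nat.
by rewrite lef_pV2 ?posrE ?exprn_gt0 ?mulr_gt0.
Qed.

Section StrongLaw.
Context {R : realType} d (T : measurableType d) (P : probability T R)
  (mu : set R -> \bar R) (X : T -> arrayT R).
Hypotheses (iX : iid_array P mu X) (i1 : integ P (fun w => X w 0 0))
  (i2 : integ P (fun w => X w 0 0 ^+ 2)).
Variables (s : nat -> seq (nat * nat)) (C : nat) (eps : R).
Hypotheses (us : forall N, uniq (s N)) (sC : forall N, (size (s N) <= C * N)%N)
  (eps0 : 0 < eps).

Section centered.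
Hypothesis m0 : \int[P]_w X w 0 0 = 0.

Let mX : measurable_fun setT X. Proof. by case: iX. Qed.

Let v := \int[P]_w (X w 0 0 ^+ 2).
Let tr (N : nat) (r : R) : R := r * (`|r| <= N%:R)%R%:R.
Let big (N : nat) (r : R) : R := (N%:R < `|r|)%R%:R.
Let b N := \int[P]_w tr N (X w 0 0).
Let phi N r := tr N r - b N.

Let mind (f g : R -> R) : measurable_fun setT f -> measurable_fun setT g ->
  measurable_fun setT (fun r => (f r <= g r)%R%:R : R).
Proof.
move=> mf mg.
apply: (measurableT_comp (f := fun c : bool => c%:R : R)) => //.
exact: measurable_fun_ler.
Qed.

Let mtr N : measurable_fun setT (tr N).
Proof.
apply: measurable_funM => //; apply: mind => //.
Qed.

Let mbig N : measurable_fun setT (big N).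
Proof.
apply: (measurableT_comp (f := fun c : bool => c%:R : R)) => //.
by apply: measurable_fun_ltr => //; exact: normr_measurable.
Qed.

Let mphi N : measurable_fun setT (phi N).
Proof. exact: measurable_funB. Qed.

Let tr_le N r : `|tr N r| <= `|r|.
Proof. by rewrite /tr; case: (`|r| <= N%:R)%R; rewrite ?mulr1 ?mulr0 ?normr0. Qed.

Let tr_leN N r : `|tr N r| <= N%:R.
Proof. by rewrite /tr; case: (leP `|r| N%:R) => rN; rewrite ?mulr1 ?mulr0 ?normr0. Qed.

Let itr N k : integ P (fun w => tr N (X w 0 0) ^+ k).
Proof.
apply: (@integ_bounded _ _ _ _ _ (N%:R ^+ k)).
  by apply: measurable_funX; exact: (measurable_coord_comp iX).
by move=> w; rewrite normrX lerXn2r ?nnegrE.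
Qed.

Let itr1 N : integ P (fun w => tr N (X w 0 0)).
Proof. by have := itr N 1; under eq_fun do rewrite expr1. Qed.

Let v0 : 0 <= v.
Proof. by apply: Rintegral_ge0 => w _; rewrite sqr_ge0. Qed.

Let Etr2 N : \int[P]_w (tr N (X w 0 0) ^+ 2) <= v.
Proof.
apply: exp_le => // w; rewrite -[leLHS]real_normK ?num_real//.
by rewrite -[leRHS]real_normK ?num_real// lerXn2r ?nnegrE.
Qed.

Let phi_mean N : \int[P]_w phi N (X w 0 0) = 0.
Proof. by rewrite expB ?exp_cst ?subrr//; exact: integ_cst. Qed.

Let Ephi2E N : \int[P]_w (phi N (X w 0 0) ^+ 2) =
  \int[P]_w (tr N (X w 0 0) ^+ 2) - b N ^+ 2.
Proof.
under eq_Rintegral => w _.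
  rewrite (_ : _ ^+ 2 = tr N (X w 0 0) ^+ 2 - ((2 * b N) * tr N (X w 0 0) - b N ^+ 2)).
    over.
  by rewrite /phi; ring.
have ic := integ_cst P (b N ^+ 2).
have iZ := integZ (2 * b N) (itr1 N).
rewrite expB//; last exact: integB.
by rewrite expB// expZ// exp_cst -/(b N); ring.
Qed.

Let Ephi2_ge0 N : 0 <= \int[P]_w (phi N (X w 0 0) ^+ 2).
Proof. by apply: Rintegral_ge0 => w _; rewrite sqr_ge0. Qed.

Let b2_le N : b N ^+ 2 <= v.
Proof. by apply: le_trans (Etr2 N); rewrite -subr_ge0 -Ephi2E. Qed.

Let Ephi2 N : \int[P]_w (phi N (X w 0 0) ^+ 2) <= v.
Proof. by rewrite Ephi2E (le_trans _ (Etr2 N))// gerBl sqr_ge0. Qed.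

Let phi_bound N r : `|phi N r| <= N%:R + `|b N|.
Proof. by rewrite (le_trans (ler_normB _ _))// lerD. Qed.

Let iphi N k : integ P (fun w => phi N (X w 0 0) ^+ k).
Proof.
apply: (@integ_bounded _ _ _ _ _ ((N%:R + `|b N|) ^+ k)).
  by apply: measurable_funX; exact: (measurable_coord_comp iX).
by move=> w; rewrite normrX lerXn2r ?nnegrE// addr_ge0.
Qed.

Let Ephi4 N : \int[P]_w (phi N (X w 0 0) ^+ 4) <=
  8 * \int[P]_w (tr N (X w 0 0) ^+ 4) + 8 * v ^+ 2.
Proof.
rewrite -expZ// -[X in _ + X](exp_cst P) -expD; [|exact: integZ|exact: integ_cst].
apply: exp_le => //; first by apply: integD; [exact: integZ|exact: integ_cst].
move=> w; rewrite /phi; set x := tr N _; have b2 := b2_le N; set y := b N in b2 *.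
have y4 : y ^+ 4 <= v ^+ 2.
  have -> : y ^+ 4 = (y ^+ 2) ^+ 2 by rewrite -exprM.
  by rewrite lerXn2r ?nnegrE ?sqr_ge0.
suff : (x - y) ^+ 4 <= 8 * x ^+ 4 + 8 * y ^+ 4 by lra.
have h1 : (x - y) ^+ 2 <= 2 * (x ^+ 2 + y ^+ 2).
  by have := sqr_ge0 (x + y); rewrite -subr_ge0; nra.
have h2 : ((x - y) ^+ 2) ^+ 2 <= (2 * (x ^+ 2 + y ^+ 2)) ^+ 2.
  by rewrite lerXn2r ?nnegrE ?sqr_ge0// mulr_ge0// addr_ge0// sqr_ge0.
have h3 := sqr_ge0 (x ^+ 2 - y ^+ 2).
by rewrite -[4%N]/(2 * 2)%N !exprM; nra.
Qed.

(** The mean is 0, so the bias [b N] is minus the mean of the part cut off, where [|r| > N] and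
    hence [N * |r| <= r ^ 2]. *)
Let b_le N : `|b N| * N%:R <= v.
Proof.
rewrite -[b N]subr0 -m0 /b -expB// -[N%:R]ger0_norm// -normrM mulrC -expZ; last exact: integB.
rewrite (le_trans (le_normr_Rintegral _ _))//; first exact: (integZ _ (integB (itr1 N) i1)).
apply: exp_le => //; first by apply: integ_norm; apply: integZ; exact: integB.
move=> w; rewrite /tr; set r := X w 0 0.
have [rN|Nr] := leP `|r| N%:R; first by rewrite mulr1 subrr mulr0 normr0 sqr_ge0.
rewrite mulr0 sub0r normrM normrN ger0_norm// -[leRHS]real_normK ?num_real// expr2.
by rewrite ler_wpM2r// ltW.
Qed.

(** Chosen with [psi] below: [psi N w < 1] excludes an entry above [N] in absolute value, and also a
    centered truncated sum [S] with [|S| >= eps * N / 2], since then [A / N ^ 4 * S ^ 4 >= 1]. *)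
Let A : R := 16 / eps ^+ 4.
Let psi N w : R := \sum_(z <- s N) big N (X w z.1 z.2) +
  A / N%:R ^+ 4 * (\sum_(z <- s N) phi N (X w z.1 z.2)) ^+ 4.

Let A0 : 0 <= A. Proof. by rewrite divr_ge0// exprn_ge0// ltW. Qed.

Let ibig N i j : integ P (fun w => big N (X w i j)).
Proof.
apply: (@integ_bounded _ _ _ _ _ 1); first exact: (measurable_coord_comp iX).
by move=> w; rewrite /big; case: (_ < _)%R; rewrite ?normr0 ?normr1.
Qed.

Let ipsi N : integ P (psi N).
Proof.
apply: integD; first by apply: integ_sum => z; exact: ibig.
apply: integZ; exact: (fourth_moment iX (mphi N) (phi_bound N) (phi_mean N) (us N)).1.
Qed.

(** The bound on the expectation of [psi N] is written as the expectation of a function of a single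
    entry, so that the sum over [N] can be estimated pointwise before integrating. *)
Let g N (r : R) : R := C%:R * (N%:R * (N%:R < `|r|)%R%:R) +
  (8 * A * C%:R) * (r ^+ 2 * (`|r| ^+ 2 * (`|r| <= N%:R)%R%:R / N%:R ^+ 3)) +
  (A * (8 * C%:R + 3 * C%:R ^+ 2) * v ^+ 2) * (N%:R ^+ 2)^-1.

Let tr4E N r : tr N r ^+ 4 = N%:R ^+ 3 * (r ^+ 2 * (`|r| ^+ 2 * (`|r| <= N%:R)%R%:R / N%:R ^+ 3)).
Proof.
have [->|N0] := eqVneq N 0%N.
  rewrite expr0n/= mul0r /tr; case: (leP `|r| 0) => [|_]; last by rewrite mulr0 expr0n.
  by rewrite normr_le0 => /eqP->; rewrite mul0r expr0n.
have Nn : N%:R != 0 :> R by rewrite pnatr_eq0.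
rewrite real_normK ?num_real// /tr; case: (_ <= _)%R => /=; last by rewrite !(mulr0, mul0r) expr0n.
by rewrite !mulr1; field.
Qed.

Let itr4 N : integ P (fun w => X w 0 0 ^+ 2 *
  (`|X w 0 0| ^+ 2 * (`|X w 0 0| <= N%:R)%R%:R / N%:R ^+ 3)).
Proof.
have [->|N0] := eqVneq N 0%N.
  by under eq_fun do rewrite expr0n/= invr0 mulr0 mulr0; exact: integ_cst.
have Nn : N%:R ^+ 3 != 0 :> R by rewrite expf_eq0/= pnatr_eq0.
have := integZ (N%:R ^+ 3)^-1 (itr N 4).
by under eq_fun do rewrite tr4E mulKf//.
Qed.

Let ig N : integ P (fun w => g N (X w 0 0)).
Proof.
apply: integD; last exact: integ_cst.
apply: integD; last by apply: integZ; exact: itr4.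
by apply: integZ; apply: integZ; exact: ibig.
Qed.

Let Epsi N : \int[P]_w psi N w <= \int[P]_w g N (X w 0 0).
Proof.
have [i4 E4] := fourth_moment iX (mphi N) (phi_bound N) (phi_mean N) (us N).
have isb : integ P (fun w => \sum_(z <- s N) big N (X w z.1 z.2)).
  by apply: integ_sum => z; exact: ibig.
rewrite expD//; last exact: integZ.
rewrite expZ// exp_sum//.
under eq_bigr do rewrite (exp_coord iX)//.
rewrite big_const_seq count_predT iter_addr_0.
have iN := integ_cst P ((A * (8 * C%:R + 3 * C%:R ^+ 2) * v ^+ 2) * (N%:R ^+ 2)^-1).
have iZ := integZ (8 * A * C%:R) (itr4 N).
have iB : integ P (fun w => C%:R * (N%:R * (N%:R < `|X w 0 0|)%R%:R)).
  by apply: integZ; apply: integZ; exact: ibig.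
rewrite [leRHS]expD//; last exact: integD.
rewrite exp_cst [X in _ <= X + _]expD// expZ; last by apply: integZ; exact: ibig.
rewrite expZ; last exact: ibig.
rewrite expZ//.
have sR : (size (s N))%:R <= C%:R * N%:R :> R by rewrite -natrM ler_nat.
have s0 : (0 : R) <= (size (s N))%:R by [].
rewrite -addrA; apply: lerD.
  rewrite -[leLHS]mulr_natl mulrA ler_wpM2r//.
  by apply: Rintegral_ge0 => w _; rewrite /big; case: (_ < _)%R.
have E4' := Ephi4 N; have E2' := Ephi2 N; have E20 := Ephi2_ge0 N.
have tE : \int[P]_w (tr N (X w 0 0) ^+ 4) = N%:R ^+ 3 *
   \int[P]_w (X w 0 0 ^+ 2 * (`|X w 0 0| ^+ 2 * (`|X w 0 0| <= N%:R)%R%:R / N%:R ^+ 3)).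
  by rewrite -expZ; [under eq_Rintegral do rewrite tr4E | exact: itr4].
set t := \int[P]_w (_ * (_ * _ / _)) in tE *.
have t0 : 0 <= t.
  apply: Rintegral_ge0 => w _; by rewrite mulr_ge0 ?sqr_ge0// divr_ge0 ?exprn_ge0//.
have [N0|N0] := eqVneq N 0%N.
  rewrite N0 [_ ^+ 4]expr0n/= invr0 mulr0 mul0r addr_ge0//.
    by apply: mulr_ge0 => //; apply: mulr_ge0 => //; apply: mulr_ge0.
  rewrite expr0n/= invr0 mulr0//.
have Npos : (0 : R) < N%:R by rewrite ltr0n lt0n.
have N1 : (1 : R) <= N%:R by rewrite ler1n lt0n.
apply: (@le_trans _ _ (A / N%:R ^+ 4 * ((C%:R * N%:R) * (8 * (N%:R ^+ 3 * t) + 8 * v ^+ 2)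
   + 3 * (C%:R * N%:R) ^+ 2 * v ^+ 2))).
  apply: ler_wpM2l; first by apply: divr_ge0 => //; exact: exprn_ge0.
  apply: (le_trans E4); apply: lerD.
    apply: ler_pM => //; first by apply: Rintegral_ge0 => w _; rewrite -[4%N]/(2 * 2)%N exprM sqr_ge0.
    by rewrite -tE.
  apply: ler_pM; rewrite ?sqr_ge0// ?mulr_ge0 ?sqr_ge0//.
    by rewrite ler_wpM2l// lerXn2r ?nnegrE// mulr_ge0.
  by rewrite lerXn2r ?nnegrE.
rewrite (_ : A / N%:R ^+ 4 * _ = 8 * A * C%:R * t +
   (A * (8 * C%:R * N%:R^-1 + 3 * C%:R ^+ 2) * v ^+ 2) * (N%:R ^+ 2)^-1); last first.
  by field; rewrite gt_eqF.
rewrite lerD2l ler_wpM2r ?invr_ge0 ?sqr_ge0// ler_wpM2r ?sqr_ge0// ler_wpM2l//.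
rewrite lerD2r -[leRHS]mulr1 ler_wpM2l ?mulr_ge0//.
by rewrite invf_le1.
Qed.

Let K := C%:R * v + (8 * A * C%:R) * (2 * v) +
  (A * (8 * C%:R + 3 * C%:R ^+ 2) * v ^+ 2) * 2.

Let sumpsi n : \sum_(N < n) \int[P]_w psi N w <= K.
Proof.
apply: (@le_trans _ _ (\sum_(N < n) \int[P]_w g N (X w 0 0))).
  by apply: ler_sum => N _; exact: Epsi.
rewrite -exp_sum; last by move=> N; exact: ig.
have iR : integ P (fun w => C%:R * (X w 0 0 ^+ 2) + (8 * A * C%:R) * (2 * X w 0 0 ^+ 2) +
  (A * (8 * C%:R + 3 * C%:R ^+ 2) * v ^+ 2) * 2).
  by apply: integD; [apply: integD; do ?apply: integZ|exact: integ_cst].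
rewrite [leRHS](_ : _ = \int[P]_w (C%:R * (X w 0 0 ^+ 2) + (8 * A * C%:R) * (2 * X w 0 0 ^+ 2) +
  (A * (8 * C%:R + 3 * C%:R ^+ 2) * v ^+ 2) * 2)); last first.
  rewrite expD; [|by apply: integD; do ?apply: integZ|exact: integ_cst].
  rewrite expD; [|by do ?apply: integZ..].
  by rewrite exp_cst !expZ//; apply: integZ.
apply: exp_le => //; first by apply: integ_sum => N; exact: ig.
move=> w; set r := X w 0 0; rewrite /g !big_split/= -!mulr_sumr.
have c0 : (0 : R) <= C%:R by [].
apply: lerD; last first.
  apply: ler_wpM2l; last exact: sum_inv_sqr_le.
  by rewrite mulr_ge0 ?sqr_ge0// mulr_ge0// addr_ge0// ?mulr_ge0 ?sqr_ge0.
apply: lerD; first by rewrite ler_wpM2l// -[leRHS]real_normK ?num_real// sum_lt_sqr_le.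
apply: ler_wpM2l; first by apply: mulr_ge0 => //; apply: mulr_ge0.
rewrite mulrC ler_wpM2r ?sqr_ge0//.
exact: sum_inv_cube_le.
Qed.

Let psi_ge0 N w : 0 <= psi N w.
Proof.
rewrite addr_ge0//; first by apply: sumr_ge0 => z _; rewrite /big; case: (_ < _)%R.
by apply: mulr_ge0; [apply: divr_ge0 => //; exact: exprn_ge0|exact: exprn_even_ge0].
Qed.

(* Hsu-Robbins: the cells may change with [N], so the deviation probabilities
   have to be summable. With two moments only, truncate at [N] and use fourth
   moments. *)
Lemma strong_law_centered : {ae P, forall w, \forall N \near \oo,
  `|\sum_(z <- s N) X w z.1 z.2| <= eps * N%:R}.
Proof.
have := ae_eventually_lt1 ipsi psi_ge0 sumpsi.
apply: filterS => w; apply: filter_app.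
near=> N => psi1.
have N0 : (0 < N)%N by near: N; exact: nbhs_infty_gt.
have Npos : (0 : R) < N%:R by rewrite ltr0n.
have small z : z \in s N -> `|X w z.1 z.2| <= N%:R.
  move=> zs; rewrite leNgt; apply/negP => Nz; move: psi1; apply/negP; rewrite -leNgt.
  rewrite /psi (big_rem z)//= -addrA {1}/big Nz lerDl addr_ge0//.
    by apply: sumr_ge0 => z' _; rewrite /big; case: (_ < _)%R.
  by apply: mulr_ge0; [apply: divr_ge0 => //; exact: exprn_ge0|exact: exprn_even_ge0].
(* No entry of the block is truncated, so only the bias has to be added back. *)
have SE : \sum_(z <- s N) X w z.1 z.2 =
    \sum_(z <- s N) phi N (X w z.1 z.2) + (size (s N))%:R * b N.
  rewrite mulr_natl -[in X in _ + X](count_predT (s N)) -iter_addr_0 -big_const_seq -big_split/=.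
  by apply: eq_big_seq => z zs; rewrite /phi /tr small// mulr1 subrK.
rewrite SE; apply: le_trans (ler_normD _ _) _.
rewrite (_ : eps * _ = eps * N%:R / 2 + eps * N%:R / 2); last by field.
(* The total bias is at most [C * v], a constant. *)
apply: lerD; last first.
  rewrite normrM normr_nat.
  have sR : (size (s N))%:R <= C%:R * N%:R :> R by rewrite -natrM ler_nat.
  apply: (@le_trans _ _ (C%:R * N%:R * `|b N|)); first by rewrite ler_wpM2r.
  rewrite -mulrA [_ * `|_|]mulrC.
  apply: (@le_trans _ _ (C%:R * v)); first by rewrite ler_wpM2l.
  rewrite mulrAC -ler_pdivrMl; last by rewrite divr_gt0.
  by near: N; exact: nbhs_infty_ger.
have : A / N%:R ^+ 4 * (\sum_(z <- s N) phi N (X w z.1 z.2)) ^+ 4 < 1.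
  apply: le_lt_trans psi1; rewrite lerDr.
  by apply: sumr_ge0 => z' _; rewrite /big; case: (_ < _)%R.
set S := \sum_(z <- s N) _; rewrite -[S ^+ 4]ger0_norm ?exprn_even_ge0// normrX => S4.
rewrite leNgt; apply/negP => h; move: S4; apply/negP; rewrite -leNgt.
have : (eps * N%:R / 2) ^+ 4 <= `|S| ^+ 4.
  by rewrite lerXn2r ?nnegrE// ?divr_ge0 ?mulr_ge0// ltW.
move=> h4; rewrite /A.
rewrite [leLHS](_ : 1 = 16 / eps ^+ 4 / N%:R ^+ 4 * (eps * N%:R / 2) ^+ 4); last first.
  by field; rewrite !gt_eqF.
apply: ler_wpM2l => //.
by apply: divr_ge0; [exact: A0|exact: exprn_ge0].
Unshelve. all: by end_near.
Qed.

End centered.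

End StrongLaw.

(** Applied to the identity for rows and to the absolute value for the vertical joining pieces. *)
Lemma strong_law {R : realType} d (T : measurableType d) (P : probability T R)
  (mu : set R -> \bar R) (X : T -> arrayT R) (phi : R -> R)
  (s : nat -> seq (nat * nat)) (C : nat) (eps : R) :
  iid_array P mu X -> measurable_fun setT phi ->
  integ P (fun w => phi (X w 0 0)) -> integ P (fun w => phi (X w 0 0) ^+ 2) ->
  (forall N, uniq (s N)) -> (forall N, (size (s N) <= C * N)%N) -> 0 < eps ->
  {ae P, forall w, \forall N \near \oo,
  `|\sum_(z <- s N) (phi (X w z.1 z.2)) - (size (s N))%:R * \int[P]_w phi (X w 0 0)|
    <= eps * N%:R}.
Proof.
move=> iX mphi i1 i2 us sC eps0; set m := \int[P]_w _.
have mphi' : measurable_fun setT (fun r => phi r - m) by exact: measurable_funB.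
have iY := iid_map iX mphi'.
have j1 : integ P (fun w => phi (X w 0 0) - m) by apply: integB => //; exact: integ_cst.
have j2 : integ P (fun w => (phi (X w 0 0) - m) ^+ 2).
  rewrite (_ : (fun w => _) = fun w => phi (X w 0 0) ^+ 2 - ((2 * m) * phi (X w 0 0) - m ^+ 2)).
    by apply: integB => //; apply: integB; [exact: integZ|exact: integ_cst].
  by apply/funext => w; ring.
have j0 : \int[P]_w (phi (X w 0 0) - m) = 0.
  by rewrite expB ?exp_cst ?subrr//; exact: integ_cst.
have := strong_law_centered iY j1 j2 us sC eps0 j0.
apply: filterS => w; apply: filterS => N.
rewrite sumrB big_const_seq count_predT iter_addr_0.
by rewrite mulr_natl.
Qed.

(** * Good starting points *)

Section MaximalDeterministic.
Context {R : realType}.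

(** A superlevel set of the one-sided discrete maximal function of [f], with windows of length at
    most [L], evaluated at 0. *)
Definition exceeds (alpha : R) (L : nat) (f : nat -> bool) : bool :=
  [exists n : 'I_L.+1, (0 < n)%N && (alpha * n%:R < \sum_(k < n) (f k)%:R)].

(* Greedy covering: from an index where [exceeds] holds, jump over an interval
   witnessing it, otherwise advance by one. *)
Lemma maximal_count (alpha : R) L T f : 0 <= alpha ->
  alpha * \sum_(i < T) (exceeds alpha L (fun k => f (i + k)%N))%:R <=
  \sum_(k < T + L) (f k)%:R.
Proof.
move=> alpha0; elim/ltn_ind: T f => -[|T] IH f.
  by rewrite big_ord0 mulr0 sumr_ge0.
have split n : (n <= T.+1)%N -> \sum_(k < T.+1 + L) (f k)%:R =
    \sum_(k < n) (f k)%:R + \sum_(k < T.+1 - n + L) (f (n + k)%N)%:R :> R.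
  move=> nT; have E : (T.+1 + L = n + (T.+1 - n + L))%N by lia.
  by rewrite E big_split_ord/=.
have splitE n : (n <= T.+1)%N ->
    \sum_(i < T.+1) (exceeds alpha L (fun k => f (i + k)%N))%:R =
    \sum_(i < n) (exceeds alpha L (fun k => f (i + k)%N))%:R +
    \sum_(i < T.+1 - n) (exceeds alpha L (fun k => f (n + (i + k))%N))%:R :> R.
  move=> nT; have E : (T.+1 = n + (T.+1 - n))%N by lia.
  rewrite [in LHS]E big_split_ord/=; congr (_ + _).
  by apply: eq_bigr => i _; congr ((exceeds _ _ _)%:R); apply/funext => k; rewrite addnA.
have [/existsP[[n nL] /= /andP[n0 an]]|] := boolP (exceeds alpha L f); last first.
  move=> f0; rewrite (splitE 1%N)// (split 1%N)// big_ord1.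
  have -> : exceeds alpha L (fun k => f (0 + k)%N) = false by exact: negbTE.
  rewrite add0r subn1 /= (le_trans (IH T (ltnSn T) (fun k => f (1 + k)%N)))//.
  by rewrite lerDr sumr_ge0.
(* A witnessing interval that sticks out beyond [T.+1] still lies within the first [T.+1 + L]
   indices, and it covers all starting points that are left. *)
have [nT|Tn] := leqP n T.+1; last first.
  apply: (@le_trans _ _ (alpha * n%:R)).
    rewrite ler_wpM2l//; apply: (@le_trans _ _ (\sum_(i < T.+1) 1)).
      by apply: ler_sum => i _; rewrite lern1 leq_b1.
    by rewrite sumr_const card_ord ler_nat ltnW.
  apply: le_trans (ltW an) _.
  have E : (T.+1 + L = n + (T.+1 + L - n))%N by lia.
  by rewrite E big_split_ord/= lerDl sumr_ge0.
rewrite (splitE n)// (split n)// mulrDr; apply: lerD.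
  apply: le_trans (ltW an); rewrite ler_wpM2l//.
  apply: (@le_trans _ _ (\sum_(i < n) 1)).
    by apply: ler_sum => i _; rewrite lern1 leq_b1.
  by rewrite sumr_const card_ord.
by apply: (IH (T.+1 - n)%N _ (fun k => f (n + k)%N)); lia.
Qed.

End MaximalDeterministic.

Section Maximal.
Context {R : realType} (Q : probability (arrayT R) R).
Hypothesis Qstat : forall A k, measurable A ->
  Q ((fun x : arrayT R => translate x k 0 : arrayT R) @^-1` A) = Q A.

Definition many_bad (B : set (arrayT R)) (alpha : R) (L : nat) : set (arrayT R) :=
  [set x | exceeds alpha L (fun k => `[< B (translate x k 0) >])].

Lemma measurable_many_bad B alpha L : measurable B -> measurable (many_bad B alpha L).
Proof.
move=> mB.
have mT k : measurable_fun setT (fun x : arrayT R => translate x k 0 : arrayT R).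
  exact: measurable_translate.
have mf n : measurable_fun setT (fun x : arrayT R =>
    \sum_(k < n) (`[< B (translate x k 0) >])%:R : R).
  elim: n => [|n IH].
    by rewrite (_ : (fun x => _) = fun=> 0)//; apply/funext => x; rewrite big_ord0.
  rewrite (_ : (fun x => _) = fun x : arrayT R =>
      \sum_(k < n) (`[< B (translate x k 0) >])%:R + (`[< B (translate x n 0) >])%:R); last first.
    by apply/funext => x; rewrite big_ord_recr.
  apply: measurable_funD => //.
  rewrite (_ : (fun x => _) = (\1_B : arrayT R -> R) \o (fun x => translate x n 0)).
    by apply: measurableT_comp => //; exact: measurable_indic.
  by apply/funext => x; rewrite /= indicE; congr (_%:R); apply/asboolP/idP; rewrite inE.
rewrite [X in measurable X](_ : _ = \bigcup_(n in [set n | (0 < n <= L)%N])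
  [set x | alpha * n%:R < \sum_(k < n) (`[< B (translate x k 0) >])%:R]); last first.
  apply/seteqP; split => x /=.
    by move=> /existsP[[n nL] /= /andP[n0 an]]; exists n => //=; rewrite n0 -ltnS.
  by move=> [n /= /andP[n0 nL] an]; apply/existsP; exists (Ordinal (nL : (n < L.+1)%N)); rewrite /= n0.
apply: bigcup_measurable => n _.
have -> : [set x | alpha * n%:R < \sum_(k < n) (`[< B (translate x k 0) >])%:R] =
  (fun x : arrayT R => \sum_(k < n) (`[< B (translate x k 0) >])%:R : R) @^-1` `]alpha * n%:R, +oo[.
  by apply/seteqP; split => x /=; rewrite in_itv/= andbT.
by have := mf n measurableT _ (measurable_itv `]alpha * n%:R, +oo[); rewrite setTI.
Qed.

(** Transference: [maximal_count] is applied along the orbit of [x] and integrated. Stationarity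
    makes all shifts contribute equally, so [alpha * T] times the probability of [many_bad] is at
    most [T + L] times that of [B]; then [T] is taken large. *)
Lemma maximal_ineq B alpha L : measurable B -> 0 < alpha ->
  (alpha%:E * Q (many_bad B alpha L) <= Q B)%E.
Proof.
move=> mB alpha0.
have mE := measurable_many_bad alpha L mB.
have indQ A : measurable A -> \int[Q]_x \1_A x = fine (Q A).
  by move=> mA; rewrite /Rintegral integral_indic// setIT.
have mT k : measurable_fun setT (fun x : arrayT R => translate x k 0 : arrayT R).
  exact: measurable_translate.
have mpre A k : measurable A -> measurable ((fun x : arrayT R => translate x k 0 : arrayT R) @^-1` A).
  by move=> mA; have := mT k measurableT _ mA; rewrite setTI.
have iind A : measurable A -> integ Q (\1_A : arrayT R -> R).
  move=> mA; apply: (@integ_bounded _ _ _ Q _ 1); first exact: measurable_indic.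
  by move=> x; rewrite indicE; case: (_ \in _); rewrite ?normr1 ?normr0.
have key T : alpha * (T%:R * fine (Q (many_bad B alpha L))) <= (T + L)%:R * fine (Q B).
  have -> : T%:R * fine (Q (many_bad B alpha L)) =
    \int[Q]_x (\sum_(i < T) \1_((fun x : arrayT R => translate x i 0 : arrayT R) @^-1` many_bad B alpha L) x).
    rewrite exp_sum; last by move=> i; apply: iind; exact: mpre.
    rewrite (eq_bigr (fun=> fine (Q (many_bad B alpha L)))).
      by rewrite sumr_const card_ord mulr_natl.
    by move=> i _; rewrite indQ; [rewrite Qstat|exact: mpre].
  have -> : (T + L)%:R * fine (Q B) =
    \int[Q]_x (\sum_(i < T + L) \1_((fun x : arrayT R => translate x i 0 : arrayT R) @^-1` B) x).
    rewrite exp_sum; last by move=> i; apply: iind; exact: mpre.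
    rewrite (eq_bigr (fun=> fine (Q B))).
      by rewrite sumr_const card_ord mulr_natl.
    by move=> i _; rewrite indQ; [rewrite Qstat|exact: mpre].
  rewrite -expZ; last by apply: integ_sum => i; apply: iind; exact: mpre.
  apply: exp_le.
  - by apply: integZ; apply: integ_sum => i; apply: iind; exact: mpre.
  - by apply: integ_sum => i; apply: iind; exact: mpre.
  move=> x.
  have badE i : \1_((fun x : arrayT R => translate x i 0 : arrayT R) @^-1` many_bad B alpha L) x =
      (exceeds alpha L (fun k => `[< B (translate x (i + k) 0) >]))%:R :> R.
    rewrite indicE; congr (nat_of_bool _)%:R.
    have tE : (fun k => `[< B (translate (translate x i 0) k 0) >]) =
        (fun k => `[< B (translate x (i + k) 0) >]).
      by apply/funext => k; rewrite translate_translate addn0.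
    by rewrite -tE; apply/idP/idP => [|h]; rewrite inE.
  have BE i : \1_((fun x : arrayT R => translate x i 0 : arrayT R) @^-1` B) x =
      (`[< B (translate x i 0) >])%:R :> R.
    by rewrite indicE; congr (nat_of_bool _)%:R; apply/idP/asboolP => [|h]; rewrite inE.
  under eq_bigr do rewrite badE.
  under [leRHS]eq_bigr do rewrite BE.
  exact: (maximal_count L T (fun k => `[< B (translate x k 0) >]) (ltW alpha0)).
have fQ A : measurable A -> Q A = (fine (Q A))%:E.
  by move=> mA; rewrite fineK// fin_num_measure.
rewrite (fQ _ mE) (fQ _ mB) -EFinM lee_fin.
rewrite leNgt; apply/negP => h.
set a := alpha * _ in h; set b := fine (Q B) in h key.
have b0 : 0 <= b by rewrite fine_ge0.
(* An explicit [T] violating [T * (a - b) <= L * b] replaces the limit. *)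
pose T := (Num.truncn (L%:R * b / (a - b))).+1.
have h' : 0 < a - b by rewrite subr_gt0.
have : T%:R * (a - b) <= L%:R * b.
  by have := key T; rewrite natrD mulrCA -/a; lra.
rewrite -ler_pdivlMr// leNgt => /negP; apply.
by rewrite /T truncnS_gt.
Qed.

End Maximal.

Section GoodWindows.
Context {R : realType} (Q : probability (arrayT R) R).
Hypothesis Qstat : forall A k, measurable A ->
  Q ((fun x : arrayT R => translate x k 0 : arrayT R) @^-1` A) = Q A.
Variables (bad : nat -> set (arrayT R)).
Hypotheses (mbad : forall n, measurable (bad n))
  (bad_finite : {ae Q, forall x, \forall n \near \oo, ~ bad n x}).

Definition bad_from n0 : set (arrayT R) := \bigcup_(n in [set n | (n0 <= n)%N]) bad n.

Lemma measurable_bad_from n0 : measurable (bad_from n0).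
Proof. exact: bigcup_measurable. Qed.

Lemma bad_from_cvg0 : Q (bad_from n) @[n --> \oo] --> 0%E.
Proof.
have cvgI : Q (bad_from n) @[n --> \oo] --> Q (\bigcap_n bad_from n).
  apply: (@nonincreasing_cvg_mu _ _ _ Q bad_from).
  - by apply: le_lt_trans (probability_le1 Q _) _; [exact: measurable_bad_from|exact: ltry].
  - exact: measurable_bad_from.
  - by apply: bigcapT_measurable => n; exact: measurable_bad_from.
  - move=> m n mn; apply/subsetPset => x [k /= nk bk]; exists k => //=.
    exact: leq_trans nk.
suff Q0 : Q (\bigcap_n bad_from n) = 0%E by rewrite Q0 in cvgI.
case: bad_finite => N [mN N0 sub].
apply/eqP; rewrite eq_le measure_ge0 andbT -N0 le_measure ?inE//.
  by apply: bigcapT_measurable => n; exact: measurable_bad_from.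
move=> x badx; apply: sub => /= -[n0 _ good].
have [k /= nk bk] := badx n0 I.
exact: good bk.
Qed.

(** The maximal inequality is uniform in [L] and so survives the union over [L]; as [n0] grows its
    right-hand side tends to 0, which makes the intersection over [n0] a null set. *)
Lemma good_windows alpha : 0 < alpha ->
  {ae Q, forall x, exists n0, forall L, ~ many_bad (bad_from n0) alpha L x}.
Proof.
move=> alpha0.
pose E n0 := \bigcup_L many_bad (bad_from n0) alpha L.
have mE n0 L : measurable (many_bad (bad_from n0) alpha L).
  by apply: measurable_many_bad; exact: measurable_bad_from.
have mE' n0 : measurable (E n0) by exact: bigcupT_measurable.
have QE n0 : (alpha%:E * Q (E n0) <= Q (bad_from n0))%E.
  have cv : Q (many_bad (bad_from n0) alpha L) @[L --> \oo] --> Q (E n0).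
    apply: (@nondecreasing_cvg_mu _ _ _ Q); [exact: mE|exact: mE'|].
    move=> L L' LL'; apply/subsetPset => x /existsP[[n nL] /= h].
    by apply/existsP; exists (Ordinal (leq_trans nL (LL' : (L.+1 <= L'.+1)%N))).
  have cv' : (alpha%:E * Q (many_bad (bad_from n0) alpha L))%E @[L --> \oo]
      --> (alpha%:E * Q (E n0))%E by exact: cvgeZl.
  rewrite -(cvg_lim _ cv')//; apply: lime_le; first by apply/cvg_ex; eexists; exact: cv'.
  by apply: nearW => L; apply: maximal_ineq => //; exact: measurable_bad_from.
exists (\bigcap_n0 E n0); split; first exact: bigcapT_measurable.
  apply/eqP; rewrite eq_le measure_ge0 andbT.
  have : (alpha%:E * Q (\bigcap_n0 E n0) <= 0)%E.
    rewrite -(cvg_lim _ bad_from_cvg0)//; apply: lime_ge.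
      by apply/cvg_ex; eexists; exact: bad_from_cvg0.
    apply: nearW => n; apply: le_trans (QE n).
    rewrite lee_pmul2l// ?lte_fin// le_measure ?inE//; first exact: bigcapT_measurable.
    by move=> x; apply.
  by rewrite pmule_rle0 ?lte_fin.
move=> x /= h n0 _; apply: contrapT => nE; apply: h; exists n0 => L EL.
by apply: nE; exists L.
Qed.

(** If every corner of the window were bad, the window alone would push the density of bad corners
    among the first [N] above [alpha]. *)
Lemma window_has_good alpha n0 x (a len N : nat) : 0 < alpha ->
  (forall L, ~ many_bad (bad_from n0) alpha L x) ->
  (a + len <= N)%N -> (0 < N)%N -> alpha * N%:R < len%:R ->
  exists k, [/\ (a <= k)%N, (k < a + len)%N &
    forall n, (n0 <= n)%N -> ~ bad n (translate x k 0)].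
Proof.
move=> alpha0 h aN N0 aNl; apply: contrapT => nex; apply: (h N).
apply/existsP; exists ord_max; rewrite /= N0/=; apply: lt_le_trans aNl _.
have E : (N = a + (len + (N - (a + len))))%N by lia.
rewrite [in leRHS]E big_split_ord/= big_split_ord/=.
apply: (@le_trans _ _ (\sum_(i < len) (`[< bad_from n0 (translate x (a + i) 0) >])%:R)).
  rewrite (eq_bigr (fun=> 1)); first by rewrite sumr_const card_ord.
  move=> i _; case: asboolP => // nb; exfalso; apply: nex.
  exists (a + i)%N; split; rewrite ?leq_addr ?ltn_add2l//.
  by move=> n nn bn; apply: nb; exists n.
by rewrite addrCA lerDl addr_ge0// sumr_ge0.
Qed.

End GoodWindows.

(** * Bounded weights in thin strips *)

Section BoundedStrip.
Context {R : realType} d (T : measurableType d) (P : probability T R)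
  (mu : set R -> \bar R) (Z : T -> arrayT R) (K : R).
Hypotheses (iZ : iid_array P mu Z) (Z1 : integ P (fun w => Z w 0 0))
  (Z2 : integ P (fun w => Z w 0 0 ^+ 2)) (ZK : forall w i j, Z w i j <= K)
  (Zmean : \int[P]_w Z w 0 0 <= 0).

Let v := \int[P]_w (Z w 0 0 ^+ 2).

Lemma lpp_le_bound w m n : lpp (Z w) m n <= K *+ (m + n).
Proof.
elim/grid_ind: m / n => [|m IH|n IH|m n IH1 IH2].
- by rewrite lpp00.
- by rewrite lppS0 addSn mulrSr lerD.
- by rewrite lpp0S addnS mulrSr lerD.
- rewrite lppSS addnS mulrSr lerD// ge_max IH2 andbT.
  by rewrite addSnnS.
Qed.

(** One-sided in [u], as the weights are bounded above only. After multiplication by [1 - u], the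
    left side is at most 1 and the right side is [1 + u ^ 2 * (1 - 2 * u)]. *)
Lemma expR_le_quadratic (u : R) : u <= 1 / 2 -> expR u <= 1 + u + 2 * u ^+ 2.
Proof.
move=> u2; have h := expR_ge1Dx (- u).
have e0 := expR_gt0 u.
have : expR u * (1 - u) <= 1.
  by rewrite -[leRHS](expRxMexpNx_1 u) ler_wpM2l// ltW.
have : 1 <= (1 + u + 2 * u ^+ 2) * (1 - u) by nra.
by move=> h1 h2; rewrite -(ler_pM2r (_ : 0 < 1 - u)); lra.
Qed.

Variables (s x : R).
Hypotheses (s0 : 0 < s) (sK : s * K <= 1 / 2) (x0 : 0 < x).

Let rho := 1 + 2 * s ^+ 2 * v.

Let v0 : 0 <= v.
Proof. by apply: Rintegral_ge0 => w _; rewrite sqr_ge0. Qed.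

Let rho1 : 1 <= rho.
Proof. by rewrite lerDl mulr_ge0// mulr_ge0// sqr_ge0. Qed.

Let mexp : measurable_fun setT (fun r : R => expR (s * r)).
Proof. by apply: measurableT_comp; [exact: measurable_expR|exact: mulrl_measurable]. Qed.

Let Eexp : \int[P]_w expR (s * Z w 0 0) <= rho.
Proof.
have i0 : integ P (fun w => 1 + (s * Z w 0 0 + 2 * s ^+ 2 * Z w 0 0 ^+ 2)).
  by apply: integD; [exact: integ_cst|apply: integD; exact: integZ].
apply: (@le_trans _ _ (\int[P]_w (1 + (s * Z w 0 0 + 2 * s ^+ 2 * Z w 0 0 ^+ 2)))).
  apply: exp_le => //.
    apply: (@integ_bounded _ _ _ _ _ (expR (s * K))); first exact: (measurable_coord_comp iZ _ _ mexp).
    by move=> w; rewrite ger0_norm ?expR_ge0// ler_expR ler_pM2l.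
  move=> w; have /expR_le_quadratic : s * Z w 0 0 <= 1 / 2.
    by apply: le_trans sK; rewrite ler_pM2l.
  by rewrite exprMn mulrA addrA.
rewrite expD; [|exact: integ_cst|by apply: integD; exact: integZ].
rewrite expD; [|exact: integZ..].
rewrite exp_cst !expZ// -/v /rho lerD2l gerDr.
by rewrite mulr_ge0_le0// ltW.
Qed.

Let mlppexp m n : measurable_fun setT (fun y : arrayT R => expR (s * lpp y m n)).
Proof. exact: measurableT_comp mexp (measurable_lpp m n). Qed.

Let iexp m n : integ P (fun w => expR (s * lpp (Z w) m n)).
Proof.
have [mZ _] := iZ.
apply: (@integ_bounded _ _ _ _ _ (expR (s * (K *+ (m + n))))).
  exact: (measurableT_comp (mlppexp m n) mZ).
by move=> w; rewrite ger0_norm ?expR_ge0// ler_expR ler_pM2l// lpp_le_bound.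
Qed.

(** The rectangle up to [(a, b)] does not contain [(m, n)], so the weight added by the last step is
    independent of the passage time before it. *)
Let step m n a b : (a <= m)%N -> (b <= n)%N -> (a + b < m + n)%N ->
  integ P (fun w => expR (s * lpp (Z w) a b) * expR (s * Z w m n)) /\
  \int[P]_w (expR (s * lpp (Z w) a b) * expR (s * Z w m n)) <=
  \int[P]_w expR (s * lpp (Z w) a b) * rho.
Proof.
move=> am bn abmn.
pose D : pred (nat * nat) := [pred z | (z.1 <= a)%N && (z.2 <= b)%N].
pose h (y : arrayT R) := expR (s * y m n).
have mh : measurable_fun setT h by exact: (measurableT_comp mexp (measurable_entry m n)).
have fD : depends_on D (fun y : arrayT R => expR (s * lpp y a b)).
  move=> y y' yy'; congr (expR (s * _)); apply: eq_lpp => i j ia jb _.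
  by apply: yy'; rewrite /D/= ia.
have hD : depends_on (predC D) h.
  move=> y y' yy'; congr (expR (s * _)); apply: yy'; rewrite /D/=.
  by apply/negP => /andP[ma nb]; move: abmn; rewrite ltnNge leq_add.
have hi : integ P (fun w => h (Z w)).
  apply: (@integ_bounded _ _ _ _ _ (expR (s * K))).
    exact: (measurable_coord_comp iZ _ _ mexp).
  by move=> w; rewrite ger0_norm ?expR_ge0// ler_expR ler_pM2l.
split; first exact: (indep_integ iZ (mlppexp a b) mh fD hD (iexp a b) hi).
rewrite (indep_exp iZ (mlppexp a b) mh fD hD (iexp a b) hi).
rewrite ler_wpM2l//; first by apply: Rintegral_ge0 => w _; exact: expR_ge0.
by rewrite /h (exp_coord iZ _ _ mexp).
Qed.

Let bnd m n := (rho * (1 + x)) ^+ (m + n) / x ^+ m.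

Let bnd0 m n : 0 <= bnd m n.
Proof.
have r0 : 0 <= rho by apply: le_trans rho1.
apply: divr_ge0; last exact/exprn_ge0/ltW.
by apply: exprn_ge0; apply: mulr_ge0 => //; apply: addr_ge0 => //; exact: ltW.
Qed.

(* [(1 + x) ^+ (m + n) / x ^+ m] bounds the number of paths to [(m, n)]; taking
   [x] small makes the entropy negligible in a thin strip. *)
Lemma exp_lpp_bound m n : \int[P]_w expR (s * lpp (Z w) m n) <=
  (rho * (1 + x)) ^+ (m + n) / x ^+ m.
Proof.
have r0 : 0 <= rho by apply: le_trans rho1.
elim/grid_ind: m / n => [|m IH|n IH|m n IH1 IH2].
- under eq_Rintegral do rewrite lpp00 mulr0 expR0.
  by rewrite exp_cst divr1.
- under eq_Rintegral do rewrite lppS0 mulrDr expRD.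
  have [_ h] := @step m.+1 0 m 0 (leqnSn _) (leqnn _) (ltnSn _).
  apply: (le_trans h); apply: (@le_trans _ _ (bnd m 0 * rho)).
    by rewrite ler_wpM2r.
  rewrite /bnd addSn !exprS (_ : _ / (x * x ^+ m) =
    (rho * (1 + x)) ^+ (m + 0) / x ^+ m * rho * ((1 + x) / x)).
    rewrite ler_peMr//; first by rewrite mulr_ge0// -/(bnd m 0).
    by rewrite ler_pdivlMr// mul1r lerDr.
  by field; rewrite !gt_eqF// exprn_gt0.
- under eq_Rintegral do rewrite lpp0S mulrDr expRD.
  have [_ h] := @step 0 n.+1 0 n (leqnn _) (leqnSn _) (ltnSn _).
  apply: (le_trans h); apply: (@le_trans _ _ (bnd 0 n * rho)).
    by rewrite ler_wpM2r.
  rewrite /bnd addnS !exprS expr0 !divr1 [X in _ <= X]mulrC mulrA ler_peMr//.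
    by rewrite mulr_ge0// exprn_ge0// mulr_ge0// addr_ge0// ltW.
  by rewrite lerDl ltW.
- have [i1 h1] := @step m.+1 n.+1 m n.+1 (leqnSn _) (leqnn _) (ltnSn _).
  have [i2 h2] := @step m.+1 n.+1 m.+1 n (leqnn _) (leqnSn _) (eq_leq (esym (addnS _ _))).
  apply: (@le_trans _ _ (\int[P]_w (expR (s * lpp (Z w) m n.+1) * expR (s * Z w m.+1 n.+1) +
     expR (s * lpp (Z w) m.+1 n) * expR (s * Z w m.+1 n.+1)))).
    apply: exp_le => //; first exact: integD.
    move=> w; rewrite lppSS mulrDr expRD -mulrDl ler_wpM2r ?expR_ge0//.
    have [_|_] := leP (lpp (Z w) m n.+1) (lpp (Z w) m.+1 n).
      by rewrite lerDr expR_ge0.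
    by rewrite lerDl expR_ge0.
  rewrite expD//; apply: (@le_trans _ _ (bnd m n.+1 * rho + bnd m.+1 n * rho)).
    by apply: lerD; [apply: le_trans h1 _|apply: le_trans h2 _]; rewrite ler_wpM2r.
  rewrite /bnd !addnS !addSn !exprS le_eqVlt; apply/orP; left; apply/eqP.
  by field; rewrite !gt_eqF// exprn_gt0.
Qed.

(** Jensen's inequality for the exponential, obtained from the tangent [1 + u <= expR u] at
    [u = s * lpp - th], where [th] dominates the logarithm of the bound in [exp_lpp_bound]. *)
Lemma strip_bound m n : s * \int[P]_w lpp (Z w) m n <=
  (2 * s ^+ 2 * v + x) * (m + n)%:R + m%:R / x.
Proof.
set th := leRHS.
have e0 : 0 <= expR (- th) by exact: expR_ge0.
have : expR (- th) * \int[P]_w expR (s * lpp (Z w) m n) <= 1.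
  rewrite -[leRHS](expRxMexpNx_1 th) mulrC ler_wpM2r//.
  apply: le_trans (exp_lpp_bound m n) _.
  have r0 : 0 <= rho by apply: le_trans rho1.
  have rx : rho * (1 + x) <= expR (2 * s ^+ 2 * v + x).
    rewrite expRD; apply: ler_pM => //; [|exact: expR_ge1Dx..].
    by apply: addr_ge0 => //; exact: ltW.
  have ix : x^-1 <= expR x^-1.
    by apply: le_trans (expR_ge1Dx _); rewrite lerDr.
  rewrite /th expRD [m%:R / x]mulrC.
  rewrite (_ : expR ((2 * s ^+ 2 * v + x) * (m + n)%:R) =
    expR (2 * s ^+ 2 * v + x) ^+ (m + n)); last by rewrite mulrC expRM_natl.
  rewrite (_ : expR (x^-1 * m%:R) = expR x^-1 ^+ m); last by rewrite mulrC expRM_natl.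
  rewrite -exprVn; apply: ler_pM.
  - by rewrite exprn_ge0// mulr_ge0// addr_ge0// ltW.
  - by rewrite exprn_ge0// invr_ge0 ltW.
  - by rewrite lerXn2r ?nnegrE ?expR_ge0// mulr_ge0// addr_ge0// ltW.
  - by rewrite lerXn2r ?nnegrE ?expR_ge0// invr_ge0 ltW.
rewrite -expZ// => h.
have i1 : integ P (fun w => s * lpp (Z w) m n) by apply: integZ; exact: (integ_lpp iZ).
have i2 : integ P (fun w => (s * lpp (Z w) m n - th) + 1).
  by apply: integD; [apply: integB => //|]; exact: integ_cst.
have : \int[P]_w ((s * lpp (Z w) m n - th) + 1) <= 1.
  apply: le_trans h; apply: exp_le => //; first by apply: integZ.
  move=> w; rewrite -expRD addrC [leRHS](_ : _ = expR (s * lpp (Z w) m n - th)).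
    exact: expR_ge1Dx.
  by rewrite addrC.
rewrite expD; [|by apply: integB => //; exact: integ_cst|exact: integ_cst].
rewrite expB//; last exact: integ_cst.
rewrite !exp_cst expZ; last exact: (integ_lpp iZ).
by lra.
Qed.

End BoundedStrip.

Section ThinStrip.
Context {R : realType} d (T : measurableType d) (P : probability T R)
  (mu : set R -> \bar R) (X : T -> arrayT R).
Hypotheses (iX : iid_array P mu X) (X1 : integ P (fun w => X w 0 0))
  (X2 : integ P (fun w => X w 0 0 ^+ 2)) (Xmean : \int[P]_w X w 0 0 <= 0).

Lemma measurable_min_cst (K : R) : measurable_fun setT (fun r : R => Num.min r K).
Proof. exact: measurable_minr. Qed.

Lemma integ_min_cst (K : R) : integ P (fun w => Num.min (X w 0 0) K).
Proof.
apply: (@integ_le _ _ _ _ _ (fun w => `|X w 0 0| + `|K|)).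
- exact: (measurable_coord_comp iX _ _ (measurable_min_cst K)).
- by apply: integD; [exact: integ_norm|exact: integ_cst].
- by move=> w; have [_|_] := leP (X w 0 0) K; rewrite ?lerDl ?lerDr.
Qed.

Lemma thin_strip_truncated (K eps : R) : 0 <= K -> 0 < eps ->
  exists2 delta : R, 0 < delta <= 1 & forall m n : nat, m%:R <= delta * n%:R ->
  \int[P]_w lpp (fun i j => Num.min (X w i j) K) m n <= eps * n%:R.
Proof.
move=> K0 eps0.
have mphi := measurable_min_cst K.
have iZ := iid_map iX mphi.
have Z1 := integ_min_cst K.
have Z2 : integ P (fun w => Num.min (X w 0 0) K ^+ 2).
  apply: (integ_le _ X2).
    by apply: measurable_funX; exact: (measurable_coord_comp iX _ _ mphi).
  move=> w; rewrite ger0_norm ?sqr_ge0//.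
  have [//|KX] := leP (X w 0 0) K.
  by rewrite lerXn2r ?nnegrE ?(le_trans K0)// ltW.
have Zmean : \int[P]_w Num.min (X w 0 0) K <= 0.
  by apply: le_trans Xmean; apply: exp_le => // w; rewrite ge_min lexx.
have ZK w i j : Num.min (X w i j) K <= K by rewrite ge_min lexx orbT.
set v := \int[P]_w (Num.min (X w 0 0) K ^+ 2).
have v0 : 0 <= v by apply: Rintegral_ge0 => w _; rewrite sqr_ge0.
have K1 : 0 < K + 1 by rewrite ltr_wpDl.
have v1 : 0 < v + 1 by rewrite ltr_wpDl.
(* Constants are fixed in the order [s], [x], [delta]: first [2 * s ^ 2 * v] and then [x] become at
   most [s * eps / 8], and finally [delta] makes the entropy term [m / x] at most
   [s * eps / 2 * n]. *)
pose s := Num.min (2 * (K + 1))^-1 (eps / (16 * (v + 1))).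
have s0 : 0 < s.
  by rewrite lt_min invr_gt0 mulr_gt0//= divr_gt0// mulr_gt0.
have sK : s * K <= 1 / 2.
  apply: (@le_trans _ _ ((2 * (K + 1))^-1 * K)); first by rewrite ler_wpM2r// ge_min lexx.
  by rewrite mulrC ler_pdivrMr ?mulr_gt0//; lra.
have sv : s * v <= eps / 16.
  apply: (@le_trans _ _ (eps / (16 * (v + 1)) * v)).
    by rewrite ler_wpM2r// ge_min lexx orbT.
  rewrite mulrAC ler_pdivrMr ?mulr_gt0//.
  by rewrite (_ : _ * (16 * _) = eps * (v + 1)); [rewrite ler_pM2l//; lra|field].
pose x := Num.min 1 (s * eps / 8).
have x0 : 0 < x by rewrite lt_min ltr01 divr_gt0 ?mulr_gt0.
have x1 : x <= 1 by rewrite ge_min lexx.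
have xs : x <= s * eps / 8 by rewrite ge_min lexx orbT.
exists (Num.min 1 (x * s * eps / 2)).
  by rewrite lt_min ltr01 ge_min lexx !divr_gt0 ?mulr_gt0.
move=> m n mn.
have mn1 : m%:R <= n%:R :> R.
  by apply: le_trans mn _; rewrite -[leRHS]mul1r ler_wpM2r// ge_min lexx.
have mn2 : m%:R <= x * s * eps / 2 * n%:R.
  by apply: le_trans mn _; rewrite ler_wpM2r// ge_min lexx orbT.
have := strip_bound iZ Z1 Z2 ZK Zmean s0 sK x0 m n.
rewrite -/v; set E := \int[P]_w _ => h.
rewrite -(ler_pM2l s0); apply: (le_trans h).
have n0 : (0 : R) <= n%:R by [].
have h1 : m%:R / x <= s * eps / 2 * n%:R.
  by rewrite ler_pdivrMr//; apply: le_trans mn2 _; lra.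
have h2 : 2 * s ^+ 2 * v <= s * eps / 8.
  by rewrite (_ : 2 * s ^+ 2 * v = s * (2 * (s * v))); [nra|ring].
have h3 : (2 * s ^+ 2 * v + x) * (m + n)%:R <= (s * eps / 4) * (2 * n%:R).
  apply: ler_pM => //; rewrite ?natrD; last by lra.
    by rewrite addr_ge0 ?(ltW x0)// mulr_ge0// mulr_ge0// sqr_ge0.
  by lra.
by lra.
Qed.

End ThinStrip.

(** * Heavy and light vertices *)

Section Conditioning.
Context {R : realType} d (T : measurableType d) (P : probability T R)
  (A : set T) (mA : measurable A).
Hypothesis PA : (0 < P A)%E.

(** The last [P] is the default of [mnormalize] when the restricted mass is 0 or infinite. *)
Definition conditional : probability T R := mnormalize (mrestr P mA) P.

Let pA := fine (P A).

Let pA0 : 0 < pA.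
Proof. by rewrite fine_gt0// PA ltey_eq fin_num_measure. Qed.

Let PAE : P A = pA%:E.
Proof. by rewrite fineK// fin_num_measure. Qed.

Lemma conditionalE B : conditional B = (P (B `&` A) * (pA^-1)%:E)%E.
Proof.
have ET : mrestr P mA setT = P A by rewrite /mrestr setTI.
rewrite /conditional/= /mnormalize; case: ifPn => [|_].
  rewrite [X in (X == 0) || _]ET [X in _ || (X == _)]ET.
  by rewrite gt_eqF//= PAE.
by rewrite -/(mrestr P mA B); congr (_ * (fine _)^-1%:E)%E.
Qed.

Let ge0_integral_conditional (f : T -> \bar R) : measurable_fun setT f ->
  (forall w, 0 <= f w)%E ->
  (\int[conditional]_w f w = (pA^-1)%:E * \int[P]_(w in A) f w)%E.
Proof.
move=> mf f0.
have pV0 : 0 <= pA^-1 by rewrite invr_ge0 ltW.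
transitivity (\int[mscale (NngNum pV0) (mrestr P mA)]_w f w)%E.
  apply: eq_measure_integral => B mB _.
  by rewrite [LHS]conditionalE muleC.
rewrite ge0_integral_mscale//; congr (_ * _)%E.
rewrite (@ge0_negligible_integral _ _ _ (mrestr P mA) setT (~` A))//; last 2 first.
- exact: measurableC.
- by rewrite -[LHS]/(P (~` A `&` A)) setICl measure0.
rewrite setTD setCK; apply: eq_measure_integral => B mB BA.
by rewrite -[LHS]/(P (B `&` A)) setIidl.
Qed.

Lemma integ_conditional f : integ P f -> integ conditional f.
Proof.
move=> fi; have mf := integ_measurable fi; apply/integrableP; split.
  exact/measurable_EFinP.
rewrite ge0_integral_conditional//; last first.
  by apply: measurableT_comp => //; exact/measurable_EFinP.
rewrite lte_mul_pinfty ?lee_fin ?invr_ge0 ?(ltW pA0)//.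
have /integrableP[_] := integrableS measurableT mA (@subsetT _ A) fi.
by [].
Qed.

Lemma exp_conditional f : integ P f ->
  \int[conditional]_w f w = (\int[P]_w (f w * \1_A w)) / pA.
Proof.
move=> fi; have mf := integ_measurable fi.
have fiA := integrableS measurableT mA (@subsetT _ A) fi.
have E : (\int[conditional]_w (f w)%:E = (pA^-1)%:E * \int[P]_(w in A) (f w)%:E)%E.
  have mEf : measurable_fun setT (fun w => (f w)%:E) by exact/measurable_EFinP.
  have h := integrable_add_def mA fiA.
  rewrite [LHS]integralE ge0_integral_conditional//; last exact: measurable_funepos.
  rewrite ge0_integral_conditional//; last exact: measurable_funeneg.
  by rewrite -muleBr// -integralE.
rewrite /Rintegral E fineM//; last first.
  by apply: integrable_fin_num => //; exact: (integrableS measurableT mA (@subsetT _ A) fi).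
rewrite /= mulrC; congr (_ / _).
rewrite integral_mkcond; congr fine; apply: eq_integral => w _.
by rewrite /patch indicE; case: ifP => _; rewrite ?mulr1 ?mulr0.
Qed.

End Conditioning.

(** * Resampling the light entries of a box *)

Section HeavyLight.
Context {R : realType} d (T : measurableType d) (P : probability T R)
  (mu : set R -> \bar R) (W : T -> arrayT R).
Hypothesis iW : iid_array P mu W.

Let mW : measurable_fun setT W. Proof. by case: iW. Qed.

Let mWB B : measurable B -> measurable (W @^-1` B).
Proof. by move=> mB; have := mW measurableT mB; rewrite setTI. Qed.

Let pr (B : set R) : R := fine (mu B).

Lemma iid_muE B : measurable B -> mu B = P ((fun w => W w 0 0) @^-1` B).
Proof.
move=> mB; have [_ /(_ [:: (0, 0)] (fun=> B) isT (fun=> mB))] := iW.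
by rewrite big_seq1 => <-; rewrite cyl_box1.
Qed.

Let mcoordB B i j : measurable B -> measurable ((fun w => W w i j) @^-1` B).
Proof. by move=> mB; have := measurable_coord i j mW measurableT mB; rewrite setTI. Qed.

Let muE B : measurable B -> mu B = (pr B)%:E.
Proof. by move=> mB; rewrite /pr iid_muE// fineK// fin_num_measure//; exact: mcoordB. Qed.

Let pr_ge0 B : measurable B -> 0 <= pr B.
Proof. by move=> mB; rewrite fine_ge0// iid_muE. Qed.

Let pr_le B C : measurable B -> measurable C -> B `<=` C -> pr B <= pr C.
Proof.
move=> mB mC BC; rewrite -lee_fin -!muE// !iid_muE// le_measure ?inE//; try exact: mcoordB.
by move=> w /=; exact: BC.
Qed.

Lemma exp_prod_iid (h : nat * nat -> R -> R) (c : R) (s : seq (nat * nat)) :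
  uniq s -> (forall z, measurable_fun setT (h z)) ->
  (forall z r, `|h z r| <= c) -> 0 <= c ->
  integ P (fun w => \prod_(z <- s) h z (W w z.1 z.2)) /\
  \int[P]_w \prod_(z <- s) h z (W w z.1 z.2) =
  \prod_(z <- s) \int[P]_w h z (W w 0 0).
Proof.
move=> us mh hc c0.
pose f s' (y : arrayT R) := \prod_(z <- s') h z (y z.1 z.2).
have mf s' : measurable_fun setT (f s').
  elim: s' => [|z s' IH].
    by rewrite (_ : f [::] = fun=> 1)//; apply/funext => y; rewrite /f big_nil.
  rewrite (_ : f (z :: s') = fun y => h z (y z.1 z.2) * f s' y).
    by apply: measurable_funM => //; exact: measurableT_comp (mh z) (measurable_entry _ _).
  by apply/funext => y; rewrite /f big_cons.
have fb s' y : `|f s' y| <= c ^+ size s'.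
  elim: s' => [|z s' IH]; first by rewrite /f big_nil normr1.
  by rewrite /f big_cons normrM exprS ler_pM.
have fi s' : integ P (fun w => f s' (W w)).
  apply: (@integ_bounded _ _ _ _ _ (c ^+ size s')) => //.
  exact: measurableT_comp (mf s') mW.
split; first exact: fi.
elim: s us => [|z s IH] /= => [_|/andP[zs us]].
  by under eq_Rintegral do rewrite big_nil; rewrite exp_cst big_nil.
under eq_Rintegral do rewrite big_cons mulrC.
have mhz : measurable_fun setT (fun y : arrayT R => h z (y z.1 z.2)).
  exact: measurableT_comp (mh z) (measurable_entry _ _).
rewrite (@indep_exp _ _ _ _ _ _ iW (mem s) (f s) (fun y => h z (y z.1 z.2)))//.
- by rewrite big_cons mulrC [\int[P]_w f _ _]IH//; congr (_ * _); exact: (exp_coord iW z.1 z.2 (mh z)).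
- move=> y y' yy'; apply: eq_big_seq => -[i j] zs' /=; congr (h _ _); exact: yy'.
- by move=> y y' yy'; congr (h _ _); apply: yy' => /=; rewrite -surjective_pairing.
- apply: (@integ_bounded _ _ _ _ _ c) => //.
  exact: measurableT_comp mhz mW.
Qed.

Variables (K : R) (D : seq (nat * nat)).
Hypotheses (uD : uniq D) (PK : (0 < mu `]-oo, K]%classic)%E).

Let L : set R := `]-oo, K]%classic.

Let mL : measurable L. Proof. exact: measurable_itv. Qed.

Let pL0 : 0 < pr L.
Proof.
by rewrite -lte_fin -(muE mL).
Qed.

Definition all_light : set T := W @^-1` cyl_box D (fun=> L).

Lemma measurable_all_light : measurable all_light.
Proof. by apply: mWB; exact: cyl_box_measurable. Qed.

Let PcylE s B : uniq s -> (forall z, measurable (B z)) ->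
  P (W @^-1` cyl_box s B) = (\prod_(z <- s) pr (B z))%:E.
Proof.
move=> us mB; have [_ /(_ s B us mB) ->] := iW.
rewrite -prodEFin; apply: eq_bigr => z _; exact: muE.
Qed.

Lemma all_light_gt0 : (0 < P all_light)%E.
Proof. by rewrite PcylE// lte_fin; apply: prodr_gt0. Qed.

Definition lightP : probability T R := conditional P measurable_all_light.

(** Conditioning on a product event keeps the entries in [D] independent; each of them is merely
    conditioned to be at most [K]. *)
Lemma lightP_cyl s B : uniq s -> (forall z, measurable (B z)) ->
  {subset s <= D} ->
  lightP (W @^-1` cyl_box s B) = (\prod_(z <- s) (pr (B z `&` L) / pr L))%:E.
Proof.
move=> us mB sD; rewrite conditionalE; last exact: all_light_gt0.
have -> : W @^-1` cyl_box s B `&` all_light =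
    W @^-1` cyl_box D (fun z => (if z \in s then B z else setT) `&` L).
  apply/seteqP; split=> w /=.
    move=> [h h'] z zD; split; last exact: h'.
    by case: ifP => // zs; exact: h.
  move=> h; split=> z zs; last by have [] := h z zs.
  by have [] := h z (sD z zs); rewrite zs.
rewrite PcylE//; last by move=> z; apply: measurableI => //; case: ifP.
rewrite PcylE// -EFinM; congr EFin.
have pLn : \prod_(z <- D) pr L != 0 by rewrite prodf_seq_neq0; apply/allP => z _ /=; rewrite gt_eqF.
rewrite /=; apply: (mulIf pLn); rewrite divfK//.
rewrite (bigID (mem s)) /= [X in _ = _ * X](bigID (mem s)) /= mulrA; congr (_ * _).
  have ps : perm_eq [seq z <- D | z \in s] s.
    apply: uniq_perm => //; first exact: filter_uniq.
    by move=> z; rewrite mem_filter andb_idr//; exact: sD.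
  rewrite -[in LHS]big_filter -[X in _ = _ * X]big_filter.
  rewrite (perm_big _ ps) [X in _ = _ * X](perm_big _ ps) -big_split/=.
  apply: eq_big_seq => z zs.
  by rewrite zs divfK// gt_eqF.
by apply: eq_bigr => z /negbTE ->; rewrite setTI.
Qed.

(* If [y] is an independent copy of [x] conditioned on all its entries in [D]
   being at most [K], this has the law of [x] on [D]. *)
Definition mixed (x y : nat -> nat -> R) : nat -> nat -> R := fun i j =>
  if (i, j) \in D then (if K < x i j then x i j else y i j) else 0.

(** Like [mixed], this vanishes off [D], so that the two laws can be compared on the whole array
    space. *)
Definition restricted (x : nat -> nat -> R) : nat -> nat -> R := fun i j =>
  if (i, j) \in D then x i j else 0.

Let mm (z : nat * nat) (B : set R) : \bar R :=
  if z \in D then mu B else (\1_B 0)%:E.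

Lemma indep_restricted : indep_law P (fun w => restricted (W w)) mm.
Proof.
move=> s B us mB.
have [s0|] := boolP (all (fun z => (z \in D) || (0 \in B z)) s); last first.
  move=> /allPn[z zs]; rewrite negb_or => /andP[zD z0].
  rewrite (_ : _ @^-1` _ = set0) ?measure0.
    rewrite (big_rem z)//= /mm (negbTE zD) indicE (negbTE z0) mul0e//.
  apply/seteqP; split => // w /= /(_ z zs); rewrite /restricted -surjective_pairing (negbTE zD).
  by move=> /mem_set; rewrite (negbTE z0).
have -> : (fun w => restricted (W w)) @^-1` cyl_box s B =
    W @^-1` cyl_box [seq z <- s | z \in D] B.
  apply/seteqP; split=> w /= h z.
    rewrite mem_filter => /andP[zD zs]; have := h z zs.
    by rewrite /restricted -surjective_pairing zD.
  move=> zs; rewrite /restricted -surjective_pairing; case: ifPn => zD.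
    by apply: h; rewrite mem_filter zD.
  by have := allP s0 z zs; rewrite (negbTE zD)/= inE.
have [_ ->//] := iW; last exact: filter_uniq.
rewrite big_filter [RHS](bigID (mem D))/= [X in (_ = _ * X)%E]big1_seq ?mule1.
  by apply: eq_bigr => z zD; rewrite /mm zD.
move=> z /andP[zD zs]; rewrite /mm (negbTE zD) indicE.
by have := allP s0 z zs; rewrite (negbTE zD)/= => ->.
Qed.

(** The conditional probability that the mixed entry at [z] falls into [B z], given the value [r] of
    the first array there. *)
Let h (B : nat * nat -> set R) (z : nat * nat) (r : R) : R :=
  if z \in D then (if K < r then \1_(B z) r else pr (B z `&` L) / pr L)
  else \1_(B z) 0.

Let hE B z r : h B z r = if z \in D then
  \1_(B z `\` L) r + pr (B z `&` L) / pr L * \1_L r else \1_(B z) 0.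
Proof.
rewrite /h; case: ifP => // _; rewrite !indicE in_setD.
have -> : (r \in L) = ~~ (K < r) by rewrite -leNgt; apply/idP/idP; rewrite inE /L/= in_itv.
by case: ltP => _ /=; rewrite ?andbT ?andbF ?mulr0 ?addr0 ?mulr1 ?add0r.
Qed.

Let mh B z : (forall z, measurable (B z)) -> measurable_fun setT (h B z).
Proof.
move=> mB; rewrite (funext (hE B z)); case: (z \in D) => //.
apply: measurable_funD; first by apply: measurable_indic; exact: measurableD.
by apply: measurable_funM => //; exact: measurable_indic.
Qed.

Let h_bound B z r : (forall z, measurable (B z)) -> `|h B z r| <= 1.
Proof.
move=> mB; have ind01 (C : set R) y : `|\1_C y| <= 1 :> R.
  by rewrite indicE; case: (_ \in _); rewrite ?normr1 ?normr0.
rewrite /h; case: ifP => // _; case: ifP => // _.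
rewrite ger0_norm; last by rewrite divr_ge0 ?pr_ge0//; exact: measurableI.
rewrite ler_pdivrMr// mul1r; apply: pr_le => //; first exact: measurableI.
Qed.

Let Eh B z : (forall z, measurable (B z)) ->
  \int[P]_w h B z (W w 0 0) = fine (mm z (B z)).
Proof.
move=> mB; under eq_Rintegral do rewrite hE; rewrite /mm; case: ifP => zD; last first.
  by rewrite exp_cst.
have Eind C : measurable C -> integ P (fun w => \1_C (W w 0 0) : R) /\
    \int[P]_w \1_C (W w 0 0) = pr C.
  move=> mC; split.
    apply: (@integ_bounded _ _ _ _ _ 1).
      exact: (measurable_coord_comp iW 0 0 (measurable_indic mC)).
    by move=> w; rewrite indicE; case: (_ \in _); rewrite ?normr1 ?normr0.
  rewrite /pr iid_muE// /Rintegral -[in RHS](setIT (_ @^-1` C)) -integral_indic//.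
  exact: mcoordB.
have mBL : measurable (B z `\` L) by exact: measurableD.
have [i1 e1] := Eind _ mBL; have [i2 e2] := Eind _ mL.
rewrite expD//; last exact: integZ.
rewrite expZ// e1 e2 divfK ?gt_eqF//.
have mBI : measurable (B z `&` L) by exact: measurableI.
apply: EFin_inj; rewrite EFinD -!muE// !iid_muE// -measureU//; try exact: mcoordB.
  by rewrite -preimage_setU setUC setUIDK.
by apply/seteqP; split => w //= -[[_ nL] [_ l]].
Qed.

(** For a fixed first array the section of a box is again a box, over the light cells; its
    conditioned probability is the product of the values of [h]. Independence in the first array
    then leaves the product of the means of [h], which are the marginals. *)
Lemma indep_mixed : indep_law (P \x lightP)%E (fun w => mixed (W w.1) (W w.2)) mm.
Proof.
move=> s B us mB.
have [ih eh] := exp_prod_iid us (fun z => mh z mB) (fun z r => h_bound z r mB) ler01.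
have hm z : mm z (B z) = (fine (mm z (B z)))%:E.
  by rewrite /mm; case: ifP => _; rewrite ?muE.
transitivity (\int[P]_w (\prod_(z <- s) h B z (W w z.1 z.2))%:E)%E; last first.
  rewrite (eq_bigr (fun z => (fine (mm z (B z)))%:E)); last by move=> z _; exact: hm.
  rewrite prodEFin -(eq_bigr _ (fun z _ => Eh z mB)) -eh /Rintegral fineK//.
  exact: integrable_fin_num.
rewrite -[LHS]/(\int[P]_w lightP (xsection _ w))%E; apply: eq_integral => w _ /=.
pose light (z : nat * nat) := (z \in D) && ~~ (K < W w z.1 z.2).
pose ok (z : nat * nat) := if z \in D then W w z.1 z.2 \in B z else 0 \in B z.
have hlight z : ~~ light z -> h B z (W w z.1 z.2) = (ok z)%:R.
  by rewrite /light /h /ok; case: (z \in D) => //= /negPn ->.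
have mixedE w' z : mixed (W w) (W w') z.1 z.2 = if light z then W w' z.1 z.2
    else if z \in D then W w z.1 z.2 else 0.
  rewrite /mixed -surjective_pairing /light; case: (z \in D) => //=.
  by case: (K < _)%R.
have [s0|] := boolP (all (fun z => light z || ok z) s); last first.
  move=> /allPn[z zs]; rewrite negb_or => /andP[zD z0].
  rewrite (_ : xsection _ _ = set0) ?measure0.
    by rewrite (big_rem z)//= hlight// (negbTE z0) mul0r.
  apply/seteqP; split => // w' /=; rewrite /xsection/= inE/= => /(_ z zs).
  rewrite mixedE (negbTE zD); move: z0; rewrite /ok; case: ifP => _ z0 /mem_set;
    by rewrite (negbTE z0).
have -> : xsection ((fun w => mixed (W w.1) (W w.2)) @^-1` cyl_box s B) w =
    W @^-1` cyl_box [seq z <- s | light z] B.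
  apply/seteqP; split=> w' /=; rewrite /xsection/= inE/= => hz z.
    rewrite mem_filter => /andP[zl zs]; have := hz z zs.
    by rewrite mixedE zl.
  move=> zs; rewrite mixedE; case: ifPn => zl.
    by apply: hz; rewrite mem_filter zl.
  by have := allP s0 z zs; rewrite (negbTE zl)/= /ok; case: ifP => _; rewrite inE.
rewrite lightP_cyl//; last 2 first.
- exact: filter_uniq.
- by move=> z; rewrite mem_filter => /andP[/andP[]].
congr EFin; rewrite big_filter [RHS](bigID light)/= [X in _ = _ * X]big1_seq ?mulr1.
  apply: eq_bigr => z /andP[zD zl]; rewrite /h zD.
  by rewrite (negbTE zl).
move=> z /andP[zl zs]; rewrite hlight//.
by have := allP s0 z zs; rewrite (negbTE zl)/= => ->.
Qed.

Lemma measurable_mixed : measurable_fun setT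
  (fun w : T * T => mixed (W w.1) (W w.2) : arrayT R).
Proof.
apply: measurable_arrayP => i j; rewrite /mixed; case: ((i, j) \in D) => //.
have m1 : measurable_fun setT (fun w : T * T => W w.1 i j).
  exact: (measurableT_comp (measurable_coord i j mW) measurable_fst).
have m2 : measurable_fun setT (fun w : T * T => W w.2 i j).
  exact: (measurableT_comp (measurable_coord i j mW) measurable_snd).
by apply: measurable_fun_if => //; [exact: measurable_fun_ltr|exact: measurable_funTS..].
Qed.

Lemma measurable_restricted : measurable_fun setT
  (fun w : T => restricted (W w) : arrayT R).
Proof.
apply: measurable_arrayP => i j; rewrite /restricted; case: ((i, j) \in D) => //.
exact: measurable_coord.
Qed.

Lemma mixed_same_law : same_law P (fun w => restricted (W w))
  (P \x lightP)%E (fun w => mixed (W w.1) (W w.2)).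
Proof.
exact: (indep_law_unique measurable_restricted measurable_mixed indep_restricted indep_mixed).
Qed.

End HeavyLight.

Section Box.
Context {R : realType}.

Definition box q p : seq (nat * nat) :=
  [seq (i, j) | i <- iota 0 q.+1, j <- iota 0 p.+1].

Lemma box_uniq q p : uniq (box q p).
Proof. by apply: allpairs_uniq; rewrite ?iota_uniq// => -[? ?] [? ?]. Qed.

Lemma mem_box q p i j : ((i, j) \in box q p) = (i <= q)%N && (j <= p)%N.
Proof.
apply/allpairsP/andP => [[[i' j'] [h1 h2 [-> ->]]]|[iq jp]].
  by move: h1 h2; rewrite !mem_iota !add0n !ltnS.
by exists (i, j); split; rewrite // mem_iota add0n ltnS.
Qed.

(** The last vertex lies on every path, so its excess is gained in full. *)
Lemma lpp_last_ge (x y : nat -> nat -> R) q p : (0 < q + p)%N ->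
  (forall i j, (i <= q)%N -> (j <= p)%N -> y i j <= x i j) ->
  lpp y q p + (x q p - y q p) <= lpp x q p.
Proof.
move=> qp yx; rewrite addrCA -lerBrDl.
suff : lpp y q p - y q p <= lpp x q p - x q p by lra.
case: q p qp yx => [|q] [|p] // _ yx.
- by rewrite !lpp0S !addrK; apply: ler_lpp => i j iq jp; apply: yx => //; exact: leqW.
- by rewrite !lppS0 !addrK; apply: ler_lpp => i j iq jp; apply: yx => //; exact: leqW.
- rewrite !lppSS !addrK ge_max !le_max !ler_lpp ?orbT// => i j iq jp; apply: yx => //; exact: leqW.
Qed.

(** An indicator in product form, which splits over disjoint sets of cells. *)
Definition below (K : R) (s : seq (nat * nat)) (x : nat -> nat -> R) : R :=
  \prod_(z <- s) (x z.1 z.2 <= K)%R%:R.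

Lemma measurable_below K s : measurable_fun setT (below K s : arrayT R -> R).
Proof.
elim: s => [|z s IH].
  by rewrite (_ : below K [::] = fun=> 1)//; apply/funext => y; rewrite /below big_nil.
rewrite (_ : below K (z :: s) = fun y => (y z.1 z.2 <= K)%R%:R * below K s y).
  apply: measurable_funM => //.
  apply: (measurableT_comp (f := fun c : bool => c%:R : R)) => //.
  by apply: measurable_fun_ler => //; exact: measurable_entry.
by apply/funext => y; rewrite /below big_cons.
Qed.

Lemma belowE K s x : below K s x = (all (fun z => x z.1 z.2 <= K) s)%:R.
Proof.
elim: s => [|z s IH]; first by rewrite /below big_nil.
by rewrite /below big_cons -/(below K s x) IH /= -natrM mulnb.
Qed.

Lemma below_le1 K s x : `|below K s x| <= 1.
Proof. by rewrite belowE; case: all; rewrite ?normr1 ?normr0. Qed.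

End Box.

Section LightGain.
Context {R : realType} d (T : measurableType d) (P : probability T R)
  (mu : set R -> \bar R) (W : T -> arrayT R).
Hypotheses (iW : iid_array P mu W) (W1 : integ P (fun w => W w 0 0)).

Let mW : measurable_fun setT W. Proof. by case: iW. Qed.

Let ibelow K s : integ P (fun w => below K s (W w)).
Proof.
apply: (@integ_bounded _ _ _ _ _ 1); last by move=> w; exact: below_le1.
exact: (measurableT_comp (measurable_below K s) mW).
Qed.

Lemma integM_below K s (f : T -> R) : integ P f -> integ P (fun w => f w * below K s (W w)).
Proof.
move=> fi; apply: (integ_le _ (integ_norm fi)).
  apply: measurable_funM; first exact: integ_measurable fi.
  exact: (measurableT_comp (measurable_below K s) mW).
by move=> w; rewrite normrM -[leRHS]mulr1 ler_wpM2l// below_le1.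
Qed.

Lemma cvg_below (f : T -> R) s : integ P f ->
  \int[P]_w (f w * below n%:R s (W w)) @[n --> \oo] --> \int[P]_w f w.
Proof.
move=> fi.
have mf := integ_measurable fi.
suff H : (\int[P]_w (f w * below n%:R s (W w))%:E @[n --> \oo] --> \int[P]_w (f w)%:E)%E.
  apply: fine_cvg; rewrite /Rintegral fineK//; exact: integrable_fin_num.
have mfb n : measurable_fun setT (fun w => f w * below n%:R s (W w)).
  exact: (integ_measurable (integM_below n%:R s fi)).
have ae_cv : {ae P, forall w, setT w ->
    (f w * below n%:R s (W w))%:E @[n --> \oo] --> (f w)%:E}.
  apply: aeW => w _; apply/fine_cvgP; split; first by apply: nearW.
  apply: cvg_near_cst; near=> n.
  rewrite /= belowE (_ : all _ _) ?mulr1//; apply/allP => z zs.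
  have : \sum_(z <- s) `|W w z.1 z.2| <= n%:R by near: n; exact: nbhs_infty_ger.
  apply: le_trans; rewrite (big_rem z)//= (le_trans (ler_norm _))// lerDl.
  by rewrite sumr_ge0.
have ae_le : {ae P, forall w n, setT w ->
    (`|(f w * below n%:R s (W w))%:E| <= `|f w|%:E)%E}.
  apply: aeW => w n _; rewrite abse_EFin lee_fin normrM -[leRHS]mulr1.
  by rewrite ler_wpM2l// below_le1.
have [_ _] := @dominated_convergence _ _ R P setT measurableT _ _ _
  (fun n => proj2 (measurable_EFinP _ _) (mfb n)) (proj2 (measurable_EFinP _ _) mf) ae_cv (integ_norm fi) ae_le.
exact.
Unshelve. all: by end_near.
Qed.

Lemma integ_translate (f : arrayT R -> R) a b : measurable_fun setT f ->
  integ P (fun w => f (W w)) -> integ P (fun w => f (translate (W w) a b)).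
Proof.
move=> mf; exact: (same_law_integrable (iid_same_law iW (iid_translate a b iW)) mf).
Qed.

Lemma exp_translate (f : arrayT R -> R) a b : measurable_fun setT f ->
  \int[P]_w f (translate (W w) a b) = \int[P]_w f (W w).
Proof.
move=> mf; exact: (same_law_Rintegral (iid_same_law (iid_translate a b iW) iW) mf).
Qed.

Variables (K : R) (M1 N1 : nat).
Hypothesis PK : (0 < mu `]-oo, K]%classic)%E.

Let D := box M1 N1.
Let LP := lightP iW K D.

Let Ebelow_gt0 s : uniq s -> 0 < \int[P]_w below K s (W w).
Proof.
move=> us; have := all_light_gt0 iW us PK; set A := all_light _ _ _.
have mA : measurable A by exact: (measurable_all_light iW).
have <- : \int[P]_w \1_A w = \int[P]_w below K s (W w).
  apply: eq_Rintegral => w _; rewrite belowE indicE; congr (nat_of_bool _)%:R.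
  apply/idP/allP => [|h]; rewrite inE.
    by move=> h z zs; have := h z zs; rewrite /= in_itv.
  by move=> z zs; rewrite /= in_itv/=; exact: h.
rewrite /Rintegral integral_indic// setIT => A0.
by rewrite -lte_fin fineK// fin_num_measure.
Qed.

(** The conditions on the cells outside the translated box are independent of [f] and cancel in the
    quotient; what remains depends neither on the position nor on the surrounding box. *)
Lemma light_exp (f : arrayT R -> R) q p a b :
  measurable_fun setT f -> depends_on (mem (box q p)) f ->
  integ P (fun w => f (W w)) -> (a + q <= M1)%N -> (b + p <= N1)%N ->
  \int[LP]_w f (translate (W w) a b) =
  \int[P]_w (f (W w) * below K (box q p) (W w)) /
  \int[P]_w below K (box q p) (W w).
Proof.
move=> mf fdep fi aq bp.
have uD : uniq D by exact: box_uniq.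
have mtr : measurable_fun setT (fun x : arrayT R => translate x a b : arrayT R).
  exact: measurable_translate.
rewrite exp_conditional; [|exact: (all_light_gt0 iW uD PK)|exact: (@integ_translate f a b mf fi)].
set A := all_light _ _ _.
pose ins (z : nat * nat) := [&& a <= z.1, z.1 <= a + q, b <= z.2 & z.2 <= b + p]%N.
pose S := [seq z <- D | ins z]; pose S' := [seq z <- D | ~~ ins z].
have AE w : \1_A w = below K S (W w) * below K S' (W w).
  transitivity (below K D (W w)); last first.
    by rewrite /below !big_filter [LHS](bigID ins).
  rewrite belowE indicE.
  congr (nat_of_bool _)%:R; apply/idP/allP => [|h]; rewrite inE.
    by move=> h z zs; have := h z zs; rewrite /= in_itv.
  by move=> z zs; rewrite /= in_itv/=; exact: h.
have SE x : below K S x = below K (box q p) (translate x a b).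
  have pS : perm_eq S [seq (a + z.1, b + z.2)%N | z <- box q p].
    apply: uniq_perm; first exact: filter_uniq.
      rewrite map_inj_uniq ?box_uniq// => -[i j] [i' j'] /= [].
      by move=> /addnI-> /addnI->.
    move=> [i j]; rewrite mem_filter mem_box; apply/idP/mapP; rewrite /ins.
      move=> /andP[/and4P[ai iq bj jp] _]; exists (i - a, j - b)%N.
        by rewrite mem_box !leq_subLR iq jp.
      by rewrite !subnKC.
    move=> [[i' j']]; rewrite mem_box => /andP[iq jp] [-> ->].
    by rewrite !leq_addr !leq_add2l iq jp/= (leq_trans _ aq) ?(leq_trans _ bp)// leq_add2l.
  by rewrite /below (perm_big _ pS) big_map.
have insD' : depends_on ins (below K S).
  move=> x y xy; rewrite /below; apply: eq_big_seq => -[i j].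
  by rewrite mem_filter => /andP[insz _]; rewrite xy.
have ninsD' : depends_on (predC ins) (below K S').
  move=> x y xy; rewrite /below; apply: eq_big_seq => -[i j].
  by rewrite mem_filter => /andP[insz _]; rewrite xy.
have key (g : arrayT R -> R) : measurable_fun setT g -> depends_on (mem (box q p)) g ->
    integ P (fun w => g (W w)) ->
    \int[P]_w (g (translate (W w) a b) * \1_A w) =
    \int[P]_w (g (W w) * below K (box q p) (W w)) * \int[P]_w below K S' (W w).
  move=> mg gdep gi.
  pose F (x : arrayT R) : R := g (translate x a b) * below K S x.
  have FE : F = (fun x : arrayT R => (fun y : arrayT R => g y * below K (box q p) y) (translate x a b)).
    by apply/funext => x; rewrite /F SE.
  have mgb : measurable_fun setT (fun y : arrayT R => g y * below K (box q p) y : R).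
    by apply: measurable_funM => //; exact: measurable_below.
  have mF : measurable_fun setT F by rewrite FE; exact: measurableT_comp mgb mtr.
  have Fi : integ P (fun w => F (W w)).
    rewrite FE; apply: (@integ_translate (fun y => g y * below K (box q p) y)) => //.
    exact: integM_below.
  have FD : depends_on ins F.
    move=> x y xy; congr (_ * _); last exact: insD'.
    apply: gdep => i j /=; rewrite mem_box => /andP[iq jp]; apply: xy.
    by rewrite /ins/= !leq_addr !leq_add2l iq jp.
  under eq_Rintegral do rewrite AE mulrA.
  rewrite (indep_exp iW mF (measurable_below K S') FD ninsD' Fi (ibelow K S')).
  congr (_ * _); rewrite FE.
  exact: (@exp_translate (fun y => g y * below K (box q p) y)).
have one_mul (B : T -> R) : \int[P]_w (1 * B w) = \int[P]_w B w.
  by under eq_Rintegral do rewrite mul1r.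
have mA : measurable A by exact: (measurable_all_light iW).
have PAE : fine (P A) = \int[P]_w below K (box q p) (W w) * \int[P]_w below K S' (W w).
  have := key (fun=> 1) (measurable_cst _) (fun _ _ _ => erefl) (integ_cst P 1).
  by rewrite !one_mul => <-; rewrite /Rintegral integral_indic// setIT.
rewrite (key f mf fdep fi) PAE.
have e1 : \int[P]_w below K (box q p) (W w) != 0.
  by rewrite gt_eqF//; apply: Ebelow_gt0; exact: box_uniq.
have e2 : \int[P]_w below K S' (W w) != 0.
  by rewrite gt_eqF//; apply: Ebelow_gt0; exact: filter_uniq.
by field; rewrite e1 e2.
Qed.

End LightGain.

Section LightBlocks.
Context {R : realType} d (T : measurableType d) (P : probability T R)
  (mu : set R -> \bar R) (W : T -> arrayT R).
Hypotheses (iW : iid_array P mu W) (W1 : integ P (fun w => W w 0 0)).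

Lemma cvg_ratio_below (f : T -> R) s : integ P f ->
  \int[P]_w (f w * below n%:R s (W w)) / \int[P]_w below n%:R s (W w)
    @[n --> \oo] --> \int[P]_w f w.
Proof.
move=> fi.
rewrite -[X in _ --> X]divr1; apply: cvgM; first exact: (cvg_below iW).
apply: cvgV; first exact: oner_neq0.
have := cvg_below iW s (integ_cst P 1); rewrite exp_cst.
by under eq_fun do under eq_Rintegral do rewrite mul1r.
Qed.

(* The quotients are expectations conditioned on all weights of the box being
   at most [K]; they tend to the unconditional ones as [K] grows. *)
Lemma truncation_level (q p : nat) (c : R) :
  0 < \int[P]_w W w 0 0 -> c < \int[P]_w lpp (W w) q p ->
  exists K : R, [/\ 0 <= K, (0 < mu `]-oo, K]%classic)%E,
    c <= \int[P]_w (lpp (W w) q p * below K (box q p) (W w)) /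
         \int[P]_w below K (box q p) (W w) &
    0 <= \int[P]_w (W w 0 0 * below K (box 0 0) (W w)) /
         \int[P]_w below K (box 0 0) (W w)].
Proof.
move=> m0 cq.
have c1 := cvg_ratio_below (box q p) (integ_lpp iW q p W1).
have c2 := cvg_ratio_below (box 0 0) W1.
have c3 := cvg_below iW (box 0 0) (integ_cst P 1); rewrite exp_cst in c3.
have [n [h1 [h2 h3]]] : exists n : nat,
    c < \int[P]_w (lpp (W w) q p * below n%:R (box q p) (W w)) /
         \int[P]_w below n%:R (box q p) (W w) /\
    0 < \int[P]_w (W w 0 0 * below n%:R (box 0 0) (W w)) /
         \int[P]_w below n%:R (box 0 0) (W w) /\
    0 < \int[P]_w (1 * below n%:R (box 0 0) (W w)).
  near \oo => n; exists n; split; last split; near: n.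
  - exact: (cvgr_gt _ c1).
  - exact: (cvgr_gt _ c2).
  - exact: (cvgr_gt _ c3).
exists n%:R; split => //; [|exact: ltW..].
have [mW _] := iW.
have mL : measurable (`]-oo, n%:R] : set R) by exact: measurable_itv.
rewrite (iid_muE iW mL) lt0e measure_ge0 andbT; apply/eqP => PL0.
suff E : \int[P]_w (1 * below n%:R (box 0 0) (W w)) =
    fine (P ((fun w => W w 0 0) @^-1` `]-oo, n%:R])).
  by move: h3; rewrite E PL0 ltxx.
rewrite /Rintegral -[in RHS](setIT (_ @^-1` _)) -integral_indic//; last first.
  by have := measurable_coord 0 0 mW measurableT mL; rewrite setTI.
congr fine; apply: eq_integral => w _; rewrite mul1r /below big_seq1 indicE.
congr ((nat_of_bool _)%:R)%:E; apply/idP/idP => [h|]; first by rewrite inE /= in_itv.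
by rewrite inE /= in_itv.
Unshelve. all: by end_near.
Qed.

Variables (K : R) (M1 N1 q0 p0 : nat) (c : R).
Hypotheses (PK : (0 < mu `]-oo, K]%classic)%E) (c0 : 0 <= c)
  (light_block : c <= \int[P]_w (lpp (W w) q0 p0 * below K (box q0 p0) (W w)) /
         \int[P]_w below K (box q0 p0) (W w))
  (light_cell : 0 <= \int[P]_w (W w 0 0 * below K (box 0 0) (W w)) /
         \int[P]_w below K (box 0 0) (W w)).

Let LP := lightP iW K (box M1 N1).
Let capK (x : nat -> nat -> R) : nat -> nat -> R := fun i j => Num.min (x i j) K.
(** Inside the box the cap is almost surely vacuous under [LP]; it makes the later comparison with
    the resampled array hold for every sample point. *)
Let V w := capK (W w).

Let iV : iid_array P (fun A => mu ((fun r => Num.min r K) @^-1` A)) (V : T -> arrayT R).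
Proof. exact: (iid_map iW (measurable_min_cst K)). Qed.

Let V1 : integ P (fun w => V w 0 0).
Proof. exact: (integ_min_cst iW W1). Qed.

Let mcap : measurable_fun setT (fun x : arrayT R => capK x : arrayT R).
Proof.
apply: measurable_arrayP => i j.
exact: (measurableT_comp (measurable_min_cst K) (measurable_entry i j)).
Qed.

Lemma integ_light_lpp a b q p : integ LP (fun w => lpp (translate (V w) a b) q p).
Proof.
apply: integ_conditional; first exact: (all_light_gt0 iW (box_uniq _ _) PK).
apply: (@integ_translate _ _ _ _ _ _ iV (fun x => lpp x q p) a b).
  exact: measurable_lpp.
exact: (integ_lpp iV).
Qed.

Let integ_light_cell i j : integ LP (fun w => V w i j).
Proof.
apply: integ_conditional; first exact: (all_light_gt0 iW (box_uniq _ _) PK).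
exact: (@integ_coord _ _ _ _ _ _ iV id i j).
Qed.

Let cap_below (f : arrayT R -> R) s w :
  depends_on (mem s) f ->
  f (V w) * below K s (W w) = f (W w) * below K s (W w).
Proof.
move=> fs; rewrite belowE; case: allP => [h|]; last by rewrite !mulr0.
rewrite !mulr1; apply: fs => i j ijs; rewrite /V /capK min_l//.
exact: (h (i, j)).
Qed.

Lemma light_block_ge a b : (a + q0 <= M1)%N -> (b + p0 <= N1)%N ->
  c <= \int[LP]_w lpp (translate (V w) a b) q0 p0.
Proof.
move=> aq bp; apply: (le_trans light_block).
have dep : depends_on (mem (box q0 p0)) (fun x => lpp (capK x) q0 p0).
  move=> x y xy /=; apply: eq_lpp => i j iq jp _.
  by rewrite /capK xy// /= mem_box iq.
have dep' : depends_on (mem (box q0 p0)) (fun x : arrayT R => lpp x q0 p0).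
  by move=> x y xy; apply: eq_lpp => i j iq jp _; rewrite xy// /= mem_box iq.
have := @light_exp _ _ _ _ _ _ iW K M1 N1 PK (fun x => lpp (capK x) q0 p0) q0 p0 a b _ dep _ aq bp.
move=> -> //; last 2 first.
- exact: (measurableT_comp (measurable_lpp q0 p0) mcap).
- exact: (integ_lpp iV).
rewrite le_eqVlt; apply/orP; left; apply/eqP; congr (_ / _).
by apply: eq_Rintegral => w _; rewrite -(cap_below w dep').
Qed.

Lemma light_cell_ge i j : (i <= M1)%N -> (j <= N1)%N -> 0 <= \int[LP]_w V w i j.
Proof.
move=> iM jN; apply: (le_trans light_cell).
have dep : depends_on (mem (box 0 0)) (fun x => capK x 0%N 0%N).
  by move=> x y xy; rewrite /capK xy// mem_box.
have dep' : depends_on (mem (box 0 0)) (fun x : arrayT R => x 0%N 0%N).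
  by move=> x y xy; rewrite xy// mem_box.
have E : \int[LP]_w V w i j =
    \int[LP]_w (fun x : arrayT R => capK x 0%N 0%N) (translate (W w) i j).
  by apply: eq_Rintegral => w _; rewrite /V /capK /translate !addn0.
rewrite E (@light_exp _ _ _ _ _ _ iW K M1 N1 PK (fun x : arrayT R => capK x 0%N 0%N) 0 0) ?addn0//; last first.
  exact: (measurableT_comp (measurable_entry 0 0) mcap).
rewrite le_eqVlt; apply/orP; left; apply/eqP; congr (_ / _).
by apply: eq_Rintegral => w _; rewrite -(cap_below w dep').
Qed.

Lemma light_ge0 a b q p : (a + q <= M1)%N -> (b + p <= N1)%N ->
  0 <= \int[LP]_w lpp (translate (V w) a b) q p.
Proof.
move=> aq bp.
have i1 : integ LP (fun w => \sum_(1 <= i < q.+1) translate (V w) a b i 0).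
  by apply: integ_sum => i; exact: integ_light_cell.
have i2 : integ LP (fun w => \sum_(1 <= j < p.+1) translate (V w) a b q j).
  by apply: integ_sum => i; exact: integ_light_cell.
apply: (@le_trans _ _ (\int[LP]_w (\sum_(1 <= i < q.+1) translate (V w) a b i 0 +
    \sum_(1 <= j < p.+1) translate (V w) a b q j))); last first.
  apply: exp_le; [exact: integD|exact: integ_light_lpp|].
  by move=> w; exact: lpp_ge_corner.
rewrite expD// !exp_sum; [|by move=> j; exact: integ_light_cell..].
rewrite addr_ge0// big_nat_cond sumr_ge0// => i /andP[/andP[i1' iq] _].
  by apply: light_cell_ge; lia.
by apply: light_cell_ge; lia.
Qed.

Let light_super a b q p q' p' : (a + (q + q') <= M1)%N -> (b + (p + p') <= N1)%N ->
  \int[LP]_w lpp (translate (V w) a b) q p +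
  \int[LP]_w lpp (translate (V w) (a + q) (b + p)) q' p' <=
  \int[LP]_w lpp (translate (V w) a b) (q + q') (p + p').
Proof.
move=> aq bp; rewrite -expD; [|exact: integ_light_lpp..].
apply: exp_le; [by apply: integD; exact: integ_light_lpp|exact: integ_light_lpp|].
by move=> w; rewrite -translate_translate; exact: lpp_super.
Qed.

(** By superadditivity, [t] blocks are strung along the diagonal, each gaining [c]; the rectangle
    left over has nonnegative mean by [light_ge0]. *)
Lemma light_blocks t a b q p : (t * q0 <= q)%N -> (t * p0 <= p)%N ->
  (a + q <= M1)%N -> (b + p <= N1)%N ->
  c * t%:R <= \int[LP]_w lpp (translate (V w) a b) q p.
Proof.
elim: t a b q p => [|t IH] a b q p tq tp aq bp.
  by rewrite mulr0 light_ge0.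
have -> : (q = q0 + (q - q0))%N by rewrite mulSn in tq; lia.
have -> : (p = p0 + (p - p0))%N by rewrite mulSn in tp; lia.
rewrite mulSn in tq; rewrite mulSn in tp.
apply: le_trans (light_super _ _); [|lia|lia].
rewrite -nat1r mulrDr mulr1; apply: lerD; first by apply: light_block_ge; lia.
by apply: IH; lia.
Qed.

End LightBlocks.

(** * Adding the light gain to the heavy one *)

Section HeavyLightInduction.
Context {R : realType} d (T : measurableType d) (P : probability T R)
  (mu : set R -> \bar R) (W : T -> arrayT R).
Hypotheses (iW : iid_array P mu W) (W1 : integ P (fun w => W w 0 0)).
Variables (K : R) (q0 p0 m n : nat) (c : R).
Hypotheses (PK : (0 < mu `]-oo, K]%classic)%E) (c0 : 0 <= c) (p0_gt0 : (0 < p0)%N)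
  (light_block : c <= \int[P]_w (lpp (W w) q0 p0 * below K (box q0 p0) (W w)) /
         \int[P]_w below K (box q0 p0) (W w))
  (light_cell : 0 <= \int[P]_w (W w 0 0 * below K (box 0 0) (W w)) /
         \int[P]_w below K (box 0 0) (W w)).

Let mW : measurable_fun setT W. Proof. by case: iW. Qed.

(* Shearing the rows makes the slope of every segment between two heavy
   vertices at least about [q0 / p0]. *)
Definition shear (i j : nat) : nat := (i + q0 * (j %/ p0))%N.

Let M1 := shear m n.
Let D := box M1 n.
Let LP := lightP iW K D.
Let V w : nat -> nat -> R := fun i j => Num.min (W w i j) K.

Lemma shear_mono i j i' j' : (i' <= i)%N -> (j' <= j)%N -> (shear i' j' <= shear i j)%N.
Proof. by move=> ii jj; rewrite /shear leq_add// leq_mul2l leq_div2r// orbT. Qed.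

(** When [t.+1] multiples of [p0] are passed, only [t] whole blocks are sure to fit between [j'] and
    [j]; this costs the last [c]. *)
Lemma light_segment i j i' j' : (i' <= i <= m)%N -> (j' <= j <= n)%N ->
  c * (j %/ p0)%:R - c * (j' %/ p0)%:R - c <=
  \int[LP]_w lpp (translate (V w) (shear i' j') j') (shear i j - shear i' j') (j - j').
Proof.
move=> /andP[ii im] /andP[jj jn].
have sm : (shear i j <= M1)%N by exact: shear_mono.
have ss : (shear i' j' <= shear i j)%N by exact: shear_mono.
have b1 : (shear i' j' + (shear i j - shear i' j') <= M1)%N by rewrite subnKC.
have b2 : (j' + (j - j') <= n)%N by rewrite subnKC.
have dd : (j' %/ p0 <= j %/ p0)%N by exact: leq_div2r.
have [E|lt] := eqVneq (j %/ p0)%N (j' %/ p0)%N.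
  rewrite E subrr sub0r; apply: le_trans (_ : 0 <= _); first by rewrite oppr_le0.
  exact: (light_ge0 iW W1 PK c0 light_block light_cell b1 b2).
have [t Et] : exists t, (j %/ p0 = t.+1 + j' %/ p0)%N.
  exists (j %/ p0 - j' %/ p0).-1; rewrite prednK ?subnK// subn_gt0 ltn_neqAle dd.
  by rewrite eq_sym lt.
apply: le_trans (light_blocks iW W1 PK c0 light_block light_cell (t := t) _ _ b1 b2).
- by rewrite Et natrD -natr1; lra.
- rewrite /shear Et mulnDr; nia.
- have := leq_divM j p0; have := ltn_ceil j' p0_gt0; rewrite Et; nia.
Qed.

Section pointwise.
Variable w : T.

Let Xs w' := mixed K D (W w) (W w').
(** The excess is counted above [K + c]: [K] bounds the light weight that the vertex replaces, and
    [c] pays for the loss in the preceding [light_segment]. *)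
Let Y (i j : nat) : R := Num.max (W w (shear i j) j - (K + c)) 0.
Let H := lpp Y.
Let Phi i j := \int[LP]_w' lpp (Xs w') (shear i j) j.

Let iXs i j : integ LP (fun w' => Xs w' i j).
Proof.
have mc : measurable_fun setT (fun w' => W w' i j) by exact: measurable_coord.
rewrite /Xs /mixed; case: ((i, j) \in D); last exact: integ_cst.
case: (K < W w i j)%R; first exact: integ_cst.
apply: integ_conditional; first exact: (all_light_gt0 iW (box_uniq _ _) PK).
exact: (@integ_coord _ _ _ _ _ _ iW id i j).
Qed.

Let iXs_lpp a b p q : integ LP (fun w' => lpp (translate (Xs w') a b) p q).
Proof. by apply: integ_lpp_coord => i j; exact: iXs. Qed.

Let Xs_ge w' i j : (i <= M1)%N -> (j <= n)%N -> V w' i j <= Xs w' i j.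
Proof.
move=> iM jn; rewrite /Xs /mixed mem_box iM jn /= /V.
by case: ltP => h; rewrite ge_min ?lexx ?(ltW h) ?orbT.
Qed.

Let Xs_heavy w' i j : (i <= m)%N -> (j <= n)%N -> 0 < Y i j ->
  Y i j + c <= Xs w' (shear i j) j - V w' (shear i j) j.
Proof.
move=> im jn; rewrite /Y lt_max ltxx orbF subr_gt0 => h.
rewrite max_l; last by rewrite subr_ge0 ltW.
have sM : (shear i j <= M1)%N by exact: shear_mono.
rewrite /Xs /mixed mem_box sM jn/= ifT; last by apply: le_lt_trans h; rewrite lerDl.
rewrite /V opprD addrA addrNK lerB// ge_min lexx orbT//.
Qed.

Let Phi_super i j i' j' : (i' <= i)%N -> (j' <= j)%N ->
  Phi i' j' + \int[LP]_w' lpp (translate (Xs w') (shear i' j') j')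
    (shear i j - shear i' j') (j - j') <= Phi i j.
Proof.
move=> ii jj; rewrite -expD; [|by have := iXs_lpp 0 0 (shear i' j') j'|exact: iXs_lpp].
apply: exp_le.
- by apply: integD; [have := iXs_lpp 0 0 (shear i' j') j'|exact: iXs_lpp].
- by have := iXs_lpp 0 0 (shear i j) j.
move=> w'; apply: (le_trans (lpp_super _ _ _ _ _)).
by rewrite !subnKC//; exact: shear_mono.
Qed.

(* [(i', j')] is the last vertex of an optimal heavy path to [(i, j)] that has
   positive heavy weight, so that no heavy gain is lost after it. *)
Let anchored i j := exists i' j', [/\ (i' <= i)%N, (j' <= j)%N,
  H i j <= H i' j' & H i' j' + c * (j' %/ p0)%:R <= Phi i' j'].

(** If [(i, j)] has no heavy weight, the old anchor is kept. Otherwise a light segment leads from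
    the old anchor to [(i, j)], whose surplus [c] makes up for the loss of that segment. *)
Let anchored_step i j i0 j0 : (i <= m)%N -> (j <= n)%N -> (i0 <= i)%N ->
  (j0 <= j)%N -> (i0 + j0 < i + j)%N -> H i j = H i0 j0 + Y i j ->
  anchored i0 j0 -> anchored i j.
Proof.
move=> im jn i0i j0j ltij HE [i' [j' [ii jj H0 HP]]].
have Y0 : 0 <= Y i j by rewrite le_max lexx orbT.
have ii' : (i' <= i)%N by exact: leq_trans i0i.
have jj' : (j' <= j)%N by exact: leq_trans j0j.
have [YE|Yn0] := eqVneq (Y i j) 0.
  by exists i', j'; rewrite HE YE addr0.
have Ypos : 0 < Y i j by rewrite lt_def Yn0.
exists i, j; split => //.
apply: le_trans (Phi_super ii' jj').
have seg := @light_segment i j i' j' (introT andP (conj ii' im)) (introT andP (conj jj' jn)).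
have smono := shear_mono ii' jj'.
have pos : (0 < (shear i j - shear i' j') + (j - j'))%N.
  rewrite addn_gt0 !subn_gt0; have [_|jge] := ltnP j' j; first exact: orbT.
  have jE : j' = j by apply/eqP; rewrite eqn_leq jj'.
  rewrite orbF /shear jE ltn_add2r; have := leq_ltn_trans (leq_add ii jj) ltij.
  by rewrite jE ltn_add2r.
have iVl : integ LP (fun w' => lpp (translate (V w') (shear i' j') j') (shear i j - shear i' j') (j - j')).
  exact: (integ_light_lpp iW W1 M1 n PK).
have : \int[LP]_w' lpp (translate (V w') (shear i' j') j') (shear i j - shear i' j') (j - j') + (Y i j + c) <=
   \int[LP]_w' lpp (translate (Xs w') (shear i' j') j') (shear i j - shear i' j') (j - j').
  rewrite -[X in _ + X](exp_cst LP) -expD//; last exact: integ_cst.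
  apply: exp_le; [by apply: integD => //; exact: integ_cst|exact: iXs_lpp|].
  move=> w'; apply: le_trans (lpp_last_ge
    (y := translate (V w') (shear i' j') j') pos _).
    by rewrite lerD2l /translate !subnKC//; exact: Xs_heavy.
  move=> a b aq bp; apply: Xs_ge.
    by apply: leq_trans (shear_mono im jn); rewrite -(subnKC smono) leq_add2l.
  by apply: leq_trans jn; rewrite -(subnKC jj') leq_add2l.
by rewrite HE; lra.
Qed.

Let all_anchored i j : (i <= m)%N -> (j <= n)%N -> anchored i j.
Proof.
elim/grid_ind: i / j => [|i IH|j IH|i j IH1 IH2] im jn.
- exists 0%N, 0%N; split => //; rewrite /H lpp00 div0n mulr0 addr0.
  rewrite /Phi /shear div0n muln0.
  by under eq_Rintegral do rewrite lpp00; rewrite exp_cst.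
- apply: (@anchored_step i.+1 0 i 0); rewrite ?addn0 ?leqnSn//; first exact: lppS0.
  by apply: IH => //; exact: ltnW.
- apply: (@anchored_step 0 j.+1 0 j); rewrite ?add0n ?leqnSn//; first exact: lpp0S.
  by apply: IH => //; exact: ltnW.
- have [le12|lt12] := leP (lpp Y i j.+1) (lpp Y i.+1 j).
    apply: (@anchored_step i.+1 j.+1 i.+1 j); rewrite ?addnS ?leqnSn//.
      by rewrite /H lppSS max_r.
    by apply: IH2 => //; exact: ltnW.
  apply: (@anchored_step i.+1 j.+1 i j.+1); rewrite ?addSn ?leqnSn//.
    by rewrite /H lppSS max_l// ltW.
  by apply: IH1 => //; exact: ltnW.
Qed.

(** The segment after the last anchor has no heavy vertex to pay for it, whence the final [- c]. *)
Lemma heavy_light_pointwise : H m n + c * (n %/ p0)%:R - c <= Phi m n.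
Proof.
have [i' [j' [ii jj H0 HP]]] := all_anchored (leqnn m) (leqnn n).
apply: le_trans (Phi_super ii jj).
have seg := @light_segment m n i' j' (introT andP (conj ii (leqnn m)))
  (introT andP (conj jj (leqnn n))).
have smono := shear_mono ii jj.
suff : \int[LP]_w' lpp (translate (V w') (shear i' j') j') (shear m n - shear i' j') (n - j') <=
   \int[LP]_w' lpp (translate (Xs w') (shear i' j') j') (shear m n - shear i' j') (n - j').
  by lra.
apply: exp_le; [exact: (integ_light_lpp iW W1 M1 n PK)|exact: iXs_lpp|].
move=> w'; apply: ler_lpp => a b aq bp; apply: Xs_ge.
  by rewrite -[leqRHS](subnKC smono) leq_add2l.
by rewrite -(subnKC jj) leq_add2l.
Qed.

Lemma integ_mixed_lpp : integ LP (fun w' => lpp (Xs w') (shear m n) n).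
Proof. exact: (iXs_lpp 0 0). Qed.

End pointwise.

Let Y w (i j : nat) : R := Num.max (W w i j - (K + c)) 0.

Let mY : measurable_fun setT (fun r : R => Num.max (r - (K + c)) 0).
Proof. by apply: measurable_maxr => //; exact: measurable_funB. Qed.

Lemma integ_heavy i j : integ P (fun w => Num.max (W w i j - (K + c)) 0).
Proof.
apply: (@integ_coord _ _ _ _ _ _ iW (fun r => Num.max (r - (K + c)) 0)) => //.
apply: (@integ_le _ _ _ _ _ (fun w => `|W w 0 0| + `|K + c|)).
- exact: (measurable_coord_comp iW _ _ mY).
- by apply: integD; [exact: integ_norm|exact: integ_cst].
- move=> w; rewrite ger0_norm ?le_max ?lexx ?orbT// ge_max addr_ge0// andbT.
  by rewrite (le_trans (ler_norm _))// ler_normB.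
Qed.

Lemma heavy_light :
  \int[P]_w lpp (fun i j => Num.max (W w i j - (K + c)) 0) m n +
    c * (n %/ p0)%:R - c <= \int[P]_w lpp (W w) (shear m n) n.
Proof.
(* Shearing is an injective relabelling of the cells, so the sheared heavy weights have the law of
   the original ones. *)
have shearE : \int[P]_w lpp (Y w) m n =
    \int[P]_w lpp (fun i j => Num.max (W w (shear i j) j - (K + c)) 0) m n.
  have iY := iid_map iW mY.
  pose phi (z : nat * nat) := (shear z.1 z.2, z.2).
  have phiI : injective phi.
    by move=> [i j] [i' j'] /= [] + jj; rewrite /shear /= jj => /addIn ->.
  have := same_law_Rintegral (iid_same_law iY (iid_reindex phiI iY)) (measurable_lpp m n).
  by [].
have iY' : integ P (fun w => lpp (fun i j => Num.max (W w (shear i j) j - (K + c)) 0) m n).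
  by apply: integ_lpp_coord => i j; exact: integ_heavy.
rewrite -/(Y _) [X in X + _ - _]shearE.
have uD : uniq D by exact: box_uniq.
have law := mixed_same_law iW uD PK.
have mlpp := @measurable_lpp R (shear m n) n.
have E1 : \int[P]_w lpp (W w) (shear m n) n = \int[P]_w lpp (restricted D (W w)) (shear m n) n.
  apply: eq_Rintegral => w _; apply: eq_lpp => i j iM jn _.
  by rewrite /restricted mem_box iM jn.
have i1 : integ P (fun w => lpp (restricted D (W w)) (shear m n) n).
  apply: integ_lpp_coord => i j; rewrite /restricted; case: ((i, j) \in D); last exact: integ_cst.
  exact: (@integ_coord _ _ _ _ _ _ iW id i j).
have i2 := same_law_integrable law mlpp i1.
rewrite E1 (same_law_Rintegral law mlpp) [leRHS]/Rintegral -integral12_prod_meas1; last exact: i2.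
rewrite /fubini_F /=.
have PhiE w : (\int[LP]_w' (lpp (mixed K D (W w) (W w')) (shear m n) n)%:E =
    (\int[LP]_w' lpp (mixed K D (W w) (W w')) (shear m n) n)%:E)%E.
  by rewrite /Rintegral fineK//; apply: integrable_fin_num => //; exact: integ_mixed_lpp.
have iPhi := integrable_fubini_F i2.
rewrite /fubini_F /= in iPhi.
under eq_integral do rewrite PhiE.
have iPhi' : integ P (fun w => \int[LP]_w' lpp (mixed K D (W w) (W w')) (shear m n) n).
  by rewrite /integ; under eq_fun do rewrite -PhiE.
rewrite -/(Rintegral P setT _) -addrA -[X in _ + X](exp_cst P) -expD//; last exact: integ_cst.
apply: exp_le => //; first by apply: integD => //; exact: integ_cst.
by move=> w; rewrite addrA; exact: heavy_light_pointwise.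
Qed.

End HeavyLightInduction.

(** * Continuity of the shape function at the boundary *)

Section ShapeContinuity.
Context {R : realType} d (T : measurableType d) (P : probability T R)
  (mu : set R -> \bar R) (X : T -> arrayT R).
Hypotheses (iX : iid_array P mu X) (X1 : integ P (fun w => X w 0 0))
  (X2 : integ P (fun w => X w 0 0 ^+ 2)) (Xmean : \int[P]_w X w 0 0 = 0).

Definition mean_lpp m n : R := \int[P]_w lpp (X w) m n.

Let a := mean_lpp.

Lemma mean_lpp_super m n p q : a m n + a p q <= a (m + p) (n + q).
Proof.
have E := @exp_translate _ _ _ _ _ _ iX (fun x => lpp x p q) m n (measurable_lpp p q).
rewrite /a /mean_lpp -E -expD; [|exact: (integ_lpp iX)|]; last first.
  by apply: (@integ_translate _ _ _ _ _ _ iX (fun x => lpp x p q)); [exact: measurable_lpp|exact: (integ_lpp iX)].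
apply: exp_le; last by move=> w; exact: lpp_super.
  apply: integD; first exact: (integ_lpp iX).
  by apply: (@integ_translate _ _ _ _ _ _ iX (fun x => lpp x p q)); [exact: measurable_lpp|exact: (integ_lpp iX)].
exact: (integ_lpp iX).
Qed.

Lemma mean_lpp_ge0 m n : 0 <= a m n.
Proof.
have ij i j : integ P (fun w => X w i j) by exact: (@integ_coord _ _ _ _ _ _ iX id).
have E i j : \int[P]_w X w i j = 0 by rewrite (@exp_coord _ _ _ _ _ _ iX id).
have is1 : integ P (fun w => \sum_(1 <= i < m.+1) X w i 0%N) by exact: integ_sum.
have is2 : integ P (fun w => \sum_(1 <= j < n.+1) X w m j) by exact: integ_sum.
apply: (@le_trans _ _ (\int[P]_w (\sum_(1 <= i < m.+1) X w i 0 + \sum_(1 <= j < n.+1) X w m j))).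
  rewrite expD// !exp_sum//.
  by rewrite !big1// ?addr0// => i _; rewrite E.
apply: exp_le; [exact: integD|exact: (integ_lpp iX)|].
by move=> w; exact: lpp_ge_corner.
Qed.

Lemma mean_lpp_le m n p q : (m <= p)%N -> (n <= q)%N -> a m n <= a p q.
Proof.
move=> mp nq; rewrite -(subnKC mp) -(subnKC nq).
by apply: le_trans (mean_lpp_super _ _ _ _); rewrite lerDl mean_lpp_ge0.
Qed.

Variable G : R -> R.
Hypothesis Glim : forall s eps, 0 <= s -> 0 < eps -> \forall n \near \oo,
  `|a (Num.truncn (n%:R * s)) n - G s * n%:R| <= eps * n%:R.

Let Glim_pos s eps : 0 <= s -> 0 < eps -> forall n0, exists2 n, (n0 < n)%N &
  `|a (Num.truncn (n%:R * s)) n - G s * n%:R| <= eps * n%:R.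
Proof.
move=> s0 e0 n0; have [n1 _ h] := Glim s0 e0.
exists (maxn n1 n0.+1); first by rewrite leq_max leqnn orbT.
by apply: h; rewrite /= leq_maxl.
Qed.

(** With [N] about [n * s' / s], which is at least [n], the rectangle of slope [s'] and length [n]
    fits into the one of slope [s] and length [N]. *)
Lemma shape_scale s s' : 0 < s -> s <= s' -> G s' <= s' / s * G s.
Proof.
move=> s0 ss'; set r := s' / s; apply/ler_addgt0Pr => eps eps0.
have r1 : 1 <= r by rewrite ler_pdivlMr ?mul1r.
pose e := eps / (2 + r).
have e0 : 0 < e by rewrite divr_gt0//; lra.
have -> : eps = (2 + r) * e by rewrite /e mulrC divfK//; lra.
have [n0 _ h] := Glim (ltW s0) e0.
have [n nn0 h'] := Glim_pos (le_trans (ltW s0) ss') e0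
  (maxn n0 (Num.truncn ((G s + e) / e)).+1).
move: nn0; rewrite gtn_max => /andP[nn0 nn1].
have {nn1} Gn : G s + e <= e * n%:R.
  rewrite mulrC -ler_pdivrMr//; apply: le_trans (ltW (truncnS_gt _)) _.
  by rewrite ler_nat ltnW.
have n0' : 0 < n%:R :> R by rewrite ltr0n; lia.
pose N := (Num.truncn (n%:R * r)).+1.
have Nge : n%:R * r <= N%:R by exact/ltW/truncnS_gt.
have Nle : N%:R <= n%:R * r + 1.
  by rewrite /N -natr1 lerD2r truncn_le mulr_ge0//; lra.
have nN : (n <= N)%N by rewrite -(ler_nat R); nra.
have {}h := h N (leq_trans (ltnW nn0) nN).
have : a (Num.truncn (n%:R * s')) n <= a (Num.truncn (N%:R * s)) N.
  apply: mean_lpp_le => //; apply: le_truncn.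
  by have -> : n%:R * s' = n%:R * r * s; [rewrite -mulrA divfK// gt_eqF|rewrite ler_wpM2r// ltW].
move: h h'; rewrite !ler_norml => /andP[h1 h2] /andP[h3 h4] h5.
have Gs : 0 <= G s + e.
  have := mean_lpp_ge0 (Num.truncn (N%:R * s)) N.
  have : 0 < N%:R :> R by rewrite ltr0n.
  nra.
have h6 : (G s + e) * N%:R <= (G s + e) * (n%:R * r + 1) by exact: ler_wpM2l.
rewrite -(ler_pM2r n0'); nra.
Qed.

Lemma shape_mono s s' : 0 <= s -> s <= s' -> G s <= G s'.
Proof.
move=> s0 ss'; apply/ler_addgt0Pr => e e0.
have e2 : 0 < e / 2 by rewrite divr_gt0.
have s'0 := le_trans s0 ss'.
have [n0 _ h] := Glim s0 e2.
have [n nn0 h'] := Glim_pos s'0 e2 n0.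
have n0' : 0 < n%:R :> R by rewrite ltr0n; lia.
have {}h := h n (ltnW nn0).
have : a (Num.truncn (n%:R * s)) n <= a (Num.truncn (n%:R * s')) n.
  by apply: mean_lpp_le => //; apply: le_truncn; rewrite ler_wpM2l.
move: h h'; rewrite !ler_norml => /andP[h1 h2] /andP[h3 h4] h5.
rewrite -(ler_pM2r n0'); lra.
Qed.

Let shape_ge0 s : 0 <= s -> 0 <= G s.
Proof.
move=> s0; apply/ler_addgt0Pr => e e0.
have [n nn0 h'] := Glim_pos s0 e0 0.
have n0' : 0 < n%:R :> R by rewrite ltr0n.
have := mean_lpp_ge0 (Num.truncn (n%:R * s)) n.
move: h'; rewrite !ler_norml => /andP[h1 h2] h3.
rewrite -(ler_pM2r n0') mul0r; lra.
Qed.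

(* If the limit [c] at the boundary were positive, then for weights with a
   small positive drift the light vertices alone gain about [c] per column on
   every path with slope bounded below, while the heavy ones gain [c] even in
   arbitrarily thin strips; the shear combines the two gains to [2 c]. *)
Lemma shape_thin eps : 0 < eps -> exists2 s, 0 < s & G s <= eps.
Proof.
move=> eps0; apply: contrapT => nex.
have Geps s : 0 < s -> eps < G s.
  by move=> s0; rewrite ltNge; apply/negP => le; apply: nex; exists s.
pose S := G @` [set s | 0 < s].
have S0 : S !=set0 by exists (G 1); exists 1 => //=.
have lbS : lbound S eps by move=> _ [s s0 <-]; exact/ltW/Geps.
have hS : has_inf S by split => //; exists eps.
pose c := inf S.
have c_ge : eps <= c by exact: lb_le_inf.
have c0 : 0 < c by exact: lt_le_trans c_ge.
have cG s : 0 < s -> c <= G s by move=> s0; apply: ge_inf => //; [exists eps|exists s].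
(* Heavy and light gains give at least [(2 * c - 4 * eta) * n], whereas the shape at [s1] allows at
   most [(c + 4 * eta) * n]. *)
pose eta := c / 16.
have eta0 : 0 < eta by rewrite divr_gt0.
have [s1 s10 Gs1] : exists2 s1, 0 < s1 <= 1 & G s1 < c + eta.
  have [_ [s s0 <-] Gs] := inf_adherent eta0 hS.
  exists (Num.min s 1); first by rewrite lt_min s0 ltr01 ge_min lexx orbT.
  apply: le_lt_trans Gs; apply: shape_mono; last by rewrite ge_min lexx.
  by rewrite le_min ltW//= ler01.
have {s10} /andP[s10 s11] := s10.
(* The drift makes the mean weight positive, so that it stays nonnegative when the weights are
   conditioned to be at most a large [K]. *)
pose W w : arrayT R := fun i j => X w i j + eta.
have mphi : measurable_fun setT (fun r : R => r + eta) by exact: measurable_funD.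
have iW := iid_map iX mphi.
rewrite -/W in iW.
have W1 : integ P (fun w => W w 0 0) by apply: integD => //; exact: integ_cst.
have Wmean : 0 < \int[P]_w W w 0 0.
  by rewrite /W expD//; [rewrite Xmean add0r exp_cst|exact: integ_cst].
have WE m n : \int[P]_w lpp (W w) m n = a m n + eta *+ (m + n).
  rewrite (_ : (fun w => lpp (W w) m n) = (fun w => lpp (X w) m n + eta *+ (m + n))).
    by rewrite expD ?exp_cst//; [exact: (integ_lpp iX)|exact: integ_cst].
  by apply/funext => w; rewrite /W lppDcst.
(* The slope [s1] is shared equally: one half bounds the slope [q0 / p0] of the shear, the other the
   slope [s3] of the heavy strip. *)
have s20 : 0 < s1 / 2 by rewrite divr_gt0.
have [p0 p0_gt0 hp0] := Glim_pos (ltW s20) (divr_gt0 eta0 (ltr0n R 2)) 0.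
pose q0 := Num.truncn (p0%:R * (s1 / 2)).
have p0R : 0 < p0%:R :> R by rewrite ltr0n.
have q0le : q0%:R <= p0%:R * (s1 / 2) by rewrite truncn_le mulr_ge0// ltW.
pose cb := (c - eta) * p0%:R.
have cb0 : 0 <= cb by rewrite mulr_ge0// /eta; lra.
have cbW : cb < \int[P]_w lpp (W w) q0 p0.
  rewrite WE; apply: ltr_wpDr; first by rewrite mulrn_wge0// ltW.
  have := cG _ s20; move: hp0; rewrite -/q0 ler_norml => /andP[h _] h'.
  rewrite /cb; nra.
have [K [K0 PK lb lc]] := truncation_level iW W1 Wmean cbW.
have Xmean0 : \int[P]_w X w 0 0 <= 0 by rewrite Xmean.
have K''0 : 0 <= K + cb by exact: addr_ge0.
have [s2 /andP[s2_gt0 _] thin] := thin_strip_truncated iX X1 X2 (Xmean0) K''0 eta0.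
pose s3 := Num.min s2 (s1 / 2).
have s30 : 0 < s3 by rewrite lt_min s2_gt0.
have [n1 _ h1] := Glim (ltW s10) eta0.
have [n nn h3] := Glim_pos (ltW s30) eta0 (maxn n1 (Num.truncn (2 * cb / eta)).+1).
move: nn; rewrite gtn_max => /andP[nn1 nn].
have {nn} cbn : 2 * cb <= eta * n%:R.
  rewrite [leRHS]mulrC -ler_pdivrMr//; apply: le_trans (ltW (truncnS_gt _)) _.
  by rewrite ler_nat ltnW.
have n_gt0 : 0 < n%:R :> R by rewrite ltr0n (leq_ltn_trans _ nn1).
have {}h1 := h1 n (ltnW nn1).
set m := Num.truncn (n%:R * s3) in h3.
have mle : m%:R <= n%:R * s3 by rewrite truncn_le mulr_ge0// ltW.
have HL := heavy_light iW W1 m n PK cb0 p0_gt0 lb lc.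
(* Weights capped at [K + cb] contribute at most [eta * n] in the thin strip, so nearly all of the
   passage time is heavy excess. *)
have am : a m n <= eta * n%:R +
    \int[P]_w lpp (fun i j => Num.max (W w i j - (K + cb)) 0) m n.
  have iV : integ P (fun w => lpp (fun i j => Num.min (X w i j) (K + cb)) m n).
    apply: integ_lpp_coord => i j.
    exact: (@integ_coord _ _ _ _ _ _ iX (fun r => Num.min r (K + cb)) i j
      (measurable_min_cst _) (integ_min_cst iX X1 _)).
  have iH : integ P (fun w => lpp (fun i j => Num.max (W w i j - (K + cb)) 0) m n).
    by apply: integ_lpp_coord => i j; exact: (integ_heavy iW W1).
  apply: (@le_trans _ _ (\int[P]_w lpp (fun i j => Num.min (X w i j) (K + cb)) m n +
    \int[P]_w lpp (fun i j => Num.max (W w i j - (K + cb)) 0) m n)); last first.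
    rewrite lerD2r; apply: thin; apply: (le_trans mle).
    by rewrite mulrC ler_wpM2r// /s3 ge_min lexx.
  rewrite -expD//; apply: exp_le; [exact: (integ_lpp iX)|exact: integD|].
  move=> w; apply: le_trans (lppD_le _ _ _ _); apply: ler_lpp => i j _ _.
  rewrite /W; case: (leP (X w i j) (K + cb)) => h.
    by rewrite lerDl le_max lexx orbT.
  by rewrite -lerBlDl le_max lerD2r lerDl ltW.
set M := shear q0 p0 m n in HL.
have divn_lt : n%:R < p0%:R * (n %/ p0)%:R + p0%:R :> R.
  by rewrite -natrM -natrD ltr_nat -mulnSr mulnC ltn_ceil.
have M_le : M%:R <= n%:R * s1.
  rewrite /M /shear natrD natrM.
  have : m%:R <= n%:R * (s1 / 2).
    by apply: le_trans mle _; rewrite ler_wpM2l// /s3 ge_min lexx orbT.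
  have : (n %/ p0)%:R * p0%:R <= n%:R :> R by rewrite -natrM ler_nat leq_divM.
  have : 0 <= (n %/ p0)%:R :> R by [].
  nra.
have aM : a M n <= a (Num.truncn (n%:R * s1)) n.
  by apply: mean_lpp_le => //; rewrite truncn_ge_nat// mulr_ge0// ltW.
move: HL; rewrite WE -[eta *+ _]mulr_natr natrD => HL.
have Mn : M%:R <= n%:R :> R by apply: le_trans M_le _; rewrite ler_piMr.
have := cG _ s30.
have gain : (c - eta) * n%:R - cb <= cb * (n %/ p0)%:R.
  rewrite /cb -mulrA; have : 0 <= c - eta by rewrite /eta; lra.
  nra.
move: h1 h3; rewrite !ler_norml => /andP[h11 h12] /andP[h31 h32] G3.
have e1 : eta * (M%:R + n%:R) <= eta * (n%:R + n%:R) by apply: ler_wpM2l; [exact: ltW|rewrite lerD2r].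
have e2 : G s1 * n%:R <= (c + eta) * n%:R by rewrite ler_wpM2r// ltW.
have e3 : c * n%:R <= G s3 * n%:R by rewrite ler_wpM2r.
have e4 : c = 16 * eta by rewrite /eta; lra.
have e5 : 0 < eta * n%:R by exact: mulr_gt0.
rewrite e4 in gain e2 e3; nra.
Qed.

End ShapeContinuity.

(** * Consequences of continuity, good windows, short columns *)

Section ShapeLimits.
Context {R : realType} d (T : measurableType d) (P : probability T R)
  (mu : set R -> \bar R) (X : T -> arrayT R).
Hypotheses (iX : iid_array P mu X) (X1 : integ P (fun w => X w 0 0))
  (X2 : integ P (fun w => X w 0 0 ^+ 2)) (Xmean : \int[P]_w X w 0 0 = 0).

Let a := mean_lpp P X.

Variable G : R -> R.
Hypothesis Glim : forall s eps, 0 <= s -> 0 < eps -> \forall n \near \oo,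
  `|a (Num.truncn (n%:R * s)) n - G s * n%:R| <= eps * n%:R.

Lemma shape_ge0 s : 0 <= s -> 0 <= G s.
Proof.
move=> s0; apply/ler_addgt0Pr => e e0.
have [n0 _ h] := Glim s0 e0.
have {h} := h n0.+1 (leqnSn _).
have := mean_lpp_ge0 iX X1 Xmean (Num.truncn (n0.+1%:R * s)) n0.+1.
rewrite -/a ler_norml => h3 /andP[h1 h2].
have n0' : 0 < n0.+1%:R :> R by rewrite ltr0n.
rewrite -(ler_pM2r n0') mul0r; lra.
Qed.

Lemma shape_cont s eps : 0 <= s -> 0 < eps -> exists2 eta, 0 < eta &
  forall t, 0 <= t -> `|t - s| <= eta -> `|G t - G s| <= eps.
Proof.
have mono := shape_mono iX X1 Xmean Glim.
move=> s0 e0; have [->|sn0] := eqVneq s 0.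
  have [eta eta0 Geta] := shape_thin iX X1 X2 Xmean Glim e0.
  exists eta => // t t0; rewrite subr0 ger0_norm// => te.
  have := mono _ _ t0 te; have := mono _ _ (lexx 0) t0.
  have := shape_ge0 (lexx 0) => h1 h2 h3.
  by rewrite ger0_norm; lra.
have {sn0} s_gt0 : 0 < s by rewrite lt_def sn0.
have scale := shape_scale iX X1 Xmean Glim.
have Gs := shape_ge0 s0.
have Gs1 : 0 < G s + 1 by lra.
(* The bound [s / 2] keeps [t] positive, so that scaling also applies with [t] as the smaller
   slope. *)
pose eta := Num.min (s / 2) (eps * s / (2 * (G s + 1))).
have eta_s : eta <= s / 2 by rewrite /eta ge_min lexx.
have eta_e : eta * (2 * (G s + 1)) <= eps * s.
  by rewrite -ler_pdivlMr ?mulr_gt0// /eta ge_min lexx orbT.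
have eta0 : 0 < eta by rewrite /eta lt_min !divr_gt0 ?mulr_gt0.
exists eta => // t t0; rewrite ler_distl => /andP[t1 t2].
have [ts|ts] := leP s t.
  have := mono _ _ s0 ts; have := scale _ _ s_gt0 ts => h1 h2.
  have {}h1 : s * G t <= t * G s by rewrite mulrC -ler_pdivlMr// mulrAC.
  rewrite ger0_norm ?subr_ge0//; rewrite -(ler_pM2l s_gt0); nra.
have tpos : 0 < t by lra.
have := mono _ _ t0 (ltW ts); have := scale _ _ tpos (ltW ts) => h1 h2.
have {}h1 : t * G s <= s * G t by rewrite mulrC -ler_pdivlMr// mulrAC.
rewrite ler0_norm ?subr_le0// opprB -(ler_pM2l tpos).
have : (s - t) * (2 * (G s + 1)) <= eps * s.
  by apply: le_trans eta_e; rewrite ler_wpM2r//; lra.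
nra.
Qed.

Lemma shape0 : G 0 = 0.
Proof.
apply/eqP; rewrite eq_le shape_ge0// andbT; apply/ler_addgt0Pr => e e0.
have [s s0 Gs] := shape_thin iX X1 X2 Xmean Glim e0.
rewrite add0r; apply: le_trans Gs.
by apply: (shape_mono iX X1 Xmean Glim) => //; exact: ltW.
Qed.

(** Monotonicity of the centered means sandwiches [m N] between the exact rays of slopes [s - eta]
    (cut at 0) and [s + eta]. The lower ray is taken at [N.-1], the actual number of steps in the
    job direction. *)
Lemma mean_lpp_lim (m : nat -> nat) s eps : 0 <= s -> 0 < eps ->
  (forall e, 0 < e -> \forall N \near \oo, `|(m N)%:R - s * N%:R| <= e * N%:R) ->
  \forall N \near \oo, `|a (m N) N.-1 - G s * N%:R| <= eps * N%:R.
Proof.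
move=> s0 e0 ms; have e4 : 0 < eps / 4 by rewrite divr_gt0.
have [eta eta0 Gc] := shape_cont s0 e4.
have s1 : 0 <= s + eta by lra.
pose v := Num.max (s - eta) 0.
have v0 : 0 <= v by rewrite le_max lexx orbT.
have vs : `|v - s| <= eta.
  by rewrite ler_distl /v le_max lexx ge_max; apply/andP; split; lra.
have Gv := Gc _ v0 vs.
have Gs1 : `|G (s + eta) - G s| <= eps / 4.
  by apply: Gc => //; rewrite addrC addKr ger0_norm// ltW.
have mono := mean_lpp_le iX X1 Xmean.
have [n1 _ h1] := Glim s1 e4.
have [n2 _ h2] := Glim v0 e4.
have Gs := shape_ge0 s0.
have [n3 _ h3] := ms _ (divr_gt0 eta0 (ltr0n R 2)).
exists (maxn n3 (maxn n1 (maxn n2.+1 (Num.truncn ((G s + eps) / (eps / 4))).+1))) => // N.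
rewrite /= !geq_max => /and4P[/h3{}h3 /h1{}h1 n2N GN].
have N0 : (0 < N)%N by exact: leq_ltn_trans n2N.
have {}h2 : `|a (Num.truncn (N.-1%:R * v)) N.-1 - G v * N.-1%:R| <= eps / 4 * N.-1%:R.
  by apply: h2; rewrite /= -ltnS prednK.
have {}GN : G s + eps <= eps / 4 * N%:R.
  rewrite [leRHS]mulrC -ler_pdivrMr//; apply: le_trans (ltW (truncnS_gt _)) _.
  by rewrite ler_nat.
have NE : N.-1%:R = N%:R - 1 :> R by rewrite -(prednK N0) -natr1 addrK.
have NR : 1 <= N%:R :> R by rewrite ler1n.
have up : (m N <= Num.truncn (N%:R * (s + eta)))%N.
  rewrite truncn_ge_nat ?mulr_ge0//; move: h3; rewrite ler_distl => /andP[_ h3].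
  by apply: le_trans h3 _; nra.
have lo : (Num.truncn (N.-1%:R * v) <= m N)%N.
  rewrite -(ler_nat R); apply: (@le_trans _ _ (N%:R * v)).
    by apply: le_trans (_ : N.-1%:R * v <= _); rewrite ?truncn_le ?mulr_ge0// ler_wpM2r// NE; lra.
  rewrite /v maxr_pMr// mulr0 ge_max ler0n andbT; move: h3; rewrite ler_distl => /andP[h3 _].
  by apply: le_trans h3; nra.
have {}up := mono _ _ _ _ up (leq_pred N).
have {}lo := mono _ _ _ _ lo (leqnn N.-1).
rewrite -/a in up lo.
move: h1 h2 Gv Gs1; rewrite !ler_distl => /andP[_ h1] /andP[h2 _] /andP[Gv _] /andP[_ Gs1].
apply/andP; split.
  have : (G s - eps / 4) * N.-1%:R <= G v * N.-1%:R by rewrite ler_wpM2r.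
  have E1 : G s * N.-1%:R = G s * N%:R - G s by rewrite NE mulrBr mulr1.
  have E2 : eps * N.-1%:R = eps * N%:R - eps by rewrite NE mulrBr mulr1.
  have : 0 <= eps * N%:R by rewrite mulr_ge0// ltW.
  lra.
have : G (s + eta) * N%:R <= (G s + eps / 4) * N%:R by rewrite ler_wpM2r.
have : 0 <= eps * N%:R by rewrite mulr_ge0// ltW.
lra.
Qed.

(** The shift acts on arrays and not on sample points, so the stationary probability of the maximal
    inequality is the distribution of [X]. *)
Lemma good_windows_iid (bad : nat -> set (arrayT R)) (alpha : R) u v :
  (forall n, measurable (bad n)) ->
  {ae P, forall w, \forall n \near \oo, ~ bad n (X w)} -> 0 < alpha ->
  {ae P, forall w, exists n0, forall L,
    ~ many_bad (bad_from bad n0) alpha L (translate (X w) u v)}.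
Proof.
move=> mbad hbad al0.
have [mX _] := iX.
pose Q := [the probability (arrayT R) R of distribution P (mfun_Sub (mem_set mX))].
have QE A : Q A = P (X @^-1` A) by [].
have Qstat A k : measurable A ->
    Q ((fun x : arrayT R => translate x k 0 : arrayT R) @^-1` A) = Q A.
  move=> mA; rewrite !QE.
  by have [_ _ /(_ A mA)] := iid_same_law (iid_translate k 0 iX) iX.
have hbadQ : {ae Q, forall x, \forall n \near \oo, ~ bad n x}.
  (* The null set in the hypothesis lives on the sample space; on arrays the limsup of the bad
     events takes its place. *)
  pose B := \bigcap_n bad_from bad n.
  have mB : measurable B by apply: bigcap_measurable => // n _; exact: measurable_bad_from.
  exists B; split => //.
    rewrite QE; have [N [mN PN hN]] := hbad.
    apply: (@subset_measure0 _ _ _ P _ N) => //.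
      by rewrite -[X in measurable X]setTI; have mX' := mX; exact: mX'.
    move=> w Bw; apply: hN => -[n0 _ h].
    by have [n /= n0n /h] := Bw n0 I; apply.
  move=> x h n0 _; apply: contrapT => nb; apply: h; exists n0 => // n n0n bn.
  by apply: nb; exists n.
have [N [mN QN hN]] := good_windows Qstat mbad hbadQ al0.
have [mtX _ PE] := iid_same_law (iid_translate u v iX) iX.
exists ((fun w => translate (X w) u v : arrayT R) @^-1` N); split.
- by rewrite -[X in measurable X]setTI; exact: mtX.
- by have := PE N mN; rewrite -[RHS]/(Q N) QN.
- by move=> w h; exact: hN.
Qed.

Lemma column_small (p q : nat -> nat) eta eps : 0 <= eta -> 0 < eps ->
  {ae P, forall w, \forall N \near \oo,
    \sum_(i <- iota (p N) (Num.truncn (eta * N%:R))) `|X w i (q N)| <=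
    (eta * \int[P]_w `|X w 0 0| + eps) * N%:R}.
Proof.
move=> eta0 e0.
pose s N := [seq (i, q N) | i <- iota (p N) (Num.truncn (eta * N%:R))].
have us N : uniq (s N).
  by rewrite map_inj_uniq ?iota_uniq// => i j [].
have szE N : size (s N) = Num.truncn (eta * N%:R) by rewrite size_map size_iota.
have ss N : (size (s N) <= (Num.truncn eta).+1 * N)%N.
  rewrite szE -(ler_nat R) natrM (le_trans (_ : _ <= eta * N%:R))//.
    by rewrite truncn_le mulr_ge0.
  by rewrite ler_wpM2r// ltW// truncnS_gt.
have X1' : integ P (fun w => `|X w 0 0|) by exact: integ_norm.
have X2' : integ P (fun w => `|X w 0 0| ^+ 2).
  by rewrite (_ : (fun w => _) = (fun w => X w 0 0 ^+ 2))//; apply/funext => w; rewrite real_normK// num_real.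
have := strong_law iX (@normr_measurable R setT) X1' X2' us ss e0.
apply: filterS => w; apply: filterS => N.
rewrite big_map szE ler_distl => /andP[_].
move=> /le_trans; apply; rewrite mulrDl lerD2r mulrAC ler_wpM2r//.
  by apply: Rintegral_ge0.
by rewrite truncn_le mulr_ge0.
Qed.

End ShapeLimits.

(** * Passage times from a moving corner *)

Section Pathwise.
Context {R : realType}.
Implicit Types x : nat -> nat -> R.

Lemma sum_iota_le (F : nat -> R) a p b q : (forall i, 0 <= F i) ->
  (a <= b)%N -> (b + q <= a + p)%N ->
  \sum_(i <- iota b q) F i <= \sum_(i <- iota a p) F i.
Proof.
move=> F0 ab bq.
have -> : (p = (b - a) + (q + (a + p - (b + q))))%N by lia.
rewrite iotaD subnKC// iotaD !big_cat/= addrCA lerDl.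
by rewrite addr_ge0// sumr_ge0.
Qed.

Lemma lpp_column_ge x a b p :
  - \sum_(i <- iota a.+1 p) `|x i b| <= lpp (translate x a b) p 0.
Proof.
rewrite lppn0 -sumrN -[in iota _ _](addn1 a) iotaDl big_map.
rewrite /index_iota subSS subn0; apply: ler_sum => i _.
by rewrite /translate addn0 lerNl (le_trans (ler_norm _))// normrN.
Qed.

Lemma lpp_upper x k k' m r N : (0 < N)%N -> (k' <= k)%N ->
  x k 1 + lpp (translate x k 1) m N.-1 <=
  lpp (translate x k' 0) ((k - k') + (m + r)) N +
  \sum_(i <- iota k'.+1 (k - k')) `|x i 0%N| +
  \sum_(i <- iota (k + m).+1 r) `|x i N|.
Proof.
move=> N0 kk.
have h1 := lpp_super (translate x k' 0) (k - k') 0 (m + r) N.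
have h2 := lpp_super (translate x k 0) m N r 0.
have h3 := lpp_super (translate x k 0) 0 1 m N.-1.
rewrite !translate_translate !addn0 !add0n subnKC// in h1 h2 h3.
rewrite add1n prednK// lpp0S lpp00 add0r /translate !addn0 addn1 -/(translate x k 1) in h3.
have c1 := lpp_column_ge x k' 0 (k - k').
have c2 := lpp_column_ge x (k + m) N r.
lra.
Qed.

(** The path climbs along job 1 to [(k + l, 1)], follows an optimal middle piece and climbs along
    job [n.+1]. The first sum starts at [k] in order to cover [x k 1] as well. *)
Lemma lpp_lower x k l m p r n : m = (l + (p + r))%N ->
  lpp (translate x (k + l) 1) p n - \sum_(i <- iota k l.+1) `|x i 1%N| -
  \sum_(i <- iota (k + l + p).+1 r) `|x i n.+1| <=
  x k 1 + lpp (translate x k 1) m n.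
Proof.
move=> ->.
have h1 := lpp_super (translate x k 1) l 0 (p + r) n.
have h2 := lpp_super (translate x (k + l) 1) p n r 0.
rewrite !translate_translate !addn0 !add0n add1n in h1 h2.
have c1 := lpp_column_ge x k 1 l.
have c2 := lpp_column_ge x (k + l + p) n.+1 r.
have c3 := ler_norm (- x k 1%N); rewrite normrN in c3.
rewrite [iota k l.+1]/= big_cons; lra.
Qed.

Lemma lpp_lower_corner x k m n :
  \sum_(j <- iota 2 n) x (k + m)%N j - \sum_(i <- iota k m.+1) `|x i 1%N| <=
  x k 1 + lpp (translate x k 1) m n.
Proof.
have h1 := lpp_super (translate x k 1) m 0 0 n.
rewrite !translate_translate !addn0 !add0n in h1.
have c1 := lpp_column_ge x k 1 m.
have c3 := ler_norm (- x k 1%N); rewrite normrN in c3.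
have E : \sum_(j <- iota 2 n) x (k + m)%N j = lpp (translate x (k + m) 1) 0 n.
  rewrite lpp0n /index_iota subSS subn0 -[2%N]/(1 + 1)%N iotaDl big_map.
  by apply: eq_bigr => i _; rewrite /translate addn0.
rewrite E [iota k m.+1]/= big_cons; lra.
Qed.

End Pathwise.

Section MovingCorner.
Context {R : realType} d (T : measurableType d) (P : probability T R)
  (mu : set R -> \bar R) (X : T -> arrayT R).
Hypotheses (iX : iid_array P mu X) (X1 : integ P (fun w => X w 0 0))
  (X2 : integ P (fun w => X w 0 0 ^+ 2)) (Xmean : \int[P]_w X w 0 0 = 0).
Variable G : R -> R.
Hypothesis Glim : forall s eps, 0 <= s -> 0 < eps -> \forall n \near \oo,
  `|mean_lpp P X (Num.truncn (n%:R * s)) n - G s * n%:R| <= eps * n%:R.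
Hypothesis Gas : forall s eps, 0 <= s -> 0 < eps ->
  {ae P, forall w, \forall n \near \oo,
    `|lpp (X w) (Num.truncn (n%:R * s)) n - G s * n%:R| <= eps * n%:R}.
Variables (k m : nat -> nat) (C : nat) (s : R).
Hypotheses (kC : \forall N \near \oo, (k N <= C * N)%N) (s0 : 0 <= s)
  (ms : forall e, 0 < e -> \forall N \near \oo, `|(m N)%:R - s * N%:R| <= e * N%:R).

Let b := \int[P]_w `|X w 0 0|.

Let b0 : 0 <= b. Proof. exact: Rintegral_ge0. Qed.

Let window (eta : R) N := Num.truncn (eta * N%:R).

(* The rate of convergence from a given corner is not uniform in the corner, but
   by the maximal inequality every window of length [eta * N] contains a corner
   from which the passage times are already close to the shape. *)
Lemma good_start v e eta : 0 <= v -> 0 < e -> 0 < eta <= 1 ->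
  {ae P, forall w, exists n0, forall x0 N a : nat, (x0 <= 1)%N ->
    (a + window eta N <= C.+1 * N)%N -> 2 <= eta * N%:R ->
    exists2 k', (a <= k' < a + window eta N)%N & forall n, (n0 <= n)%N ->
      `|lpp (translate (X w) k' x0) (Num.truncn (n%:R * v)) n - G v * n%:R| <= e * n%:R}.
Proof.
move=> v0 e0 /andP[eta0 eta1].
pose bad n : set (arrayT R) := [set x |
  (e * n%:R < `|lpp x (Num.truncn (n%:R * v)) n - G v * n%:R|)%R].
have mbad n : measurable (bad n).
  have mf : measurable_fun setT (fun x : arrayT R =>
      `|lpp x (Num.truncn (n%:R * v)) n - G v * n%:R|).
    apply: measurableT_comp => //; apply: measurable_funB => //.
    exact: measurable_lpp.
  have := mf measurableT `]e * n%:R, +oo[%classic (measurable_itv _).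
  by rewrite setTI; congr measurable; apply/seteqP; split => x /=; rewrite in_itv/= andbT.
have hbad : {ae P, forall w, \forall n \near \oo, ~ bad n (X w)}.
  apply: filterS (Gas v0 e0) => w; apply: filterS => n.
  by rewrite leNgt => /negP.
(* Among the first [C.+1 * N] corners, density [alpha] means [eta * N / 4] of them, fewer than a
   window contains once [eta * N >= 2]. *)
pose alpha := eta / (4 * C.+1%:R).
have C0 : 0 < C.+1%:R :> R by rewrite ltr0n.
have al0 : 0 < alpha by rewrite divr_gt0// mulr_gt0.
have hw x0 := good_windows_iid iX 0 x0 mbad hbad al0.
apply: filterS2 (hw 0%N) (hw 1%N) => w [n0 h0] [n1 h1].
exists (maxn n0 n1) => x0 N a x01 aN etaN.
have N0 : (0 < N)%N.
  by rewrite lt0n; apply/negP => /eqP N0; move: etaN; rewrite N0 mulr0; lra.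
have N'0 : (0 < C.+1 * N)%N by rewrite muln_gt0.
have alN : alpha * (C.+1 * N)%:R < (window eta N)%:R.
  have := truncnS_gt (eta * N%:R); rewrite -/(window eta N) -natr1 natrM.
  have -> : alpha * (C.+1%:R * N%:R) = eta * N%:R / 4.
    by rewrite /alpha; field; rewrite gt_eqF.
  lra.
have [nn nle hh] : exists2 nn, (nn <= maxn n0 n1)%N &
    forall L, ~ many_bad (bad_from bad nn) alpha L (translate (X w) 0 x0).
  case: x0 x01 => [|[|//]] _; [exists n0|exists n1] => //;
  by rewrite ?leq_maxl ?leq_maxr.
have [k' [ak ka good]] := window_has_good al0 hh aN N'0 alN.
exists k'; first by rewrite ak ka.
move=> n n0n; have := good n (leq_trans nle n0n).
by rewrite /bad translate_translate add0n addn0 /= => /negP; rewrite -leNgt.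
Qed.

(** An optimal path from the moving corner, prolonged at both ends, becomes a path from a good
    corner at most [eta * N] below, whose passage time is under control. *)
Lemma corner_upper eps : 0 < eps -> {ae P, forall w, \forall N \near \oo,
  X w (k N) 1%N + lpp (translate (X w) (k N) 1) (m N) N.-1 <= (G s + eps) * N%:R}.
Proof.
move=> eps0; pose e := eps / 5.
have e0 : 0 < e by rewrite divr_gt0.
have [eta1 eta10 Gc] := shape_cont iX X1 X2 Xmean Glim s0 e0.
have b1 : 0 < b + 1 by rewrite ltr_wpDl.
pose eta : R := Num.min 1 (Num.min (eta1 / 2) (e / (4 * (b + 1)))).
have eta0 : 0 < eta by rewrite /eta !lt_min ltr01 !divr_gt0 ?mulr_gt0.
have eta_1 : eta <= 1 by rewrite /eta ge_min lexx.
have eta_c : eta <= eta1 / 2 by rewrite /eta !ge_min lexx orbT.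
have eta_b : 4 * eta * b <= e.
  have : eta <= e / (4 * (b + 1)) by rewrite /eta !ge_min lexx !orbT.
  rewrite ler_pdivlMr ?mulr_gt0//; have := b0; nra.
(* One [eta] makes room for [k N - k'], the other for the deviation of [m N] from [s * N]; the
   surplus at the upper end is then at most [3 * eta * N]. *)
clearbody eta; pose v := s + 2 * eta.
have s0' := s0; have v0 : 0 <= v by rewrite /v; lra.
have Gv : G v <= G s + e.
  have : `|v - s| <= eta1 by rewrite /v addrC addKr ger0_norm; lra.
  by move=> /(Gc _ v0); rewrite ler_distl => /andP[].
have H1 := good_start v0 e0 (ltac:(by rewrite eta0) : 0 < eta <= 1).
have H2 := column_small iX X1 X2 (fun N => (k N - window eta N).+1) (fun=> 0%N) (ltW eta0) e0.
have eta30 : 0 <= 3 * eta by lra.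
have H3 := column_small iX X1 X2 (fun N => (k N + m N).+1) id eta30 e0.
apply: filterS2 (filterI (Gas v0 e0) H1) (filterI H2 H3) => w [h0 [n0 h1]] [h2 h3].
have m3 := ms eta0; have kC' := kC.
near=> N.
have kCN : (k N <= C * N)%N by near: N.
have N0 : (0 < N)%N by near: N; exact: nbhs_infty_gt.
have nN : (n0 <= N)%N by near: N; exact: nbhs_infty_ge.
have etaN : 2 <= eta * N%:R.
  rewrite mulrC -ler_pdivrMr//; near: N; exact: nbhs_infty_ger.
have h0N : `|lpp (X w) (Num.truncn (N%:R * v)) N - G v * N%:R| <= e * N%:R by near: N.
have h2N : \sum_(i <- iota (k N - window eta N).+1 (window eta N)) `|X w i 0%N| <=
  (eta * b + e) * N%:R by near: N; exact: h2.
have h3N : \sum_(i <- iota (k N + m N).+1 (Num.truncn (3 * eta * N%:R))) `|X w i N| <=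
  (3 * eta * b + e) * N%:R by near: N; exact: h3.
have mN : `|(m N)%:R - s * N%:R| <= eta * N%:R by near: N; exact: m3.
have wN : (window eta N)%:R <= eta * N%:R by rewrite truncn_le mulr_ge0// ltW.
have [k' /andP[k'k kk'] good] : exists2 k', (k' <= k N <= k' + window eta N)%N &
    `|lpp (translate (X w) k' 0) (Num.truncn (N%:R * v)) N - G v * N%:R| <= e * N%:R.
  (* If no full window fits below [k N], the origin itself is the good corner, by the shape
     limit. *)
  have [kw|wk] := leqP (k N) (window eta N); first by exists 0%N => //; rewrite kw.
  have aw : (k N - window eta N + window eta N <= C.+1 * N)%N.
    by rewrite subnK ?(ltnW wk)// (leq_trans kCN)// leq_mul2r leqnSn orbT.
  have [k' /andP[ak ka] good] := h1 0%N N _ isT aw etaN.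
  exists k'; last exact: good.
  by move: ka; rewrite subnK 1?(ltnW wk)// => /ltnW -> /=; rewrite addnC -leq_subLR.
set tv := Num.truncn (N%:R * v) in good.
have tvle : tv%:R <= N%:R * v by rewrite truncn_le mulr_ge0.
move: mN; rewrite ler_distl => /andP[mlo mup].
have kk'' : (k N - k')%:R <= eta * N%:R :> R.
  by apply: le_trans wN; rewrite ler_nat leq_subLR.
have km : ((k N - k') + m N <= tv)%N.
  by rewrite truncn_ge_nat ?mulr_ge0// natrD /v; lra.
pose r := (tv - ((k N - k') + m N))%N.
have tvE : ((k N - k') + (m N + r) = tv)%N by rewrite addnA /r subnKC.
have rle : (r <= Num.truncn (3 * eta * N%:R))%N.
  rewrite truncn_ge_nat; last exact: mulr_ge0.
  rewrite /r natrB// natrD.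
  have : 0 <= (k N - k')%:R :> R by [].
  rewrite /v in tvle; lra.
have := lpp_upper (X w) (m N) r N0 k'k.
rewrite tvE; move: good; rewrite ler_distl => /andP[_ good].
have c1 : \sum_(i <- iota k'.+1 (k N - k')) `|X w i 0%N| <= (eta * b + e) * N%:R.
  apply: le_trans h2N; apply: sum_iota_le => //.
    by rewrite ltnS leq_subLR addnC.
  by rewrite !addSn ltnS subnKC// addnC -leq_subLR.
have c2 : \sum_(i <- iota (k N + m N).+1 r) `|X w i N| <= (3 * eta * b + e) * N%:R.
  by apply: le_trans h3N; apply: sum_iota_le => //; rewrite leq_add2l.
have e1 : 4 * eta * b * N%:R <= e * N%:R by rewrite ler_wpM2r.
have e2 : G v * N%:R <= (G s + e) * N%:R by rewrite ler_wpM2r.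
have e3 : eps * N%:R = 5 * (e * N%:R) by rewrite /e; field.
lra.
Unshelve. all: by end_near.
Qed.

(** From the moving corner one climbs to a good corner above it, follows an optimal path of slightly
    smaller slope and climbs the rest; a positive [s] leaves room for the smaller slope. *)
Let corner_lower_pos eps : 0 < s -> 0 < eps -> {ae P, forall w, \forall N \near \oo,
  (G s - eps) * N%:R <= X w (k N) 1%N + lpp (translate (X w) (k N) 1) (m N) N.-1}.
Proof.
move=> s_gt0 eps0; pose e := eps / 6.
have e0 : 0 < e by rewrite divr_gt0.
have [eta1 eta10 Gc] := shape_cont iX X1 X2 Xmean Glim s0 e0.
have b1 : 0 < b + 1 by rewrite ltr_wpDl.
pose eta : R := Num.min (Num.min 1 (s / 4)) (Num.min (eta1 / 2) (e / (5 * (b + 1)))).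
have eta0 : 0 < eta by rewrite /eta !lt_min ltr01 !divr_gt0 ?mulr_gt0.
have eta_1 : eta <= 1 by rewrite /eta !ge_min lexx.
have eta_s : eta <= s / 4 by rewrite /eta !ge_min lexx orbT.
have eta_c : eta <= eta1 / 2 by rewrite /eta !ge_min lexx !orbT.
have eta_b : 5 * eta * b <= e.
  have : eta <= e / (5 * (b + 1)) by rewrite /eta !ge_min lexx !orbT.
  rewrite ler_pdivlMr ?mulr_gt0//; have := b0; nra.
(* The remaining climb is about [3 * eta * N] at most; a fourth [eta * N] absorbs rounding and the
   use of [N.-1]. *)
clearbody eta; pose v := s - 2 * eta.
have v0 : 0 <= v by rewrite /v; lra.
have Gv : G s - e <= G v.
  have : `|v - s| <= eta1 by rewrite /v addrAC subrr add0r normrN ger0_norm; lra.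
  by move=> /(Gc _ v0); rewrite ler_distl => /andP[].
have H1 := good_start v0 e0 (ltac:(by rewrite eta0) : 0 < eta <= 1).
have H2 := column_small iX X1 X2 k (fun=> 1%N) (ltW eta0) e0.
have eta40 : 0 <= 4 * eta by lra.
have H3 := column_small iX X1 X2 (fun N => (k N + m N - window (4 * eta) N).+1) id eta40 e0.
apply: filterS3 H1 H2 H3 => w [n0 h1] h2 h3.
have m3 := ms eta0; have kC' := kC.
near=> N.
have kCN : (k N <= C * N)%N by near: N.
have N0 : (0 < N)%N by near: N; exact: nbhs_infty_gt.
have n0N : (n0 <= N.-1)%N.
  by rewrite -ltnS prednK//; near: N; exact: nbhs_infty_gt.
have etaN : 2 <= eta * N%:R.
  rewrite mulrC -ler_pdivrMr//; near: N; exact: nbhs_infty_ger.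
have vN : v + 1 <= eta * N%:R.
  rewrite [leRHS]mulrC -ler_pdivrMr//; near: N; exact: nbhs_infty_ger.
have GN : G s <= e * N%:R.
  rewrite mulrC -ler_pdivrMr//; near: N; exact: nbhs_infty_ger.
have h2N : \sum_(i <- iota (k N) (window eta N)) `|X w i 1%N| <=
  (eta * b + e) * N%:R by near: N; exact: h2.
have h3N : \sum_(i <- iota (k N + m N - window (4 * eta) N).+1 (window (4 * eta) N))
  `|X w i N| <= (4 * eta * b + e) * N%:R by near: N; exact: h3.
have mN : `|(m N)%:R - s * N%:R| <= eta * N%:R by near: N; exact: m3.
have wN : (window eta N)%:R <= eta * N%:R by rewrite truncn_le mulr_ge0// ltW.
have wle : (window eta N <= N)%N.
  by rewrite -(ler_nat R) (le_trans wN)// ler_piMl.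
have aw : (k N + window eta N <= C.+1 * N)%N.
  by rewrite mulSn addnC leq_add.
have [k' /andP[kk' k'k] good] := h1 1%N N _ isT aw etaN.
have {}good := good _ n0N.
set tv := Num.truncn (N.-1%:R * v) in good.
have NE : N.-1%:R = N%:R - 1 :> R by rewrite -(prednK N0) -natr1 addrK.
have NvE : N.-1%:R * v = N%:R * v - v by rewrite NE mulrBl mul1r.
have tvle : tv%:R <= N.-1%:R * v by rewrite truncn_le mulr_ge0.
have tvge : N.-1%:R * v < tv%:R + 1 by rewrite natr1 truncnS_gt.
have NvE' : N%:R * v = s * N%:R - 2 * (eta * N%:R) by rewrite /v; ring.
move: mN; rewrite ler_distl => /andP[mlo mup].
pose l := (k' - k N)%N.
have lw : (l < window eta N)%N by rewrite /l ltn_subLR.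
have lN : l%:R <= eta * N%:R :> R by apply: le_trans wN; rewrite ler_nat ltnW.
have ltm : (l + tv <= m N)%N.
  by rewrite -(ler_nat R) natrD; lra.
pose r := (m N - (l + tv))%N.
have mE : (m N = l + (tv + r))%N by rewrite addnA /r subnKC.
have rle : (r <= window (4 * eta) N)%N.
  rewrite truncn_ge_nat; last exact: mulr_ge0.
  rewrite /r natrB// natrD.
  have : 0 <= l%:R :> R by [].
  lra.
have := lpp_lower (X w) (k N) N.-1 mE.
rewrite prednK// /l subnKC// -/l.
move: good; rewrite ler_distl => /andP[good _].
have c1 : \sum_(i <- iota (k N) l.+1) `|X w i 1%N| <= (eta * b + e) * N%:R.
  by apply: le_trans h2N; apply: sum_iota_le => //; rewrite leq_add2l.
have c2 : \sum_(i <- iota (k' + tv).+1 r) `|X w i N| <= (4 * eta * b + e) * N%:R.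
  have E : (k' + tv + r = k N + m N)%N by rewrite mE /l !addnA subnKC.
  apply: le_trans h3N; apply: sum_iota_le => //.
    by rewrite ltnS leq_subLR -E [leqRHS]addnC leq_add2l.
  by rewrite !addSn ltnS E [leqRHS]addnC -leq_subLR.
have e1 : 5 * eta * b * N%:R <= e * N%:R by rewrite ler_wpM2r.
have e2 : (G s - e) * N.-1%:R <= G v * N.-1%:R by rewrite ler_wpM2r.
have e3 : eps * N%:R = 6 * (e * N%:R) by rewrite /e; field.
have e4 : (G s - e) * N.-1%:R = G s * N%:R - G s - e * N%:R + e by rewrite NE; ring.
have e5 : e * N.-1%:R = e * N%:R - e by rewrite NE; ring.
lra.
Unshelve. all: by end_near.
Qed.

(** No smaller slope is available, but [G 0 = 0]: it suffices that one path, a short climb followed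
    by a row, is not very negative, which the strong law gives. *)
Let corner_lower0 eps : s = 0 -> 0 < eps -> {ae P, forall w, \forall N \near \oo,
  (G s - eps) * N%:R <= X w (k N) 1%N + lpp (translate (X w) (k N) 1) (m N) N.-1}.
Proof.
move=> sE eps0; pose e := eps / 4.
have e0 : 0 < e by rewrite divr_gt0.
have G0 : G s = 0 by rewrite sE (shape0 iX X1 X2 Xmean Glim).
have b1 : 0 < b + 1 by rewrite ltr_wpDl.
pose eta : R := e / (2 * (b + 1)).
have eta0 : 0 < eta by rewrite /eta divr_gt0 ?mulr_gt0.
have eta_b : 2 * eta * b <= e.
  have : eta <= e / (2 * (b + 1)) by [].
  rewrite ler_pdivlMr ?mulr_gt0//; have := b0; nra.
clearbody eta.
have eta20 : 0 <= 2 * eta by lra.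
have H2 := column_small iX X1 X2 k (fun=> 1%N) eta20 e0.
pose c N := [seq ((k N + m N)%N, j) | j <- iota 2 N.-1].
have uc N : uniq (c N) by rewrite map_inj_uniq ?iota_uniq// => i j [].
have sc N : (size (c N) <= 1 * N)%N by rewrite size_map size_iota mul1n leq_pred.
have H3 := strong_law iX (@measurable_id _ _ setT) X1 X2 uc sc e0.
apply: filterS2 H2 H3 => w h2 h3.
have m3 := ms eta0.
near=> N.
have etaN : 1 <= eta * N%:R.
  rewrite mulrC -ler_pdivrMr//; near: N; exact: nbhs_infty_ger.
have h2N : \sum_(i <- iota (k N) (window (2 * eta) N)) `|X w i 1%N| <=
  (2 * eta * b + e) * N%:R by near: N; exact: h2.
have h3N : `|\sum_(z <- c N) X w z.1 z.2 - (size (c N))%:R * \int[P]_w0 X w0 0 0| <=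
  e * N%:R by near: N; exact: h3.
have mN : `|(m N)%:R - s * N%:R| <= eta * N%:R by near: N; exact: m3.
rewrite sE mul0r subr0 ger0_norm// in mN.
have mw : ((m N).+1 <= window (2 * eta) N)%N.
  by rewrite truncn_ge_nat; [rewrite -natr1; lra|exact: mulr_ge0].
have := lpp_lower_corner (X w) (k N) (m N) N.-1.
move: h3N; rewrite Xmean mulr0 subr0 big_map ler_norml => /andP[/= h3N _].
have c1 : \sum_(i <- iota (k N) (m N).+1) `|X w i 1%N| <= (2 * eta * b + e) * N%:R.
  by apply: le_trans h2N; apply: sum_iota_le => //; rewrite leq_add2l.
have e1 : 2 * eta * b * N%:R <= e * N%:R by rewrite ler_wpM2r.
have e3 : eps * N%:R = 4 * (e * N%:R) by rewrite /e; field.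
have e4 : 0 <= e * N%:R by rewrite mulr_ge0// ltW.
rewrite G0 sub0r mulNr /=; lra.
Unshelve. all: by end_near.
Qed.

Lemma corner_lim eps : 0 < eps -> {ae P, forall w, \forall N \near \oo,
  `|X w (k N) 1%N + lpp (translate (X w) (k N) 1) (m N) N.-1 - G s * N%:R| <= eps * N%:R}.
Proof.
move=> eps0.
have low : {ae P, forall w, \forall N \near \oo,
    (G s - eps) * N%:R <= X w (k N) 1%N + lpp (translate (X w) (k N) 1) (m N) N.-1}.
  have [sE|sn0] := eqVneq s 0; first exact: corner_lower0.
  by apply: corner_lower_pos => //; rewrite lt_def sn0.
apply: filterS2 (corner_upper eps0) low => w; apply: filterS2 => N h1 h2.
by rewrite ler_distl -mulrBl -mulrDl h1 h2.
Qed.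

End MovingCorner.

(** * The makespan *)

Lemma cvg_ratioP {R : realType} (f : nat -> R) (l : R) :
  (N%:R^-1 * f N @[N --> \oo] --> l) <->
  (forall eps, 0 < eps -> \forall N \near \oo, `|f N - l * N%:R| <= eps * N%:R).
Proof.
have E N : (0 < N)%N -> `|f N - l * N%:R| = `|l - N%:R^-1 * f N| * N%:R.
  move=> N0; have N0' : N%:R != 0 :> R by rewrite pnatr_eq0 -lt0n.
  have -> : f N - l * N%:R = - ((l - N%:R^-1 * f N) * N%:R) by field.
  by rewrite normrN normrM (ger0_norm (ler0n R N)).
split=> [/cvgrPdist_le h eps /h h'|h].
- near=> N; have N0 : (0 < N)%N by near: N; exact: nbhs_infty_gt.
  by rewrite E// ler_wpM2r//; near: N.
- apply/cvgrPdist_le => eps /h h'.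
  near=> N; have N0 : (0 < N)%N by near: N; exact: nbhs_infty_gt.
  by rewrite -(@ler_pM2r _ N%:R) ?ltr0n// -E//; near: N.
Unshelve. all: by end_near.
Qed.

(** Restricting to the countably many tolerances [1 / j.+1] allows the null sets to be united. *)
Lemma ae_cvg_ratio {R : realType} d (T : measurableType d) (P : probability T R)
    (f : nat -> T -> R) (l : R) :
  (forall eps, 0 < eps -> {ae P, forall w, \forall N \near \oo,
    `|f N w - l * N%:R| <= eps * N%:R}) ->
  {ae P, forall w, N%:R^-1 * f N w @[N --> \oo] --> l}.
Proof.
move=> h.
have : {ae P, forall w, forall j, \forall N \near \oo,
    `|f N w - l * N%:R| <= j.+1%:R^-1 * N%:R}.
  by apply/ae_foralln => j; apply: h; rewrite invr_gt0.
apply: filterS => w hw; apply/cvg_ratioP => eps eps0.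
have [j je] : exists j, j.+1%:R^-1 <= eps.
  exists (Num.truncn eps^-1); rewrite -[leRHS]invrK lef_pV2 ?posrE ?invr_gt0//.
  exact/ltW/truncnS_gt.
by apply: filterS (hw j) => N /le_trans; apply; rewrite ler_wpM2r.
Qed.

Section Asymptotics.
Context {R : realType} (M nu : nat -> nat) (kappa tau : R).
Hypotheses (nu_range : forall N, (1 <= N)%N -> (1 <= nu N <= M N)%N)
  (kappa_ge0 : 0 <= kappa) (tau_range : 0 <= tau <= 1)
  (M_asymp : (fun N => (M N)%:R : R^o) =
     (fun N => kappa * N%:R : R^o) +o_\oo (fun N => N%:R : R^o))
  (nu_asymp : (fun N => (nu N)%:R : R^o) =
     (fun N => tau * (M N)%:R : R^o) +o_\oo (fun N => (M N)%:R : R^o)).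

Lemma machines_lim e : 0 < e ->
  \forall N \near \oo, `|(M N)%:R - kappa * N%:R| <= e * N%:R.
Proof.
move=> e0; have /eqaddoP /(_ e e0) := M_asymp.
by apply: filterS => N; rewrite [X in _ <= _ * X]ger0_norm.
Qed.

Lemma fiducial_lim e : 0 < e ->
  \forall N \near \oo, `|(nu N)%:R - kappa * tau * N%:R| <= e * N%:R.
Proof.
move=> e0; have k0 := kappa_ge0; have k1 : 0 < kappa + 2 by lra.
(* As [M <= (kappa + 1) * N] when [e1 <= 1], the error of [nu] costs [(kappa + 1) * e1]; the error
   of [M] costs one more [e1]. *)
pose e1 : R := Num.min 1 (e / (kappa + 2)).
have e10 : 0 < e1 by rewrite /e1 lt_min ltr01 divr_gt0.
have e11 : e1 <= 1 by rewrite /e1 ge_min lexx.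
have e1e : e1 * (kappa + 2) <= e by rewrite -ler_pdivlMr// /e1 ge_min lexx orbT.
clearbody e1.
have /eqaddoP /(_ e1 e10) := nu_asymp.
apply: filterS2 (machines_lim e10) => N; rewrite [X in _ -> _ <= _ * X -> _]ger0_norm//.
have [t0 t1] := andP tau_range.
move=> h1 h2.
have E : (nu N)%:R - kappa * tau * N%:R =
  ((nu N)%:R - tau * (M N)%:R) + tau * ((M N)%:R - kappa * N%:R) :> R by ring.
rewrite E; apply: le_trans (ler_normD _ _) _; rewrite normrM (ger0_norm t0).
have h3 : tau * `|(M N)%:R - kappa * N%:R| <= e1 * N%:R.
  by apply: le_trans h1; rewrite ler_piMl.
have MN : (M N)%:R <= (kappa + 1) * N%:R.
  move: h1; rewrite ler_distl => /andP[_ h1]; apply: le_trans h1 _.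
  by rewrite -mulrDl ler_wpM2r// lerD2l.
have h4 : e1 * (M N)%:R <= e1 * ((kappa + 1) * N%:R) by rewrite ler_wpM2l// ltW.
have h5 : e1 * (kappa + 2) * N%:R <= e * N%:R by rewrite ler_wpM2r.
apply: le_trans (lerD h2 h3) _; lra.
Qed.

Lemma above_lim e : 0 < e ->
  \forall N \near \oo, `|(M N - nu N)%:R - kappa * (1 - tau) * N%:R| <= e * N%:R.
Proof.
move=> e0; have e20 : 0 < e / 2 by rewrite divr_gt0.
apply: filterS3 (nbhs_infty_gt 0) (machines_lim e20) (fiducial_lim e20) => N N0.
have /andP[_ nM] := nu_range N0; rewrite natrB//.
rewrite !ler_distl => /andP[h1 h2] /andP[h3 h4]; apply/andP; split; lra.
Qed.

Lemma below_lim e : 0 < e ->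
  \forall N \near \oo, `|(nu N).-1%:R - kappa * tau * N%:R| <= e * N%:R.
Proof.
move=> e0; have e20 : 0 < e / 2 by rewrite divr_gt0.
apply: filterS3 (nbhs_infty_gt 0) (nbhs_infty_ger (e / 2)^-1) (fiducial_lim e20) => N N0 eN.
have /andP[n0 _] := nu_range N0.
have -> : (nu N).-1%:R = (nu N)%:R - 1 :> R by rewrite -[in RHS](prednK n0) -natr1 addrK.
have eN' : 1 <= e / 2 * N%:R by rewrite mulrC -ler_pdivrMr ?div1r.
rewrite !ler_distl => /andP[h1 h2]; apply/andP; split; lra.
Qed.

Lemma fiducial_bound : exists C, \forall N \near \oo, (nu N <= C * N)%N.
Proof.
exists (Num.truncn (kappa + 1)).+1.
apply: filterS2 (nbhs_infty_gt 0) (machines_lim ltr01) => N N0.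
have /andP[_ nM] := nu_range N0.
rewrite ler_distl => /andP[_ h]; apply: leq_trans nM _.
rewrite -(ler_nat R) (le_trans h)// -mulrDl natrM ler_wpM2r//.
exact/ltW/truncnS_gt.
Qed.

End Asymptotics.

Section Flowshop.
Context {R : realType} d (Omega : measurableType d) (P : probability Omega R)
  (X : nat -> nat -> {RV P >-> R}) (F : R -> \bar R) (lambda : R).
Hypotheses (X_indep : mutually_independent X)
  (X_ident : forall (mu i : nat) (r : R), cdf (X mu i) r = F r)
  (X_mean : forall mu i : nat, 'E_P[X mu i]%E = lambda%:E)
  (X_var : forall mu i : nat, (0 < 'V_P[X mu i] < +oo)%E).

Definition centered (w : Omega) : arrayT R := fun i j => X i j w - lambda.

Let Z := centered.

Lemma centered_iid : exists mu, iid_array P mu Z.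
Proof.
have mphi : measurable_fun setT (fun r : R => r - lambda) by exact: measurable_funB.
by eexists; exact: (iid_map (array_of_iid X_indep X_ident) mphi).
Qed.

Lemma integ_X i j : integ P (X i j).
Proof. exact: expectation_integ (X_mean i j). Qed.

Lemma integ_centered : integ P (fun w => Z w 0 0).
Proof. by apply: integB; [exact: integ_X|exact: integ_cst]. Qed.

Lemma exp_X i j : \int[P]_w X i j w = lambda.
Proof.
by have := X_mean i j; rewrite expectation_Rintegral; [case|exact: integ_X].
Qed.

Lemma centered_mean : \int[P]_w Z w 0 0 = 0.
Proof.
by rewrite expB ?exp_X ?exp_cst ?subrr//; [exact: integ_X|exact: integ_cst].
Qed.

Lemma integ_centered_sqr : integ P (fun w => Z w 0 0 ^+ 2).
Proof.
have /andP[V0 V1] := X_var 0 0.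
have VE : 'V_P[X 0 0]%E = (fine 'V_P[X 0 0])%:E.
  by rewrite fineK// ge0_fin_numE// ltW.
apply: (@expectation_integ _ _ _ _ _ (fine 'V_P[X 0 0])).
  by apply: measurable_funX; exact: integ_measurable integ_centered.
rewrite -VE /variance covariance.unlock X_mean; congr expectation.
Qed.

Lemma lpp_centered w a b m n :
  lpp (translate (fun i j => X i j w) a b) m n =
  lpp (translate (Z w) a b) m n + lambda * (m%:R + n%:R).
Proof.
rewrite -natrD mulr_natr -lppDcst; apply: eq_lpp => i j _ _ _.
by rewrite /translate /Z /centered subrK.
Qed.

Section Shape.
Variable g : R -> R -> R.
Hypothesis g_shape : is_shape_function X g.

Definition boundary_shape s : R := centered_shape g lambda s 1.

Let G := boundary_shape.

Let trunc_err n (s : R) : 0 <= s -> `|(Num.truncn (n%:R * s))%:R - n%:R * s| <= 1 :> R.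
Proof.
move=> s0; have h : 0 <= n%:R * s by rewrite mulr_ge0.
have := truncnS_gt (n%:R * s); have : (Num.truncn (n%:R * s))%:R <= n%:R * s by rewrite truncn_le.
rewrite -natr1 ler_distl => h1 h2; apply/andP; split; lra.
Qed.

Let passage w n (s : R) : (0 < n)%N ->
  last_passage (fun mu i => X mu i w) (Num.truncn (n%:R * s)) (Num.truncn (n%:R * 1 : R)) =
  X 0 0 w + (lpp (Z w) (Num.truncn (n%:R * s)) n + lambda * ((Num.truncn (n%:R * s))%:R + n%:R)).
Proof.
move=> n0; rewrite mulr1 natrK last_passage_lpp ?addn_gt0 ?n0 ?orbT//.
by congr (_ + _); exact: (lpp_centered w 0 0).
Qed.

(** Two bounded discrepancies separate [last_passage] from the centered [lpp]: the weight [y] of the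
    origin and the rounding of [n * s] in the drift. *)
Let passage_err (c y gs : R) n (s : R) : 0 <= s ->
  `|y + (c + lambda * ((Num.truncn (n%:R * s))%:R + n%:R)) - gs * n%:R| + (`|y| + `|lambda|) >=
  `|c - (gs - lambda * (s + 1)) * n%:R|.
Proof.
move=> s0; have h := trunc_err n s0; set t := Num.truncn _ in h *.
have -> : c - (gs - lambda * (s + 1)) * n%:R =
  (y + (c + lambda * (t%:R + n%:R)) - gs * n%:R) - (y + lambda * (t%:R - n%:R * s)) by ring.
apply: le_trans (ler_normB _ _) _; rewrite lerD2l.
apply: le_trans (ler_normD _ _) _; rewrite lerD2l normrM.
by rewrite ler_piMr.
Qed.

Lemma boundary_shape_as s eps : 0 <= s -> 0 < eps ->
  {ae P, forall w, \forall n \near \oo,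
    `|lpp (Z w) (Num.truncn (n%:R * s)) n - G s * n%:R| <= eps * n%:R}.
Proof.
move=> s0 e0; have e20 : 0 < eps / 2 by rewrite divr_gt0.
have [h _] := g_shape s0 ler01.
apply: filterS h => w /cvg_ratioP /(_ _ e20) h.
apply: filterS3 (nbhs_infty_gt 0) (nbhs_infty_ger ((`|X 0 0 w| + `|lambda|) / (eps / 2))) h => n n0 hn.
rewrite passage// => h.
apply: le_trans (passage_err _ (X 0 0 w) _ _ s0) _.
move: hn; rewrite ler_pdivrMr// => hn.
rewrite /G /boundary_shape /centered_shape; lra.
Qed.

Lemma boundary_shape_mean s eps : 0 <= s -> 0 < eps -> \forall n \near \oo,
  `|mean_lpp P Z (Num.truncn (n%:R * s)) n - G s * n%:R| <= eps * n%:R.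
Proof.
move=> s0 e0; have e20 : 0 < eps / 2 by rewrite divr_gt0.
have [_ h] := g_shape s0 ler01.
have [mu iZ] := centered_iid.
have iL m n : integ P (fun w => lpp (Z w) m n) by exact: (integ_lpp iZ _ _ integ_centered).
have E n : (0 < n)%N -> 'E_P[fun w => last_passage (fun mu i => X mu i w)
      (Num.truncn (n%:R * s)) (Num.truncn (n%:R * 1 : R))]%E =
    (lambda + (mean_lpp P Z (Num.truncn (n%:R * s)) n + lambda * ((Num.truncn (n%:R * s))%:R + n%:R)))%:E.
  move=> n0; under [X in expectation _ X]funext do rewrite passage//.
  have ic c : integ P (fun w => lpp (Z w) (Num.truncn (n%:R * s)) n + c).
    by apply: integD => //; exact: integ_cst.
  rewrite expectation_Rintegral; last by apply: integD => //; exact: integ_X.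
  rewrite expD//; last exact: integ_X.
  by rewrite exp_X expD ?exp_cst//; exact: integ_cst.
have {}h : n%:R^-1 * (lambda + (mean_lpp P Z (Num.truncn (n%:R * s)) n +
    lambda * ((Num.truncn (n%:R * s))%:R + n%:R))) @[n --> \oo] --> g s 1.
  suff h2 : (n%:R^-1 * (lambda + (mean_lpp P Z (Num.truncn (n%:R * s)) n +
    lambda * ((Num.truncn (n%:R * s))%:R + n%:R))))%:E @[n --> \oo] --> (g s 1)%:E.
    exact: (fine_cvg h2).
  apply: cvg_trans h; apply: near_eq_cvg.
  by near=> n; rewrite /= EFinM E //; near: n; exact: nbhs_infty_gt.
have {}h := (cvg_ratioP _ _).1 h _ e20.
apply: filterS3 (nbhs_infty_gt 0) (nbhs_infty_ger ((`|lambda| + `|lambda|) / (eps / 2))) h => n n0 hn h.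
apply: le_trans (passage_err _ lambda _ _ s0) _.
move: hn; rewrite ler_pdivrMr// => hn.
rewrite /G /boundary_shape /centered_shape; lra.
Unshelve. all: by end_near.
Qed.

Variables (M nu : nat -> nat) (kappa tau : R).
Hypotheses (nu_range : forall N, (1 <= N)%N -> (1 <= nu N <= M N)%N)
  (kappa_ge0 : 0 <= kappa) (tau_range : 0 <= tau <= 1)
  (M_asymp : (fun N => (M N)%:R : R^o) =
     (fun N => kappa * N%:R : R^o) +o_\oo (fun N => N%:R : R^o))
  (nu_asymp : (fun N => (nu N)%:R : R^o) =
     (fun N => tau * (M N)%:R : R^o) +o_\oo (fun N => (M N)%:R : R^o)).

Let T N w := makespan N (nu N) (fun mu i => X mu i w) (M N).
Let l := G (kappa * (1 - tau)) + G (kappa * tau) + lambda * (kappa + 1).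

Let tau0 : 0 <= kappa * tau. Proof. by rewrite mulr_ge0//; case/andP: tau_range. Qed.
Let tau1 : 0 <= kappa * (1 - tau).
Proof. by rewrite mulr_ge0// subr_ge0; case/andP: tau_range. Qed.

(** The two paths have [M - nu + N] and [nu + N - 1] vertices and the subtracted row has [N], which
    leaves a drift of [M + N - 1] means. *)
Lemma makespan_centered N w : (0 < N)%N ->
  T N w = Z w (nu N) 1%N + lpp (translate (Z w) (nu N) 1) (M N - nu N) N.-1 +
    (Z w 1%N 1%N + lpp (translate (Z w) 1 1) (nu N).-1 N.-1) -
    \sum_(1 <= j < N.+1) Z w (nu N) j + lambda * ((M N)%:R + N%:R - 1).
Proof.
move=> N0; have nuM := nu_range N0; rewrite /T makespan_lpp// !lpp_centered.
have /andP[n0 nM] := nuM; rewrite natrB//.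
have NE (n : nat) : (0 < n)%N -> n.-1%:R = n%:R - 1 :> R.
  by move=> n_gt0; rewrite -[in RHS](prednK n_gt0) -natr1 addrK.
rewrite !NE//.
have -> : \sum_(1 <= j < N.+1) X (nu N) j w =
    \sum_(1 <= j < N.+1) Z w (nu N) j + lambda * N%:R.
  have -> : lambda * N%:R = \sum_(1 <= j < N.+1) lambda.
    by rewrite sumr_const_nat subSS subn0 mulr_natr.
  by rewrite -big_split; apply: eq_bigr => j _; rewrite /= /Z /centered subrK.
by rewrite /Z /centered; ring.
Qed.

Let drift eps : 0 < eps -> \forall N \near \oo,
  `|lambda * ((M N)%:R + N%:R - 1) - lambda * (kappa + 1) * N%:R| <= eps * N%:R.
Proof.
move=> e0; have l1 : 0 < `|lambda| + 1 by rewrite ltr_wpDl.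
have e20 : 0 < eps / 2 / (`|lambda| + 1) by rewrite !divr_gt0.
apply: filterS2 (nbhs_infty_ger (eps / 2 / (`|lambda| + 1))^-1) (machines_lim M_asymp e20) => N hN hM.
have -> : lambda * ((M N)%:R + N%:R - 1) - lambda * (kappa + 1) * N%:R =
  lambda * (((M N)%:R - kappa * N%:R) - 1) by ring.
rewrite normrM; apply: (@le_trans _ _ ((`|lambda| + 1) * (eps / (`|lambda| + 1) * N%:R))); last first.
  by rewrite mulrA mulrCA mulfV ?mulr1// gt_eqF.
apply: ler_pM => //; first by rewrite lerDl.
apply: le_trans (ler_normB _ _) _; rewrite normr1.
have : 1 <= eps / 2 / (`|lambda| + 1) * N%:R by rewrite mulrC -ler_pdivrMr ?div1r.
have -> : eps / (`|lambda| + 1) * N%:R = eps / 2 / (`|lambda| + 1) * N%:R + eps / 2 / (`|lambda| + 1) * N%:R.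
  by field; rewrite gt_eqF.
lra.
Qed.

Lemma makespan_as : {ae P, forall w, N%:R^-1 * T N w @[N --> \oo] --> l}.
Proof.
apply: ae_cvg_ratio => eps eps0; pose e := eps / 4.
have e0 : 0 < e by rewrite divr_gt0.
have [mu iZ] := centered_iid.
have [Z1 Z2 Z0] := And3 integ_centered integ_centered_sqr centered_mean.
have [C nuC] := fiducial_bound nu_range M_asymp.
have above := corner_lim iZ Z1 Z2 Z0 boundary_shape_mean boundary_shape_as
  nuC tau1 (above_lim nu_range kappa_ge0 tau_range M_asymp nu_asymp) e0.
(* The backward half starts at the fixed corner [(1, 1)], treated as a constant moving corner. *)
have one : \forall N \near \oo, (1 <= 1 * N)%N.
  by apply: filterS (nbhs_infty_gt 0) => N; rewrite mul1n.
have below := corner_lim iZ Z1 Z2 Z0 boundary_shape_mean boundary_shape_as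
  one tau0 (below_lim nu_range kappa_ge0 tau_range M_asymp nu_asymp) e0.
(* The fiducial row changes with [N], so its sum calls for the strong law over moving cells. *)
pose c N := [seq (nu N, j) | j <- iota 1 N].
have uc N : uniq (c N) by rewrite map_inj_uniq ?iota_uniq// => i j [].
have sc N : (size (c N) <= 1 * N)%N by rewrite size_map size_iota mul1n.
have row := strong_law iZ (@measurable_id _ _ setT) Z1 Z2 uc sc e0.
apply: filterS3 above below row => w above below row.
have dr := drift e0.
near=> N.
have N0 : (0 < N)%N by near: N; exact: nbhs_infty_gt.
have aboveN : `|Z w (nu N) 1%N + lpp (translate (Z w) (nu N) 1) (M N - nu N) N.-1 -
  G (kappa * (1 - tau)) * N%:R| <= e * N%:R by near: N.
have belowN : `|Z w 1%N 1%N + lpp (translate (Z w) 1 1) (nu N).-1 N.-1 -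
  G (kappa * tau) * N%:R| <= e * N%:R by near: N.
have rowN : `|\sum_(z <- c N) Z w z.1 z.2 - (size (c N))%:R * \int[P]_w0 Z w0 0 0|
  <= e * N%:R by near: N.
rewrite Z0 mulr0 subr0 big_map /= in rowN.
have drN : `|lambda * ((M N)%:R + N%:R - 1) - lambda * (kappa + 1) * N%:R| <= e * N%:R.
  by near: N.
rewrite makespan_centered// /index_iota subSS subn0 /l.
have e4 : eps * N%:R = 4 * (e * N%:R) by rewrite /e; field.
move: aboveN belowN rowN drN; rewrite !ler_norml.
move=> /andP[a1 a2] /andP[b1 b2] /andP[r1 r2] /andP[d1 d2].
apply/andP; split; lra.
Unshelve. all: by end_near.
Qed.

Lemma makespan_mean : ((N%:R^-1)%:E * 'E_P[T N])%E @[N --> \oo] --> l%:E.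
Proof.
have [mu iZ] := centered_iid.
have [Z1 Z2 Z0] := And3 integ_centered integ_centered_sqr centered_mean.
pose a := mean_lpp P Z.
have iij i j : integ P (fun w => Z w i j) by exact: (@integ_coord _ _ _ _ _ _ iZ id).
have Eij i j : \int[P]_w Z w i j = 0 by rewrite (@exp_coord _ _ _ _ _ _ iZ id).
have icorner i j m n : integ P (fun w => Z w i j + lpp (translate (Z w) i j) m n).
  apply: integD => //; apply: (@integ_translate _ _ _ _ _ _ iZ (fun x => lpp x m n)).
    exact: measurable_lpp.
  exact: (integ_lpp iZ).
have Ecorner i j m n : \int[P]_w (Z w i j + lpp (translate (Z w) i j) m n) = a m n.
  rewrite expD//; last first.
    apply: (@integ_translate _ _ _ _ _ _ iZ (fun x => lpp x m n)); first exact: measurable_lpp.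
    exact: (integ_lpp iZ).
  rewrite Eij add0r.
  exact: (@exp_translate _ _ _ _ _ _ iZ (fun x => lpp x m n) i j (measurable_lpp m n)).
have ET N : (0 < N)%N -> 'E_P[T N]%E =
    (a (M N - nu N)%N N.-1 + a (nu N).-1 N.-1 + lambda * ((M N)%:R + N%:R - 1))%:E.
  move=> N0.
  have irow : integ P (fun w => \sum_(1 <= j < N.+1) Z w (nu N) j) by exact: integ_sum.
  have -> : T N = fun w => Z w (nu N) 1%N + lpp (translate (Z w) (nu N) 1) (M N - nu N) N.-1 +
    (Z w 1%N 1%N + lpp (translate (Z w) 1 1) (nu N).-1 N.-1) -
    \sum_(1 <= j < N.+1) Z w (nu N) j + lambda * ((M N)%:R + N%:R - 1).
    by apply/funext => w; rewrite makespan_centered.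
  have i1 := integD (icorner (nu N) 1%N (M N - nu N)%N N.-1) (icorner 1%N 1%N (nu N).-1 N.-1).
  have i2 := integB i1 irow.
  rewrite expectation_Rintegral; last by apply: integD => //; exact: integ_cst.
  rewrite expD//; last exact: integ_cst.
  have row0 : \int[P]_w \sum_(1 <= j < N.+1) Z w (nu N) j = 0.
    by rewrite exp_sum// big1// => j _; exact: Eij.
  by rewrite expB// expD// !Ecorner exp_cst row0 subr0.
have above e (e0 : 0 < e) := mean_lpp_lim iZ Z1 Z2 Z0 boundary_shape_mean tau1 e0
  (above_lim nu_range kappa_ge0 tau_range M_asymp nu_asymp).
have below e (e0 : 0 < e) := mean_lpp_lim iZ Z1 Z2 Z0 boundary_shape_mean tau0 e0
  (below_lim nu_range kappa_ge0 tau_range M_asymp nu_asymp).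
have h : N%:R^-1 * (a (M N - nu N)%N N.-1 + a (nu N).-1 N.-1 +
    lambda * ((M N)%:R + N%:R - 1)) @[N --> \oo] --> l.
  apply/cvg_ratioP => eps eps0; pose e := eps / 3.
  have e0 : 0 < e by rewrite divr_gt0.
  apply: filterS3 (above _ e0) (below _ e0) (drift e0) => N.
  rewrite !ler_norml -/a /l => /andP[a1 a2] /andP[b1 b2] /andP[d1 d2].
  have e3 : eps * N%:R = 3 * (e * N%:R) by rewrite /e; field.
  apply/andP; split; lra.
apply: (cvg_EFin (f := fun N => ((N%:R^-1)%:E * 'E_P[T N])%E)).
  by near=> N; rewrite ET//; near: N; exact: nbhs_infty_gt.
apply: cvg_trans h; apply: near_eq_cvg.
by near=> N; rewrite /= ET//; near: N; exact: nbhs_infty_gt.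
Unshelve. all: by end_near.
Qed.

End Shape.
End Flowshop.

Theorem theorem4p1 (R : realType) (d : measure_display)
  (Omega : measurableType d) (P : probability Omega R)
  (X : nat -> nat -> {RV P >-> R}) (F : R -> \bar R) (lambda : R)
  (X_indep : mutually_independent X)
  (X_ident : forall (mu i : nat) (r : R), cdf (X mu i) r = F r)
  (X_mean : forall mu i : nat, 'E_P[X mu i]%E = lambda%:E)
  (X_var : forall mu i : nat, (0 < 'V_P[X mu i] < +oo)%E)
  (g : R -> R -> R) (g_shape : is_shape_function X g)
  (M nu : nat -> nat) (kappa tau : R)
  (nu_range : forall N : nat, (1 <= N)%N -> (1 <= nu N <= M N)%N)
  (kappa_ge0 : 0 <= kappa) (tau_range : 0 <= tau <= 1)
  (M_asymp : (fun N => (M N)%:R : R^o) =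
     (fun N => kappa * N%:R : R^o) +o_\oo (fun N => N%:R : R^o))
  (nu_asymp : (fun N => (nu N)%:R : R^o) =
     (fun N => tau * (M N)%:R : R^o) +o_\oo (fun N => (M N)%:R : R^o)) :
  let T (N : nat) (w : Omega) : R :=
    makespan N (nu N) (fun mu i => X mu i w) (M N) in
  let gt := centered_shape g lambda in
  let l := g (kappa * (1 - tau)) 1 + g (kappa * tau) 1 - lambda in
  [/\ {ae P, forall w, (N%:R^-1 * T N w) @[N --> \oo] --> l},
      ((N%:R^-1)%:E * 'E_P[T N])%E @[N --> \oo] --> l%:E
    & l = gt (kappa * (1 - tau)) 1 + gt (kappa * tau) 1 + lambda * (kappa + 1)].
Proof.
set l' := boundary_shape lambda g (kappa * (1 - tau)) +
  boundary_shape lambda g (kappa * tau) + lambda * (kappa + 1).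
move=> T gt l; have lE : l = l'.
  by rewrite /l /l' /boundary_shape /centered_shape; ring.
split; last exact: lE.
- rewrite lE; exact: (makespan_as X_indep X_ident X_mean X_var g_shape nu_range
    kappa_ge0 tau_range M_asymp nu_asymp).
- rewrite lE; exact: (makespan_mean X_indep X_ident X_mean X_var g_shape nu_range
    kappa_ge0 tau_range M_asymp nu_asymp).
Qed.
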